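(* Let $p\in(0,1)$ and $q=1-p$. For $\nu_{\mathsf{pf}}$-almost every tiling $\mathcal{T}$ in the geometric hull $\mathbb{Y}_\rho$ of the random period doubling substitution $\rho$, with $\Lambda=\Lambda_a\,\dot\cup\,\Lambda_b$ the set of left endpoints of the tiles of $\mathcal{T}$, the diffraction measure of the Dirac comb $\delta_{\Lambda_a}$ (that is, with weights $u_a=1$ and $u_b=0$) reads \[ \widehat{\gamma}\,=\,\widehat{\gamma}_{\mathsf{pp}}+\widehat{\gamma}_{\mathsf{ac}}\,=\sum_{k\in\mathbb{Z}[1/2]}I_p(k)\,\delta_k\,+\,\phi_p\,\lambda , \] where $\lambda$ is Lebesgue measure, where for $k=\frac{m}{2^r}$ (with $r=0$, $m\in\mathbb{Z}$, or $r\ge1$, $m$ odd) \[ I_p\bigl(\tfrac{m}{2^r}\bigr)=\frac{1}{9\cdot4^{r-1}}\prod_{\ell=1}^{r}\bigl|q+p\,e^{-2^\ell\pi i\frac{m}{2^r}}\bigr|^2 , \] and where \[ \phi_p(k)=\frac{4pq}{3}\sum_{n=1}^{\infty}\frac{1-\cos(2^n\pi k)}{2^n}\prod_{j=1}^{n-1}\bigl|q+p\,e^{-2^j\pi i k}\bigr|^2 \] (empty products being $1$).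
   Context: Random period doubling substitution: on the alphabet $\{a,b\}$, $\rho$ maps $a\mapsto ab$ with probability $p$ and $a\mapsto ba$ with probability $q$, and $b\mapsto aa$; it is applied independently to every letter of a word and independently in each iteration step. A finite word is legal if it is a subword of some realisation of $\rho^k(a)$ for some $k\in\mathbb{N}$. $\mathbb{X}_\rho\subset\{a,b\}^{\mathbb{Z}}$ is the set of bi-infinite sequences all of whose finite subwords are legal. Geometric hull: letters $a$, $b$ are replaced by two distinct (coloured) prototiles, both intervals of length $1$, with the left endpoint of the tile at position $0$ of the sequence placed at $0\in\mathbb{R}$; $\mathbb{Y}_\rho$ is the set of all translates by $t\in\mathbb{R}$ of tilings so obtained from elements of $\mathbb{X}_\rho$, with the local topology. $\Lambda_a$, $\Lambda_b$ are the left endpoints of tiles of type $a$, $b$. Patch frequency measure: $\nu_{\mathsf{pf}}$ is the translation-invariant, ergodic probability measure on $\mathbb{Y}_\rho$ obtained, as the normalised suspension measure (constant roof function $1$), from the shift-invariant probability measure on $\mathbb{X}_\rho$ giving the cylinder set of each legal word $w$ the mass $\lim_{n\to\infty}2^{-n}\,\mathbb{E}(\text{number of occurrences of }w\text{ in }\rho^n(a))$. Diffraction measure: fix a sequence of intervals $B_n\subset\mathbb{R}$ centred at $0$ with $B_n\subset B_{n+1}$ and $\operatorname{vol}(B_n)\to\infty$. The diffraction measure of $\delta_{\Lambda_a}$ is the Fourier transform (kernel $e^{-2\pi i kx}$) of the autocorrelation $\lim_{n\to\infty}\frac{1}{\operatorname{vol}(B_n)}\sum_{x,y\in\Lambda_a\cap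 B_n}\delta_{x-y}$ (vague limit). $\mathbb{Z}[1/2]$ is the set of dyadic rationals. *)

(* Defs.v *)
From HB Require Import structures.
From mathcomp Require Import all_boot all_order all_algebra.
From mathcomp Require Import all_classical all_reals all_analysis.
From mathcomp Require Import complex.

Set Implicit Arguments.
Unset Strict Implicit.
Unset Printing Implicit Defensive.

Import Order.TTheory GRing.Theory Num.Theory.
Import numFieldNormedType.Exports.

Local Open Scope classical_set_scope.
Local Open Scope ring_scope.
Local Open Scope complex_scope.

(* The alphabet {a, b}. *)
Notation letter := bool.
Notation la := true (only parsing).
Notation lb := false (only parsing).
Notation word := (seq bool).

Section RandomSubstitution.
Context {R : realType}.
Implicit Types (p : R) (u v w : word).

(* Probability that the image of the letter c is v. *)
Definition letter_prob p (c : letter) v : R :=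
  if c == la then
    if v == [:: la; lb] then p
    else if v == [:: lb; la] then 1 - p else 0
  else (v == [:: la; la])%:R.

(* Probability that the image of u is v: the letters of u are substituted
   independently, and every image of a letter has length 2. *)
Fixpoint subst_prob p u v : R :=
  if u is c :: u' then letter_prob p c (take 2 v) * subst_prob p u' (drop 2 v)
  else (v == [::])%:R.

(* Law of rho^n(a), a random word of length 2^n. *)
Fixpoint law_iter p n v : R :=
  if n is n'.+1 then
    \sum_(u : (2 ^ n').-tuple letter) law_iter p n' u * subst_prob p u v
  else (v == [:: la])%:R.

Definition legal p w := exists n v, 0 < law_iter p n v /\ infix w v.

Definition occurrences w v : nat :=
  count (fun i => prefix w (drop i v)) (iota 0 (size v)).

Definition expected_occurrences p w n : R :=
  \sum_(v : (2 ^ n).-tuple letter) law_iter p n v * (occurrences w v)%:R.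

End RandomSubstitution.

Definition window (x : int -> letter) (m : int) (n : nat) : word :=
  mkseq (fun i => x (m + i%:Z)) n.

Definition X_rho {R : realType} (p : R) : set (int -> letter) :=
  [set x | forall m n, legal p (window x m n)].

Definition cylinder (m : int) (w : word) : set (int -> letter) :=
  [set x | window x m (size w) = w].

Definition shift (x : int -> letter) : int -> letter := fun n => x (n + 1).

Definition cylinders : set (set (int -> letter)) :=
  [set A | exists m w, A = cylinder m w].

(* {a,b}^Z; the cylinders generate its Borel (product) sigma-algebra. *)
Notation full_shift := (g_sigma_algebraType cylinders).

(* A tiling by coloured unit intervals, encoded as the set of the pairs
   (left endpoint, colour) of its tiles. *)
Notation tiling R := (set (R * letter)).

Section GeometricHull.
Context {R : realType}.

Definition translate (t : R) (T : tiling R) : tiling R :=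
  [set z | T (z.1 - t, z.2)].

Definition tiling_of (x : int -> letter) : tiling R :=
  [set z | exists n : int, z = (n%:~R, x n)].

Definition geometric_hull (p : R) : set (tiling R) :=
  [set T | exists x t, X_rho p x /\ T = translate t (tiling_of x)].

Definition left_endpoints (T : tiling R) (c : letter) : set R :=
  [set y | T (y, c)].

(* After a translation by at most eps, the two tilings have the same tiles
   among those meeting [- 1 / eps, 1 / eps]. *)
Definition local_close (eps : R) (T T' : tiling R) := exists s : R,
  `|s| <= eps /\
  forall z : R * letter, `[z.1, z.1 + 1] `&` `[- eps^-1, eps^-1] !=set0 ->
    (T' z <-> translate s T z).

(* Open sets of the local topology on the geometric hull. *)
Definition hull_open (p : R) : set (set (tiling R)) :=
  [set A | A `<=` geometric_hull p /\ forall T, A T ->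
     exists2 eps : R, 0 < eps & forall T', geometric_hull p T' ->
       local_close eps T T' -> A T'].

End GeometricHull.

Notation hull_space p := (g_sigma_algebraType (hull_open p)).

Section PatchFrequencyMeasure.
Context {R : realType}.

(* The shift-invariant measure on X_rho which is suspended below. *)
Definition is_word_frequency_measure (p : R)
    (mu : probability full_shift R) :=
  [/\ mu (X_rho p) = 1%E,
      forall A : set full_shift, measurable A -> mu (shift @^-1` A) = mu A
    & forall w, legal p w ->
        ((2 ^- n * expected_occurrences p w n)%:E @[n --> \oo]
           --> mu (cylinder 0 w))].

(* The suspension with constant roof function 1. *)
Definition is_patch_frequency_measure (p : R)
    (nu : probability (hull_space p) R) :=
  exists2 mu : probability full_shift R, is_word_frequency_measure p mu &
  forall A : set (hull_space p), measurable A ->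
    nu A = (mu \x @lebesgue_measure R)%E
      [set xt | 0 <= xt.2 < 1 /\ A (translate xt.2 (tiling_of xt.1))].

End PatchFrequencyMeasure.

Section Diffraction.
Context {R : realType}.
Implicit Types (mu gamma : {measure set (measurableTypeR R) -> \bar R}).

Definition vol (A : set R) : R := fine (@lebesgue_measure R A).

(* Bounded intervals with midpoint 0, with or without their endpoints. *)
Definition centred_interval (A : set R) :=
  is_interval A /\
  exists2 r : R, 0 <= r & `]- r, r[ `<=` A /\ A `<=` `[- r, r].

Definition averaging_sequence (B : nat -> set R) :=
  [/\ forall n, centred_interval (B n),
      forall n, B n `<=` B n.+1
    & vol (B n) @[n --> \oo] --> +oo].

Definition locally_finite mu := forall K : set R, compact K -> (mu K < +oo)%E.

(* gamma is the vague limit of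
   vol(B_n)^-1 * \sum_(x, y in L `&` B_n) \d_(x - y). *)
Definition is_autocorrelation (B : nat -> set R) (L : set R) gamma :=
  locally_finite gamma /\
  forall f : R -> R, continuous f ->
    (exists r : R, forall x, r < `|x| -> f x = 0) ->
    ((vol (B n))^-1 *
       \sum_(z \in (L `&` B n) `*` (L `&` B n)) f (z.1 - z.2)) @[n --> \oo]
    --> \int[gamma]_x f x.

Definition schwartz_real (f : R -> R) :=
  (forall n (x : R), derivable (derive1n n f) x 1) /\
  (forall m n, exists C : R, forall x, `|x ^+ m * derive1n n f x| <= C).

Definition schwartz (g : R -> complex R) :=
  schwartz_real (fun x => complex.Re (g x)) /\ schwartz_real (fun x => complex.Im (g x)).

Definition cintegrable mu (f : R -> complex R) :=
  mu.-integrable setT (fun x => (complex.Re (f x))%:E) /\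
  mu.-integrable setT (fun x => (complex.Im (f x))%:E).

Definition cintegral mu (f : R -> complex R) : complex R :=
  (\int[mu]_x complex.Re (f x)) +i* (\int[mu]_x complex.Im (f x)).

(* e^(i theta) *)
Definition expi (theta : R) : complex R := cos theta +i* sin theta.

Definition fourier (g : R -> complex R) (k : R) : complex R :=
  cintegral (@lebesgue_measure R)
    (fun x => expi (- (2 * pi * k * x)) * g x).

(* Fourier transform of gamma as a tempered distribution; the transform is
   required to be a positive measure. *)
Definition is_fourier_transform gamma gammahat :=
  forall g, schwartz g ->
  [/\ cintegrable gamma (fourier g), cintegrable gammahat g
    & cintegral gammahat g = cintegral gamma (fourier g)].

(* Both measures are unique when they exist. *)
Definition is_diffraction (B : nat -> set R) (L : set R) gammahat :=
  exists2 gamma, is_autocorrelation B L gamma &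
                 is_fourier_transform gamma gammahat.

Definition pure_point mu := exists2 S : set R, countable S & mu (~` S) = 0%E.

End Diffraction.

Section Intensities.
Context {R : realType}.
Implicit Types (p k : R).

(* |q + p e^(- 2^l pi i k)|^2 with q = 1 - p *)
Definition phase_factor p k (l : nat) : R :=
  Normc.normc ((1 - p)%:C + p%:C * expi (- (2 ^+ l * pi * k))) ^+ 2.

(* Z[1/2]; the reduced form of k is numq k / denq k. *)
Definition dyadic : set rat := [set k | exists r : nat, denq k = 2 ^+ r].

Definition dyadic_exponent (k : rat) : nat := logn 2 `|denq k|%N.

Definition I_pp p (k : rat) : R :=
  let r := dyadic_exponent k in
  (9 * 4 ^ (r%:Z - 1))^-1 * \prod_(1 <= l < r.+1) phase_factor p (ratr k) l.

Definition phi_ac p k : R :=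
  4 * p * (1 - p) / 3 *
  limn (fun N => \sum_(1 <= n < N)
    (1 - cos (2 ^+ n * pi * k)) / 2 ^+ n *
    \prod_(1 <= j < n) phase_factor p k j).

End Intensities.

(* Main.v *)
From HB Require Import structures.
Require Import Defs.
From mathcomp Require Import all_boot all_order all_algebra.
From mathcomp Require Import all_classical all_reals all_analysis.
From mathcomp Require Import complex measurable_realfun zify ring lra.

Set Implicit Arguments.
Unset Strict Implicit.
Unset Printing Implicit Defensive.

Import Order.TTheory GRing.Theory Num.Theory.
Import numFieldNormedType.Exports.

Local Open Scope classical_set_scope.
Local Open Scope ring_scope.

(** Write [eta m] for the frequency with which two sites at distance [m] both
carry the letter a. Two facts about this sequence carry the proof: it is the
limit of the pair counts along almost every tiling, so that the
autocorrelation is the sum over the integers m of [eta |m|] times the unit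
mass at m; and it satisfies a recursion which is inherited from the
substitution and determines the Fourier transform.

The recursion. Sites 2i and 2i+1 of the image of a word depend on the letter
at site i and on a choice made independently there. Averaging an observable
of two letters over the image therefore expresses [eta] at 2j by [eta] at j,
and [eta] at 2j+1 by [eta] at j and j+1 ([pair_mean_even],
[pair_mean_odd]). At the distances 0 and 1 both letters may come from one
and the same site, and the values there differ from the general pattern
([pair_mean_0], [pair_mean_1]). These defects are what creates the absolutely
continuous part.

The almost sure limit. The measure on sequences is given by limits of
expected word counts only. Cut a long word into the images of single letters
under a high power of the substitution: conditionally on those letters the
blocks are independent, and the mean of a block per site is close to the
limit whatever its letter is. So the variance over N sites is of order N, and
a deviation has frequency of order 1/N ([deviation_bound]). Summing over
squares and interpolating gives almost sure convergence ([ae_generic]), which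
[ae_lifted] carries to the hull and [autocorrelation_cvg] turns into the
convergence of the averaged sums over pairs of points.

The Fourier transform. For a test function f let c_m be the integral of
f(x) cos(2 pi m x); the Fourier transform of f is paired with the
autocorrelation as the sum of [eta |m|] c_m. Inserting the recursion
([pair_series_step]) splits this into one third of the sum of all c_m, a
multiple of the integral of (1 - cos(2 pi x)) f(x), which comes from the
defects, and one quarter of the same expression for T f, where
T f(y) = |q + p e^(- pi i y)|^2 f(y / 2) is [transfer]. By Poisson summation
([poisson_summation]) the first sum is that of f(j) over the integers. The
coefficients of T f have at most twice the absolute sum of those of f, so on
iterating the remainder is of order 2^-n and disappears. The i-th step gives
the masses at j / 2^i with weights (3 4^i)^-1 times a product of i phase
factors, and the i-th term of the density ([pair_series_decomposition]). A
dyadic number with reduced denominator 2^r receives mass from all steps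
i >= r; the phase factors beyond the r-th are 1 there, and the geometric
series of the weights sums to the stated intensity ([I_pp_series]). *)

(** * Expectations under the random substitution *)

Section WordExpectation.
Context {R : realType} (p : R).
Implicit Types (u v w : word) (f g : word -> R) (k n : nat).

(** The expectation is taken as a functional on observables, by recursion on
the word, because independence of the letters then becomes the composition
rule [subst_exp_cat]. *)
Fixpoint subst_exp u f : R :=
  if u is c :: u' then
    if c then p * subst_exp u' (fun v => f [:: true, false & v])
              + (1 - p) * subst_exp u' (fun v => f [:: false, true & v])
    else subst_exp u' (fun v => f [:: true, true & v])
  else f [::].

Fixpoint iter_exp k u f : R :=
  if k is k'.+1 then subst_exp u (fun v => iter_exp k' v f) else f u.

(** The functionals below are expectations of laws with finite support on
words of a fixed length; linearity, monotonicity and interchange of two of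
them are all read off from such a representation. *)
Definition finite_law (s : seq (R * word)) (n : nat) (E : (word -> R) -> R) :=
  [/\ forall z, z \in s -> 0 <= z.1 /\ size z.2 = n,
      \sum_(z <- s) z.1 = 1 &
      forall f, E f = \sum_(z <- s) z.1 * f z.2].

Hypothesis hp : 0 <= p <= 1.

Lemma subst_exp_law u : exists s, finite_law s (2 * size u) (subst_exp u).
Proof.
have [p0 p1] := andP hp.
elim: u => [|c u [s [s0 s1 sE]]].
  exists [:: (1, [::])]; split => [z||f].
  - by rewrite inE => /eqP ->.
  - by rewrite big_seq1.
  - by rewrite big_seq1 mul1r.
have sz z : z \in s -> size z.2 = (2 * size u)%N by move=> /s0[].
case: c.
  exists ([seq (p * z.1, [:: true, false & z.2]) | z <- s] ++
          [seq ((1 - p) * z.1, [:: false, true & z.2]) | z <- s]); split => [z||f].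
  - rewrite mem_cat => /orP[] /mapP[y ys ->] /=; have [y0 ->] := s0 _ ys.
      by split; [rewrite mulr_ge0|rewrite /=; lia].
    by split; [rewrite mulr_ge0// subr_ge0|rewrite /=; lia].
  - by rewrite big_cat !big_map /= -!mulr_sumr s1; ring.
  - rewrite /= big_cat !big_map /= !sE !mulr_sumr.
    by congr (_ + _); apply: eq_bigr => z _; rewrite mulrA.
exists [seq (z.1, [:: true, true & z.2]) | z <- s]; split => [z||f].
- move=> /mapP[y ys ->] /=; have [y0 ->] := s0 _ ys.
  by split => //; lia.
- by rewrite big_map.
- by rewrite /= big_map /= sE.
Qed.

Lemma iter_exp_law k u :
  exists s, finite_law s (2 ^ k * size u) (iter_exp k u).
Proof.
elim: k u => [|k IH] u.
  exists [:: (1, u)]; split => [z||f].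
  - by rewrite inE => /eqP -> /=; rewrite mul1n.
  - by rewrite big_seq1.
  - by rewrite big_seq1 mul1r.
have [S HS] := choice IH.
have [s [s0 s1 sE]] := subst_exp_law u.
exists [seq (z.1 * y.1, y.2) | z <- s, y <- S z.2]; split => [z||f].
- move=> /allpairsPdep[y [x [ys xs ->]]] /=.
  have [y0 sy] := s0 _ ys; have [H _ _] := HS y.2; have [x0 sx] := H _ xs.
  split; first exact: mulr_ge0.
  by rewrite sx sy expnSr mulnA.
- rewrite big_allpairs_dep /= -[RHS]s1; apply: eq_bigr => z _.
  by rewrite -mulr_sumr; have [_ -> _] := HS z.2; rewrite mulr1.
- rewrite big_allpairs_dep /= sE; apply: eq_bigr => z _.
  have [_ _ ->] := HS z.2; rewrite mulr_sumr.
  by apply: eq_bigr => y _; rewrite mulrA.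
Qed.

Lemma iter_exp_le k u f g :
  (forall v, size v = (2 ^ k * size u)%N -> f v <= g v) ->
  iter_exp k u f <= iter_exp k u g.
Proof.
have [s [s0 s1 sE]] := iter_exp_law k u => fg.
rewrite !sE !big_seq; apply: ler_sum => z zs.
by have [z0 sz] := s0 _ zs; rewrite ler_wpM2l// fg.
Qed.

Lemma eq_iter_exp k u f g :
  (forall v, size v = (2 ^ k * size u)%N -> f v = g v) ->
  iter_exp k u f = iter_exp k u g.
Proof.
by move=> fg; apply/eqP; rewrite eq_le !iter_exp_le// => v /fg ->.
Qed.

Lemma iter_exp_cst k u c : iter_exp k u (fun=> c) = c.
Proof.
have [s [s0 s1 sE]] := iter_exp_law k u.
by rewrite sE -mulr_suml s1 mul1r.
Qed.

Lemma iter_expD k u f g :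
  iter_exp k u (fun v => f v + g v) = iter_exp k u f + iter_exp k u g.
Proof.
have [s [s0 s1 sE]] := iter_exp_law k u.
by rewrite !sE -big_split; apply: eq_bigr => z _; rewrite mulrDr.
Qed.

Lemma iter_expZ k u c f :
  iter_exp k u (fun v => c * f v) = c * iter_exp k u f.
Proof.
have [s [s0 s1 sE]] := iter_exp_law k u.
by rewrite !sE mulr_sumr; apply: eq_bigr => z _; rewrite mulrCA.
Qed.

Lemma iter_exp_sum k u (I : Type) (r : seq I) (P : pred I) (F : I -> word -> R) :
  iter_exp k u (fun v => \sum_(i <- r | P i) F i v) =
  \sum_(i <- r | P i) iter_exp k u (F i).
Proof.
have [s [s0 s1 sE]] := iter_exp_law k u.
under [RHS]eq_bigr => i _ do rewrite sE.
rewrite sE exchange_big/=; apply: eq_bigr => z _.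
by rewrite mulr_sumr.
Qed.

Lemma iter_exp_exchange k u l w (F : word -> word -> R) :
  iter_exp k u (fun v => iter_exp l w (F v)) =
  iter_exp l w (fun v' => iter_exp k u (F ^~ v')).
Proof.
have [s [s0 s1 sE]] := iter_exp_law k u.
have [t [t0 t1 tE]] := iter_exp_law l w.
rewrite sE tE; under eq_bigr => z _ do rewrite tE mulr_sumr.
under [RHS]eq_bigr => z _ do rewrite sE mulr_sumr.
rewrite exchange_big/=; apply: eq_bigr => z _; apply: eq_bigr => y _.
by rewrite mulrCA.
Qed.

Lemma iter_exp_add j k u f :
  iter_exp (j + k) u f = iter_exp j u (fun v => iter_exp k v f).
Proof. by elim: j u => //= j IH u; congr subst_exp; apply/funext. Qed.

Lemma subst_exp_cat u1 u2 f :
  subst_exp (u1 ++ u2) f =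
  subst_exp u1 (fun v1 => subst_exp u2 (fun v2 => f (v1 ++ v2))).
Proof.
elim: u1 f => //= -[] u1 IH f; rewrite !IH//.
Qed.

(** Independence: the images of the two halves of a word are independent. *)
Lemma iter_exp_cat k u1 u2 f :
  iter_exp k (u1 ++ u2) f =
  iter_exp k u1 (fun v1 => iter_exp k u2 (fun v2 => f (v1 ++ v2))).
Proof.
elim: k u1 u2 f => //= k IH u1 u2 f; rewrite subst_exp_cat.
apply: (@eq_iter_exp 1) => v1 _ /=.
under [LHS](@eq_iter_exp 1) do rewrite IH.
exact: (@iter_exp_exchange 1 u2 k v1).
Qed.

Lemma sum_tupleS (m : nat) (F : word -> R) :
  \sum_(v : m.+1.-tuple letter) F v =
  \sum_(v : m.-tuple letter) F (true :: v) +
  \sum_(v : m.-tuple letter) F (false :: v).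
Proof.
rewrite (reindex (fun z : bool * m.-tuple bool => [tuple of z.1 :: z.2]))/=.
  rewrite -(pair_big xpredT xpredT (fun b (t : m.-tuple bool) => F (b :: t)))/=.
  by rewrite big_bool/=.
exists (fun t => (thead t, [tuple of behead t])) => [[b t] _|t _] /=.
  by congr pair; apply/val_inj.
by rewrite -tuple_eta.
Qed.

(** Connects the functional with the probabilities that define the model; the
length is a separate variable because the sum ranges over tuples. *)
Lemma subst_prob_sum u m f : m = (2 * size u)%N ->
  \sum_(v : m.-tuple letter) subst_prob p u v * f v = subst_exp u f.
Proof.
elim: u m f => [|c u IH] m f /=.
  move=> ->; rewrite (eq_bigr (fun=> f [::])).
    by rewrite sumr_const card_tuple expn0.
  by move=> v _; rewrite tuple0/= mul1r.
rewrite mulnS add2n => ->.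
pose F v := letter_prob p c (take 2 v) * subst_prob p u (drop 2 v) * f v.
rewrite (sum_tupleS _ F) (sum_tupleS _ (fun v => F (true :: v))).
rewrite (sum_tupleS _ (fun v => F (false :: v))) {}/F/=.
under eq_bigr => v _ do rewrite drop0 take0.
under [X in _ + X + _]eq_bigr => v _ do rewrite drop0 take0.
under [X in _ + (X + _)]eq_bigr => v _ do rewrite drop0 take0.
under [X in _ + (_ + X)]eq_bigr => v _ do rewrite drop0 take0.
rewrite /letter_prob/=.
case: c => /=.
- rewrite -!(IH _ _ erefl).
  under eq_bigr do rewrite !mul0r.
  under [X in _ + (_ + X)]eq_bigr do rewrite !mul0r.
  rewrite !big1_eq add0r addr0 !mulr_sumr.
  by congr (_ + _); apply: eq_bigr => v _; rewrite mulrA.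
- rewrite -!(IH _ _ erefl).
  under [X in _ + X + _]eq_bigr do rewrite !mul0r.
  under [X in _ + (X + _)]eq_bigr do rewrite !mul0r.
  under [X in _ + (_ + X)]eq_bigr do rewrite !mul0r.
  rewrite !big1_eq !addr0.
  by apply: eq_bigr => v _; rewrite mul1r.
Qed.

Lemma law_iter_sum n f :
  \sum_(v : (2 ^ n).-tuple letter) law_iter p n v * f v =
  iter_exp n [:: true] f.
Proof.
elim: n f => [|n IH] f.
  rewrite /= (sum_tupleS 0 (fun v => (v == [:: true])%:R * f v))/=.
  rewrite (eq_bigr (fun=> f [:: true])).
    rewrite sumr_const card_tuple expn0.
    rewrite big1 ?addr0// => v _; by rewrite mul0r.
  by move=> v _; rewrite tuple0/= mul1r.
rewrite [LHS]/=; under eq_bigr do rewrite mulr_suml.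
rewrite exchange_big [LHS]/=.
have -> : iter_exp n.+1 [:: true] f = iter_exp (n + 1) [:: true] f by rewrite addn1.
rewrite iter_exp_add -IH; apply: eq_bigr => u _.
under eq_bigr do rewrite -mulrA.
by rewrite -mulr_sumr (@subst_prob_sum u)// size_tuple expnS.
Qed.

Lemma law_iter_ge0 n v : 0 <= law_iter p n v.
Proof.
have [p0 p1] := andP hp.
elim: n v => [|n IH] v /=; first by rewrite ler0n.
apply: sumr_ge0 => u _; rewrite mulr_ge0//.
elim: (tval u) v => [|c s IHs] v /=; first by rewrite ler0n.
rewrite mulr_ge0// /letter_prob; case: ifP => _; last by rewrite ler0n.
by case: ifP => // _; case: ifP => // _; rewrite subr_ge0.
Qed.

(** The mean, per site of the 2^n sites of the n-th iterate, of an observable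
of the suffix that starts at the site. *)
Definition site_mean n (F : word -> R) : R :=
  2 ^- n * iter_exp n [:: true] (fun v => \sum_(i < size v) F (drop i v)).

Lemma eq_site_mean n F G : F =1 G -> site_mean n F = site_mean n G.
Proof. by move=> /funext ->. Qed.

Lemma le_site_mean n F G : (forall v, F v <= G v) ->
  site_mean n F <= site_mean n G.
Proof.
move=> FG; rewrite ler_wpM2l ?invr_ge0 ?exprn_ge0//.
by apply: iter_exp_le => v _; exact: ler_sum.
Qed.

Lemma site_meanD n F G :
  site_mean n (fun v => F v + G v) = site_mean n F + site_mean n G.
Proof.
rewrite /site_mean -mulrDr -iter_expD; congr (_ * _).
by apply: eq_iter_exp => v _; rewrite big_split.
Qed.

Lemma site_meanZ n c F : site_mean n (fun v => c * F v) = c * site_mean n F.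
Proof.
rewrite /site_mean [RHS]mulrCA -(iter_expZ _ _ c); congr (_ * _).
by apply: eq_iter_exp => v _; rewrite mulr_sumr.
Qed.

Lemma site_mean_cst n c : site_mean n (fun=> c) = c.
Proof.
rewrite /site_mean (@eq_iter_exp _ _ _ (fun=> c * 2 ^+ n)).
  by rewrite iter_exp_cst mulrCA mulVf ?mulr1// expf_neq0.
by move=> v ->; rewrite sumr_const card_ord muln1 -natrX mulr_natr.
Qed.

Lemma site_mean_sum n (I : Type) (r : seq I) (P : pred I) (F : I -> word -> R) :
  site_mean n (fun v => \sum_(i <- r | P i) F i v) =
  \sum_(i <- r | P i) site_mean n (F i).
Proof.
rewrite /site_mean -mulr_sumr -iter_exp_sum; congr (_ * _).
by apply: eq_iter_exp => v _; rewrite exchange_big.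
Qed.

Lemma big_ord_block (K N : nat) (F : nat -> R) :
  \sum_(i < K * N) F i = \sum_(j < N) \sum_(s < K) F (K * j + s)%N.
Proof.
elim: N => [|N IH]; first by rewrite muln0 !big_ord0.
rewrite big_ord_recr/= -IH mulnS addnC big_split_ord/=.
by [].
Qed.

(** Sites of the (n+k)-th iterate are the sites of the n-th iterate together
with an offset [s] in the image of the letter there under the k-th power.
Letters to the left of the site do not matter for the suffix. *)
Lemma site_mean_selfsimilar n k F :
  site_mean (n + k) F =
  2 ^- k * \sum_(s < 2 ^ k)
     site_mean n (fun u => iter_exp k u (fun v => F (drop s v))).
Proof.
rewrite -site_mean_sum -/(site_mean _ _) /site_mean iter_exp_add.
rewrite exprD invfM -mulrA mulrCA; congr (_ * (_ * _)).
apply: eq_iter_exp => u _.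
transitivity (iter_exp k u (fun v => \sum_(j < size u) \sum_(s < 2 ^ k)
   F (drop (2 ^ k * j + s) v))).
  apply: eq_iter_exp => v sv.
  by rewrite -(big_ord_block _ _ (fun i => F (drop i v))) -sv.
rewrite iter_exp_sum; apply: eq_bigr => j _; rewrite iter_exp_sum.
apply: eq_bigr => s _.
rewrite -{1}(cat_take_drop j u) iter_exp_cat.
rewrite -[RHS](iter_exp_cst k (take j u)).
apply: eq_iter_exp => v1 sv1; apply: eq_iter_exp => v2 _; congr F.
have -> : (2 ^ k * j + s = size v1 + s)%N.
  by rewrite sv1 size_takel// ltnW.
by rewrite addnC -drop_drop drop_size_cat.
Qed.

End WordExpectation.

(** * Site averages and the recursion for the pair correlations *)

Section SiteMeanLimits.
Context {R : realType} (p : R).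
Hypothesis hp : 0 <= p <= 1.
Implicit Types (u v w : word) (F G : word -> R) (l M C : R).

Definition mean_cvg F l := site_mean p n F @[n --> \oo] --> l.

Lemma mean_cvg_cst c : mean_cvg (fun=> c) c.
Proof.
rewrite /mean_cvg; under eq_fun do rewrite (site_mean_cst hp).
exact: cvg_cst.
Qed.

Lemma mean_cvgD F G l l' : mean_cvg F l -> mean_cvg G l' ->
  mean_cvg (fun v => F v + G v) (l + l').
Proof.
move=> Fl Gl; rewrite /mean_cvg; under eq_fun do rewrite (site_meanD hp).
exact: cvgD.
Qed.

Lemma mean_cvgZ c F l : mean_cvg F l -> mean_cvg (fun v => c * F v) (c * l).
Proof.
move=> Fl; rewrite /mean_cvg; under eq_fun do rewrite (site_meanZ hp).
exact: cvgMr.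
Qed.

Lemma mean_cvg_unique F l l' : mean_cvg F l -> mean_cvg F l' -> l = l'.
Proof. by move=> h h'; apply: (cvg_unique _ h h'). Qed.

Lemma eq_mean_cvg F G l : F =1 G -> mean_cvg F l -> mean_cvg G l.
Proof. by move=> /funext ->. Qed.

Lemma expr2V_cvg0 : (2 : R) ^- n @[n --> \oo] --> 0.
Proof.
have := @cvg_expr R 2^-1; rewrite ger0_norm//.
have -> : (2^-1 < 1 :> R) = true by lra.
move=> /(_ isT); apply: cvg_trans; apply: near_eq_cvg.
by apply: nearW => n; rewrite exprVn.
Qed.

(** A difference which is bounded over a whole word is of order 2^-n per
site. *)
Lemma mean_cvg_close F G l C :
  (forall v, `|\sum_(i < size v) F (drop i v) - \sum_(i < size v) G (drop i v)|
     <= C) ->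
  mean_cvg F l -> mean_cvg G l.
Proof.
move=> FG Fl; rewrite /mean_cvg.
have H : (site_mean p n F - site_mean p n G) @[n --> \oo] --> (0 : R).
  apply/norm_cvg0P.
  apply: (@squeeze_cvgr _ _ _ _ (cst 0) (fun n => C * 2 ^- n)).
  - apply: nearW => n; rewrite normr_ge0/= -mulrBr normrM mulrC.
    rewrite [X in _ * X]ger0_norm ?invr_ge0 ?exprn_ge0//.
    apply: ler_wpM2r; first by rewrite invr_ge0 exprn_ge0.
    rewrite -mulN1r -(iter_expZ hp) -(iter_expD hp).
    rewrite ler_norml -(iter_exp_cst hp n [:: true] (- C)).
    rewrite -{2}(iter_exp_cst hp n [:: true] C).
    by apply/andP; split; apply: (iter_exp_le hp) => v _; rewrite mulN1r;
      have := FG v; rewrite ler_norml => /andP[].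
  - exact: cvg_cst.
  - by rewrite -[X in _ --> X](mulr0 C); apply: cvgMr; exact: expr2V_cvg0.
have -> : (fun n => site_mean p n G) =
    (fun n => site_mean p n F - (site_mean p n F - site_mean p n G)).
  by apply/funext => n; rewrite subKr.
by rewrite -[l]subr0; apply: cvgB.
Qed.

Lemma sum_near_end (N L : nat) : (\sum_(i < N) (N - i <= L) <= L)%N.
Proof.
rewrite (reindex_inj rev_ord_inj)/=.
under eq_bigr => i _ do rewrite (subKn (ltn_ord i)).
elim: N => [|N IH]; first by rewrite big_ord0.
rewrite big_ord_recr/=; case: ltnP => NL; last by rewrite addn0.
rewrite addn1 (leq_ltn_trans _ NL)//.
apply: (@leq_trans (\sum_(i < N) 1)); first by apply: leq_sum => i _; case: leqP.
by rewrite sum_nat_const card_ord muln1.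
Qed.

(** Only the last [L] sites of a word have a suffix of length at most [L], so
values on short words cannot influence the limit. *)
Lemma mean_cvg_boundary (L : nat) M F G l :
  (forall v, (L < size v)%N -> F v = G v) ->
  (forall v, `|F v| <= M) -> (forall v, `|G v| <= M) ->
  mean_cvg F l -> mean_cvg G l.
Proof.
move=> FG FM GM; apply: (@mean_cvg_close _ _ _ (L%:R * (M + M))) => v.
rewrite -sumrB.
apply: (le_trans (ler_norm_sum _ _ _)).
have M0 : 0 <= M + M by rewrite addr_ge0// (le_trans (normr_ge0 (F [::])))//.
apply: (@le_trans _ _ (\sum_(i < size v) (size v - i <= L)%N%:R * (M + M))).
  apply: ler_sum => i _; case: leqP => h.
    by rewrite mul1r (le_trans (ler_normB _ _))// lerD.
  by rewrite FG ?subrr ?normr0 ?mul0r// size_drop.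
rewrite -mulr_suml ler_wpM2r// -natr_sum ler_nat.
exact: sum_near_end.
Qed.

(** Stationarity of the limit: moving the observation window by one site
changes the sum over a word by the difference of two boundary terms. *)
Lemma mean_cvg_drop M F l j : (forall v, `|F v| <= M) ->
  mean_cvg F l -> mean_cvg (fun v => F (drop j v)) l.
Proof.
move=> FM; elim: j => [|j IH] Fl.
  by apply: eq_mean_cvg Fl => v; rewrite drop0.
apply: (@mean_cvg_close (fun v => F (drop j v)) _ _ (M + M)); last exact: IH.
move=> v; pose a i := F (drop (i + j) v).
rewrite (eq_bigr (fun i : 'I_(size v) => a i)); last first.
  by move=> i _; rewrite drop_drop addnC.
rewrite [X in _ - X](eq_bigr (fun i : 'I_(size v) => a i.+1)); last first.
  by move=> i _; rewrite drop_drop /a addnC addnS.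
rewrite -sumrB.
have -> : \sum_(i < size v) (a i - a i.+1) = a 0%N - a (size v).
  elim: (size v) => [|N IHN]; first by rewrite big_ord0 subrr.
  by rewrite big_ord_recr/= IHN addrA subrK.
by apply: (le_trans (ler_normB _ _)); apply: lerD; exact: FM.
Qed.

(** The renormalisation step: even and odd sites of the image of a word each
make up half of all sites. *)
Lemma mean_cvg_subst F l0 l1 :
  mean_cvg (fun u => subst_exp p u F) l0 ->
  mean_cvg (fun u => subst_exp p u (fun v => F (drop 1 v))) l1 ->
  mean_cvg F ((l0 + l1) / 2).
Proof.
move=> h0 h1; rewrite /mean_cvg.
rewrite -(cvg_shiftn 1)/=.
under eq_fun => n do rewrite (site_mean_selfsimilar hp) expr1 big_ord_recl
  big_ord1/= mulrC.
apply: cvgMl; apply: cvgD => //.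
by under eq_fun do under eq_site_mean do under eq_fun do rewrite drop0.
Qed.

Lemma subst_exp_cst u c : subst_exp p u (fun=> c) = c.
Proof. exact: (iter_exp_cst hp 1). Qed.

Lemma eq_subst_exp u F G : F =1 G -> subst_exp p u F = subst_exp p u G.
Proof. by move=> /funext ->. Qed.

Lemma subst_exp_le u F G : (forall v, F v <= G v) ->
  subst_exp p u F <= subst_exp p u G.
Proof. by move=> FG; apply: (@iter_exp_le _ _ hp 1). Qed.

Lemma subst_expZ u c F :
  subst_exp p u (fun v => c * F v) = c * subst_exp p u F.
Proof. exact: (iter_expZ hp 1). Qed.

Definition image_exp (f : bool -> bool -> R) (c : bool) : R :=
  if c then p * f true false + (1 - p) * f false true else f true true.

Lemma subst_exp_nth (f : bool -> bool -> R) u i : (i < size u)%N ->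
  subst_exp p u (fun v => f (nth false v (2 * i)) (nth false v (2 * i).+1)) =
  image_exp f (nth false u i).
Proof.
elim: u i => [//|c u IH] [_|i iu].
  by rewrite muln0; case: c; rewrite /= !subst_exp_cst.
rewrite mulnS/= -(IH i iu)/= !add0n add1n.
by case: (c) => //=; ring.
Qed.

(** The images of two different sites are independent. *)
Lemma subst_exp_nth2 (f g : bool -> bool -> R) u i j : (i < j < size u)%N ->
  subst_exp p u (fun v => f (nth false v (2 * i)) (nth false v (2 * i).+1) *
                          g (nth false v (2 * j)) (nth false v (2 * j).+1)) =
  image_exp f (nth false u i) * image_exp g (nth false u j).
Proof.
elim: u i j => [|c u IH] i j; first by rewrite ltn0 andbF.
case: i j => [|i] [|j] // /andP[ij ju].
  rewrite muln0 mulnS/= !add0n !add1n !subst_expZ !subst_exp_nth//.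
  by case: (c) => //=; ring.
rewrite !mulnS/= !add0n !add1n !IH; try by apply/andP; split.
by case: (c) => //=; ring.
Qed.

(** Beyond the end of a word the default letter is b, so that pairs which stick
out of the word are not counted. *)
Definition pair_obs (m : nat) (v : word) : R :=
  (nth false v 0 && nth false v m)%:R.

Lemma pair_obs_norm m v : `|pair_obs m v| <= 1.
Proof. by rewrite ger0_norm ?ler0n// /pair_obs; case: (_ && _). Qed.

Section PairRecursion.
Variable eta : nat -> R.
Hypothesis etaP : forall m, mean_cvg (pair_obs m) (eta m).

Let Y j (u : word) : R := (nth false u j)%:R.
Let Y_norm j u : `|Y j u| <= 1.
Proof. by rewrite ger0_norm ?ler0n// /Y; case: nth. Qed.

Let Y_cvg j : mean_cvg (Y j) (eta 0%N).
Proof.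
have H : mean_cvg (Y 0%N) (eta 0%N).
  by apply: eq_mean_cvg (@etaP 0%N) => v; rewrite /pair_obs/= andbb.
apply: eq_mean_cvg (mean_cvg_drop j (Y_norm 0%N) H) => v.
by rewrite /Y nth_drop addn0.
Qed.

Let subst_cvg (F : word -> R) (L : nat) (c0 c1 c2 c3 : R) i j m :
  (forall v, `|F v| <= 1) ->
  (forall u, (L < size u)%N -> subst_exp p u F =
     c0 + c1 * Y i u + c2 * Y j u + c3 * pair_obs m u) ->
  mean_cvg (fun u => subst_exp p u F)
    (c0 + c1 * eta 0%N + c2 * eta 0%N + c3 * eta m).
Proof.
move=> F1 FE.
pose M := 1 + (`|c0| + `|c1| + `|c2| + `|c3|).
apply: (@mean_cvg_boundary L M
  (fun u => c0 + c1 * Y i u + c2 * Y j u + c3 * pair_obs m u)).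
- by move=> u /FE.
- move=> u; rewrite /M -[X in X <= _]add0r; apply: lerD => //.
  have H (c x : R) : `|x| <= 1 -> `|c * x| <= `|c|.
    by move=> x1; rewrite normrM ler_piMr.
  apply: (le_trans (ler_normD _ _)); apply: lerD; last exact/H/pair_obs_norm.
  apply: (le_trans (ler_normD _ _)); apply: lerD; last exact/H/Y_norm.
  by apply: (le_trans (ler_normD _ _)); apply: lerD => //; exact/H/Y_norm.
- move=> u; apply: (@le_trans _ _ 1); last first.
    by rewrite lerDl !addr_ge0.
  rewrite ler_norml -{1}(subst_exp_cst u (-1)) -{2}(subst_exp_cst u 1).
  by apply/andP; split; apply: subst_exp_le => v;
    have := F1 v; rewrite ler_norml => /andP[].
- apply: mean_cvgD; last exact/mean_cvgZ/etaP.
  apply: mean_cvgD; last exact/mean_cvgZ/Y_cvg.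
  apply: mean_cvgD; last exact/mean_cvgZ/Y_cvg.
  exact: mean_cvg_cst.
Qed.

Let pair_obs_drop s m v : pair_obs m (drop s v) =
  (nth false v s && nth false v (s + m))%:R.
Proof. by rewrite /pair_obs !nth_drop addn0. Qed.

(** The frequency of the letter a is the fixed point of x = 1 - x / 2. *)
Lemma pair_mean_0 : eta 0%N = 2 / 3.
Proof.
(* Even sites on the first line, odd sites on the second, in the form required by [subst_cvg]. *)
suff : eta 0%N = (1 + (p - 1) * eta 0%N + 0 * eta 0%N + 0 * eta 0%N +
   (1 + (- p) * eta 0%N + 0 * eta 0%N + 0 * eta 0%N)) / 2 by lra.
apply: (mean_cvg_unique (@etaP 0%N)); apply: mean_cvg_subst.
- apply: (@subst_cvg _ 0 _ _ _ _ 0 0 0); first exact: pair_obs_norm.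
  move=> u u0; have := subst_exp_nth (fun b _ => b%:R) u0.
  rewrite muln0 => H.
  transitivity (subst_exp p u (fun v => (nth false v 0)%:R)).
    by apply: eq_subst_exp => v; rewrite /pair_obs andbb.
  by rewrite H /image_exp /Y; case: nth; rewrite /=; ring.
- apply: (@subst_cvg _ 0 _ _ _ _ 0 0 0) => [v|]; first exact: pair_obs_norm.
  move=> u u0; have := subst_exp_nth (fun _ b => b%:R) u0.
  rewrite muln0 => H.
  transitivity (subst_exp p u (fun v => (nth false v 1)%:R)).
    by apply: eq_subst_exp => v; rewrite pair_obs_drop andbb.
  by rewrite H /image_exp /Y; case: nth; rewrite /=; ring.
Qed.

(** A given position of the image carries a with probability 1 - q or 1 - p if
the site carries a, and surely if it carries b. The product of two such
factors gives the coefficients q^2 and p^2, one for each parity. *)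
Lemma pair_mean_even j : (0 < j)%N ->
  eta (2 * j)%N = 1 / 3 + (p ^+ 2 + (1 - p) ^+ 2) / 2 * eta j.
Proof.
move=> j0.
suff : eta (2 * j)%N = (1 + (p - 1) * eta 0%N + (p - 1) * eta 0%N +
    (1 - p) ^+ 2 * eta j +
   (1 + (- p) * eta 0%N + (- p) * eta 0%N + p ^+ 2 * eta j)) / 2.
  by move=> ->; rewrite pair_mean_0; field.
apply: (mean_cvg_unique (@etaP _)); apply: mean_cvg_subst.
- apply: (@subst_cvg _ j _ _ _ _ 0 j j); first exact: pair_obs_norm.
  move=> u ju; have ij : (0 < j < size u)%N by rewrite j0.
  have := subst_exp_nth2 (fun b _ => b%:R) (fun b _ => b%:R) ij.
  rewrite muln0 => H.
  transitivity (subst_exp p u (fun v => (nth false v 0)%:R * (nth false v (2 * j))%:R)).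
    by apply: eq_subst_exp => v; rewrite /pair_obs -natrM mulnb.
  by rewrite H /image_exp /Y /pair_obs; case: (nth _ _ 0); case: nth; rewrite /=; ring.
- apply: (@subst_cvg _ j _ _ _ _ 0 j j) => [v|]; first exact: pair_obs_norm.
  move=> u ju; have ij : (0 < j < size u)%N by rewrite j0.
  have := subst_exp_nth2 (fun _ b => b%:R) (fun _ b => b%:R) ij.
  rewrite muln0 => H.
  transitivity (subst_exp p u (fun v => (nth false v 1)%:R * (nth false v (2 * j).+1)%:R)).
    by apply: eq_subst_exp => v; rewrite pair_obs_drop -natrM mulnb add1n.
  by rewrite H /image_exp /Y /pair_obs; case: (nth _ _ 0); case: nth; rewrite /=; ring.
Qed.

(** The two letters of the image of one letter are both a only for the letter
b, so the term with the value at distance 0 that [pair_mean_odd] would give is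
absent. *)
Lemma pair_mean_1 : eta 1%N = 1 / 3 + p * (1 - p) / 2 * eta 1%N.
Proof.
suff : eta 1%N = (1 + (- 1) * eta 0%N + 0 * eta 0%N + 0 * eta 0%N +
   (1 + (- p) * eta 0%N + (p - 1) * eta 0%N + p * (1 - p) * eta 1%N)) / 2.
  by move=> {1}->; rewrite pair_mean_0; field.
apply: (mean_cvg_unique (@etaP _)); apply: mean_cvg_subst.
- apply: (@subst_cvg _ 0 _ _ _ _ 0 0 0); first exact: pair_obs_norm.
  move=> u u0; have := subst_exp_nth (fun b c => (b && c)%:R) u0.
  rewrite muln0 => H.
  transitivity (subst_exp p u (fun v => (nth false v 0 && nth false v 1)%:R)).
    by apply: eq_subst_exp => v.
  by rewrite H /image_exp /Y; case: nth; rewrite /=; ring.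
- apply: (@subst_cvg _ 1 _ _ _ _ 0 1 1) => [v|]; first exact: pair_obs_norm.
  move=> u ju; have ij : (0 < 1 < size u)%N by [].
  have := subst_exp_nth2 (fun _ b => b%:R) (fun b _ => b%:R) ij.
  rewrite muln0 => H.
  transitivity (subst_exp p u (fun v => (nth false v 1)%:R * (nth false v (2 * 1))%:R)).
    by apply: eq_subst_exp => v; rewrite pair_obs_drop -natrM mulnb.
  by rewrite H /image_exp /Y /pair_obs; case: (nth _ _ 0); case: nth; rewrite /=; ring.
Qed.

(** The pair belongs to two sites at distance j when its left site is even and
to two sites at distance j + 1 when it is odd. *)
Lemma pair_mean_odd j : (0 < j)%N ->
  eta (2 * j).+1 = 1 / 3 + p * (1 - p) / 2 * (eta j + eta j.+1).
Proof.
move=> j0.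
suff : eta (2 * j).+1 = (1 + (p - 1) * eta 0%N + (- p) * eta 0%N +
    p * (1 - p) * eta j +
   (1 + (- p) * eta 0%N + (p - 1) * eta 0%N + p * (1 - p) * eta j.+1)) / 2.
  by move=> ->; rewrite pair_mean_0; field.
apply: (mean_cvg_unique (@etaP _)); apply: mean_cvg_subst.
- apply: (@subst_cvg _ j _ _ _ _ 0 j j); first exact: pair_obs_norm.
  move=> u ju; have ij : (0 < j < size u)%N by rewrite j0.
  have := subst_exp_nth2 (fun b _ => b%:R) (fun _ b => b%:R) ij.
  rewrite muln0 => H.
  transitivity (subst_exp p u (fun v => (nth false v 0)%:R * (nth false v (2 * j).+1)%:R)).
    by apply: eq_subst_exp => v; rewrite /pair_obs -natrM mulnb.
  by rewrite H /image_exp /Y /pair_obs; case: (nth _ _ 0); case: nth; rewrite /=; ring.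
- apply: (@subst_cvg _ j.+1 _ _ _ _ 0 j.+1 j.+1) => [v|]; first exact: pair_obs_norm.
  move=> u ju; have ij : (0 < j.+1 < size u)%N by [].
  have := subst_exp_nth2 (fun _ b => b%:R) (fun b _ => b%:R) ij.
  rewrite muln0 => H.
  transitivity (subst_exp p u (fun v => (nth false v 1)%:R * (nth false v (2 * j.+1))%:R)).
    apply: eq_subst_exp => v; rewrite pair_obs_drop -natrM mulnb.
    by rewrite add1n mulnS.
  by rewrite H /image_exp /Y /pair_obs; case: (nth _ _ 0); case: nth; rewrite /=; ring.
Qed.

End PairRecursion.

End SiteMeanLimits.

(** * A law of large numbers for site averages *)

Section LawOfLargeNumbers.
Context {R : realType} (p : R).
Hypothesis hp : 0 <= p <= 1.
Implicit Types (u v w : word).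

Variables (F : word -> R) (l : nat) (eta : R).
Hypothesis F01 : forall v, 0 <= F v <= 1.
Hypothesis Floc : forall v w, (l <= size v)%N -> F (v ++ w) = F v.
Hypothesis Feta : mean_cvg p F eta.

Let h v := \sum_(i < size v) F (drop i v).

Let F0 v : 0 <= F v. Proof. by have /andP[] := F01 v. Qed.
Let F1 v : F v <= 1. Proof. by have /andP[] := F01 v. Qed.

Let h0 v : 0 <= h v. Proof. exact: sumr_ge0. Qed.
Let h_le v : h v <= (size v)%:R.
Proof.
rewrite -[size v in X in _ <= X]card_ord -sum1_card natr_sum.
by apply: ler_sum.
Qed.

Lemma site_mean_bounds n : 0 <= site_mean p n F <= 1.
Proof.
rewrite -{1}(site_mean_cst hp n 0) -{1}(site_mean_cst hp n 1).
by apply/andP; split; apply: (le_site_mean hp).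
Qed.

Lemma mean_limit_bounds : 0 <= eta <= 1.
Proof.
have c : cvgn (site_mean p ^~ F) by apply/cvg_ex; exists eta; exact: Feta.
rewrite -(cvg_lim _ Feta)//; apply/andP; split.
  by apply: limr_ge => //; apply: nearW => n; have /andP[] := site_mean_bounds n.
by apply: limr_le => //; apply: nearW => n; have /andP[] := site_mean_bounds n.
Qed.

(** Since the observable only looks at [l] letters, cutting a word affects at
most [l] sites. *)
Lemma partial_block_sum v1 v2 :
  `|\sum_(i < size v1) F (drop i (v1 ++ v2)) - h v1| <= l%:R.
Proof.
rewrite -sumrB (le_trans (ler_norm_sum _ _ _))//.
apply: (@le_trans _ _ (\sum_(i < size v1) (size v1 - i <= l)%N%:R)).
  apply: ler_sum => i _.
  have -> : drop i (v1 ++ v2) = drop i v1 ++ v2.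
    rewrite drop_cat; case: ltnP => // vi.
    by have := leq_trans (ltn_ord i) vi; rewrite ltnn.
  have [il|il] := leqP (size v1 - i) l.
    rewrite ler_norml; have := F01 (drop i v1 ++ v2); have := F01 (drop i v1).
    by rewrite /= => /andP[? ?] /andP[? ?]; apply/andP; split; lra.
  by rewrite Floc ?subrr ?normr0// size_drop ltnW.
by rewrite -natr_sum ler_nat sum_near_end.
Qed.

Lemma block_sum_cat v1 v2 : `|h (v1 ++ v2) - (h v1 + h v2)| <= l%:R.
Proof.
have -> : h (v1 ++ v2) = \sum_(i < size v1) F (drop i (v1 ++ v2)) + h v2.
  rewrite /h size_cat big_split_ord/=; congr (_ + _).
  by apply: eq_bigr => i _; rewrite addnC -drop_drop drop_size_cat.
by rewrite opprD addrACA subrr addr0 partial_block_sum.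
Qed.

Let b k c := iter_exp p k [:: c] h.

Lemma iter_exp_near k u (G H : word -> R) (C : R) :
  (forall v, size v = (2 ^ k * size u)%N -> `|G v - H v| <= C) ->
  `|iter_exp p k u G - iter_exp p k u H| <= C.
Proof.
move=> GH; rewrite -mulN1r -(iter_expZ hp) -(iter_expD hp).
rewrite ler_norml -(iter_exp_cst hp k u (- C)) -{2}(iter_exp_cst hp k u C).
by apply/andP; split; apply: (iter_exp_le hp) => v /GH; rewrite mulN1r ler_norml
  => /andP[].
Qed.

(** For the letter a this is the hypothesis on [F]. The image of b is aa, so
a block of b is, up to the sites near the cut, a pair of blocks of a of the
previous generation. *)
Lemma block_mean_near e : 0 < e ->
  exists k0, forall k, (k0 <= k)%N -> forall c, `|b k c - 2 ^+ k * eta| <= 2 ^+ k * e.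
Proof.
move=> e0.
have e20 : 0 < e / 2 by rewrite divr_gt0.
have := Feta => /cvgrPdist_le /(_ _ e20)[k1 _ Hk1].
have /cvgrPdist_le /(_ _ e20)[k2 _ Hk2] : (l%:R * 2 ^- n.+1 : R) @[n --> \oo] --> 0.
  rewrite -(mulr0 (l%:R : R)); apply: cvgMr.
  by rewrite (cvg_shiftS (fun n => (2 : R) ^- n)); exact: expr2V_cvg0.
have Ha k : (k1 <= k)%N -> `|b k true - 2 ^+ k * eta| <= 2 ^+ k * (e / 2).
  move=> /Hk1; rewrite /= distrC /site_mean => H.
  have -> : b k true - 2 ^+ k * eta = 2 ^+ k * (2 ^- k * b k true - eta).
    by rewrite mulrBr mulrA mulfV ?mul1r// expf_neq0.
  by rewrite normrM ger0_norm ?exprn_ge0// ler_wpM2l ?exprn_ge0.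
exists (maxn k1 k2).+1 => -[//|k]; rewrite ltnS geq_max => /andP[kk1 kk2] [].
  rewrite (le_trans (Ha _ _))//; first exact: leqW.
  by rewrite ler_wpM2l ?exprn_ge0//; lra.
have H : `|b k.+1 false - 2 * b k true| <= l%:R.
  rewrite /b /= -[ [:: true; true] ]/([:: true] ++ [:: true]) (iter_exp_cat hp).
  have -> : 2 * iter_exp p k [:: true] h =
     iter_exp p k [:: true] (fun v1 => iter_exp p k [:: true] (fun v2 => h v1 + h v2)).
    transitivity (iter_exp p k [:: true] (fun v1 => h v1 + iter_exp p k [:: true] h)).
      by rewrite (iter_expD hp) (iter_exp_cst hp); ring.
    apply: (eq_iter_exp hp) => v1 _.
    by rewrite (iter_expD hp) (iter_exp_cst hp).
  apply: iter_exp_near => v1 _; apply: iter_exp_near => v2 _.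
  exact: block_sum_cat.
have := Hk2 _ kk2; rewrite /= sub0r normrN ger0_norm ?mulr_ge0 ?invr_ge0 ?exprn_ge0// => H2.
have -> : b k.+1 false - 2 ^+ k.+1 * eta =
  (b k.+1 false - 2 * b k true) + 2 * (b k true - 2 ^+ k * eta).
  by rewrite exprS; ring.
apply: (le_trans (ler_normD _ _)).
have -> : 2 ^+ k.+1 * e = 2 ^+ k.+1 * (e / 2) + 2 * (2 ^+ k * (e / 2)).
  by rewrite exprS; field.
apply: lerD; last by rewrite normrM ger0_norm// ler_wpM2l// Ha.
rewrite (le_trans H)//.
by move: H2; rewrite ler_pdivrMr ?exprn_gt0// mulrC.
Qed.

Let Z k J u v :=
  \sum_(j < J) (h (take (2 ^ k) (drop (2 ^ k * j) v)) - b k (nth false u j)).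

Lemma block_mean_bounds k c : 0 <= b k c <= (2 ^ k)%:R.
Proof.
rewrite -{1}(iter_exp_cst hp k [:: c] 0).
rewrite -{1}(iter_exp_cst hp k [:: c] (2 ^ k)%:R).
apply/andP; split; apply: (iter_exp_le hp) => v sv; first exact: h0.
by rewrite (le_trans (h_le v))// sv muln1.
Qed.

(** The blocks are independent with means [b], so the mixed terms vanish and
every block contributes at most the square of its length. *)
Lemma block_variance k J u : (J <= size u)%N ->
  iter_exp p k u (fun v => Z k J u v ^+ 2) <= J%:R * (2 ^ k)%:R ^+ 2.
Proof.
elim: J u => [|J IH] u.
  move=> _; rewrite mul0r -(iter_exp_cst hp k u 0).
  by apply: (iter_exp_le hp) => v _; rewrite /Z big_ord0 expr0n.
case: u => [//|c u] Ju; rewrite -cat1s (iter_exp_cat hp).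
set E1 := iter_exp p k [:: c]; set E2 := iter_exp p k u.
have -> : E1 (fun v1 => E2 (fun v2 => Z k J.+1 ([:: c] ++ u) (v1 ++ v2) ^+ 2)) =
   E1 (fun v1 => (h v1 - b k c) ^+ 2) +
   E2 (fun v2 => Z k J u v2 ^+ 2).
  transitivity (E1 (fun v1 => (h v1 - b k c) ^+ 2 +
     ((2 * E2 (Z k J u)) * (h v1 + (- b k c)) + E2 (fun v2 => Z k J u v2 ^+ 2)))).
    apply: (eq_iter_exp hp) => v1 sv1; rewrite muln1 in sv1.
    rewrite -[(h v1 - b k c) ^+ 2 in RHS](iter_exp_cst hp k u) -/E2.
    rewrite mulrAC -(iter_expZ hp) -!(iter_expD hp).
    apply: (eq_iter_exp hp) => v2 _.
    have -> : Z k J.+1 ([:: c] ++ u) (v1 ++ v2) = (h v1 - b k c) + Z k J u v2.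
      rewrite /Z big_ord_recl muln0 drop0 -sv1 take_size_cat//; congr (_ + _).
      apply: eq_bigr => j _ /=; congr (h (take _ _) - _).
      by rewrite /bump add1n mulnS addnC -drop_drop drop_size_cat.
    by ring.
  rewrite /E1 !(iter_expD hp) (iter_expZ hp) (iter_expD hp) !(iter_exp_cst hp).
  by rewrite -/(b k c) subrr mulr0 add0r.
rewrite -natr1 mulrDl mul1r addrC lerD//; first exact: IH.
rewrite -[X in _ <= X](iter_exp_cst hp k [:: c]).
apply: (iter_exp_le hp) => v sv; rewrite muln1 in sv.
have /andP[b0 b1] := block_mean_bounds k c.
have := h0 v; have := h_le v; rewrite sv => ? ?.
rewrite -(real_normK (num_real (h v - b k c))) ler_sqr ?nnegrE// ler_norml.
by apply/andP; split; lra.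
Qed.

(** Compares the sum over a window with that over the complete blocks: the
three errors are those of the block means, of the cuts between blocks, and of
the incomplete blocks at both ends. *)
Lemma window_sum_near k (e : R) u v s N J :
  (forall c, `|b k c - 2 ^+ k * eta| <= 2 ^+ k * e) -> 0 <= e ->
  size v = (2 ^ k * size u)%N -> (s < 2 ^ k)%N -> (N + l <= size (drop s v))%N ->
  J = (N %/ 2 ^ k)%N ->
  `|\sum_(i < N) F (drop i (drop s v)) - N%:R * eta| <=
  `|Z k J u v| + N%:R * e + J%:R * l%:R + 3 * (2 ^ k)%:R.
Proof.
move=> Hb e0 sv sK Nv JE; set K := (2 ^ k)%N.
have K0 : (0 < K)%N by rewrite expn_gt0.
have KJ : (K * J <= N)%N by rewrite JE mulnC leq_trunc_div.
have NKJ : (N < K * J + K)%N by rewrite JE addnC -mulnS mulnC ltn_ceil.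
have Ju : (J <= size u)%N.
  rewrite -(leq_pmul2l K0) (leq_trans KJ)// -sv.
  by rewrite size_drop in Nv; lia.
pose T n := \sum_(i < n) F (drop i v).
have TD m n : T (m + n)%N = T m + \sum_(i < n) F (drop (m + i) v).
  by rewrite /T big_split_ord.
have TDle m n : 0 <= T (m + n)%N - T m <= n%:R.
  rewrite TD addrC addKr sumr_ge0//=.
  rewrite -[n in X in _ <= X]card_ord -sum1_card natr_sum.
  by apply: ler_sum => i _.
have -> : \sum_(i < N) F (drop i (drop s v)) = T (s + N)%N - T s.
  rewrite TD addrC addKr; apply: eq_bigr => i _.
  by rewrite drop_drop addnC.
have TKJ : `|T (K * J)%N - \sum_(j < J) h (take K (drop (K * j) v))| <= J%:R * l%:R.
  rewrite /T (big_ord_block _ _ (fun i => F (drop i v))) -sumrB (le_trans (ler_norm_sum _ _ _))//.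
  rewrite -[J in X in _ <= X]card_ord -sum1_card natr_sum mulr_suml.
  apply: ler_sum => j _; rewrite mul1r.
  have sB : size (take K (drop (K * j) v)) = K.
    rewrite size_takel// size_drop sv -/K -mulnBr leq_pmulr// subn_gt0.
    exact: leq_trans (ltn_ord j) Ju.
  have := partial_block_sum (take K (drop (K * j) v)) (drop K (drop (K * j) v)).
  rewrite sB cat_take_drop; congr (`|_ - _| <= _); apply: eq_bigr => i _.
  by rewrite drop_drop addnC.
have TZ : `|\sum_(j < J) h (take K (drop (K * j) v)) - (K * J)%:R * eta|
    <= `|Z k J u v| + N%:R * e.
  have -> : \sum_(j < J) h (take K (drop (K * j) v)) - (K * J)%:R * eta =
     Z k J u v + \sum_(j < J) (b k (nth false u j) - 2 ^+ k * eta).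
    rewrite /Z !sumrB addrA subrK sumr_const card_ord -mulr_natl natrM natrX -/K.
    by congr (_ - _); ring.
  apply: (le_trans (ler_normD _ _)); apply: lerD => //.
  apply: (le_trans (ler_norm_sum _ _ _)).
  apply: (@le_trans _ _ (\sum_(j < J) (2 ^+ k * e))); first exact: ler_sum.
  rewrite sumr_const card_ord -[X in X <= _]mulr_natl mulrA; apply: ler_wpM2r => //.
  by rewrite -natrX -natrM ler_nat mulnC.
have /andP[pair_mean_0 pair_mean_1] := mean_limit_bounds.
have N1 : `|N%:R * eta - (K * J)%:R * eta| <= K%:R.
  rewrite -mulrBl -natrB// normrM ger0_norm//.
  rewrite (@le_trans _ _ ((N - K * J)%:R * 1))//.
    by rewrite ler_wpM2l// ger0_norm.
  by rewrite mulr1 ler_nat; lia.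
have T1 : 0 <= T (s + N)%N - T (K * J)%N <= (2 * K)%:R.
  have -> : (s + N = K * J + (s + N - K * J))%N by lia.
  have /andP[-> H] := TDle (K * J)%N (s + N - K * J)%N.
  by rewrite (le_trans H)// ler_nat; lia.
have T2 : 0 <= T s <= K%:R.
  have := TDle 0%N s; rewrite add0n /T big_ord0 subr0 => /andP[-> H].
  by rewrite (le_trans H)// ler_nat ltnW.
move: TKJ TZ N1 T1 T2; rewrite !natrM.
move: (T (s + N)%N) (T (K * J)%N) (T s) (\sum_(j < J) _) (N%:R * eta) (N%:R * e)
  (K%:R * J%:R * eta) (`|Z k J u v|) (J%:R * l%:R) (K%:R) => a1 a2 a3 a4 a5 a6 a7 a8 a9 a10.
rewrite !ler_norml => /andP[? ?] /andP[? ?] /andP[? ?] /andP[? ?] /andP[? ?].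
by apply/andP; split; lra.
Qed.

(** Words too short to determine the sum over the window are not counted, so
that the event is decided by the first [N + l] letters. *)
Definition deviates (e : R) N v : bool :=
  (N + l <= size v)%N && (N%:R * e < `|\sum_(i < N) F (drop i v) - N%:R * eta|).

(** Chebyshev's inequality for the sum over blocks. The generation [k] of the
blocks is fixed first, large enough for the systematic errors to stay below
half of [e]; the remaining quarter must come from the fluctuation. *)
Lemma deviation_bound e : 0 < e ->
  exists2 C, 0 <= C & exists k0, forall n N, (0 < N)%N -> (k0 <= n)%N ->
    site_mean p n (fun v => (deviates e N v)%:R) <= C / N%:R.
Proof.
move=> e0.
have e40 : 0 < e / 4 by rewrite divr_gt0.
have [k1 Hk1] := block_mean_near e40.
have /cvgrPdist_le /(_ _ e40)[k2 _ Hk2] : (l%:R * 2 ^- n : R) @[n --> \oo] --> 0.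
  by rewrite -(mulr0 (l%:R : R)); apply: cvgMr; exact: expr2V_cvg0.
pose k := maxn k1 k2.
have {}Hk1 c := Hk1 k (leq_maxl _ _) c.
have {}Hk2 := Hk2 k (leq_maxr _ _).
rewrite /= sub0r normrN ger0_norm ?mulr_ge0 ?invr_ge0 ?exprn_ge0// in Hk2.
rewrite ler_pdivrMr ?exprn_gt0// -natrX in Hk2.
set K : R := (2 ^ k)%:R in Hk2.
have K0 : 0 < K by rewrite ltr0n expn_gt0.
(* The first term is the variance bound, the second covers the small N for which the incomplete blocks dominate. *)
exists (16 * K / e ^+ 2 + 12 * K / e).
  by rewrite addr_ge0// divr_ge0 ?mulr_ge0 ?exprn_ge0 ?ltW.
exists k => n N N0 kn; rewrite -(subnK kn) (site_mean_selfsimilar hp).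
set C := _ / N%:R.
have NR0 : (0 : R) < N%:R by rewrite ltr0n.
have key u (s : 'I_(2 ^ k)) :
   iter_exp p k u (fun v => (deviates e N (drop s v))%:R) <= C.
  pose J := (N %/ 2 ^ k)%N.
  have JK : J%:R * K <= N%:R by rewrite -natrM ler_nat leq_trunc_div.
  have [Ju|uJ] := leqP J (size u); last first.
    rewrite -[X in _ <= X](iter_exp_cst hp k u); apply: (iter_exp_le hp) => v sv.
    rewrite /deviates; case: leqP => /= h1; last first.
      by rewrite divr_ge0// addr_ge0// divr_ge0 ?mulr_ge0 ?exprn_ge0 ?ltW.
    exfalso; move: h1; rewrite size_drop sv => h1.
    have := leq_trunc_div N (2 ^ k); rewrite -/J.
    have : (2 ^ k * (size u).+1 <= 2 ^ k * J)%N by rewrite leq_mul2l uJ orbT.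
    have := expn_gt0 2 k; lia.
  pose c1 := 16 / (N%:R * e) ^+ 2; pose c2 := 12 * K / e / N%:R.
  have c10 : 0 <= c1 by rewrite divr_ge0// exprn_ge0// mulr_ge0// ltW.
  have c20 : 0 <= c2 by rewrite !divr_ge0 ?mulr_ge0 ?ltW.
  apply: (@le_trans _ _ (iter_exp p k u (fun v => c1 * Z k J u v ^+ 2 + c2))).
    apply: (iter_exp_le hp) => v sv.
    case: (boolP (deviates _ _ _)) => [/andP[h1 h2]|_]; last first.
      by rewrite addr_ge0// mulr_ge0// sqr_ge0.
    have := window_sum_near Hk1 (ltW e40) sv (ltn_ord s) h1 (erefl J).
    rewrite -/K /= => h3.
    have h4 : N%:R * e < `|Z k J u v| + N%:R * e / 2 + 3 * K.
      have Jl : J%:R * l%:R <= N%:R * (e / 4).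
        rewrite (le_trans (ler_wpM2l _ Hk2))// mulrCA mulrC.
        by rewrite ler_wpM2r// ltW.
      have := lt_le_trans h2 h3; move: Jl.
      have -> : N%:R * (e / 4) = N%:R * e / 4 by rewrite mulrA.
      move: (J%:R * l%:R) (`|Z k J u v|) (N%:R * e) => a1 a2 a3.
      by move=> *; lra.
    have [h5|h5] := lerP (12 * K) (N%:R * e).
      have h6 : N%:R * e / 4 <= `|Z k J u v| by lra.
      rewrite -[1%:R]addr0 lerD// /c1 mulrAC ler_pdivlMr ?exprn_gt0 ?mulr_gt0//.
      rewrite mul1r -(real_normK (num_real (Z k J u v))).
      have -> : (N%:R * e) ^+ 2 = 16 * (N%:R * e / 4) ^+ 2 by field.
      rewrite ler_wpM2l// ler_sqr// nnegrE ?normr_ge0//.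
      by rewrite !mulr_ge0// ltW.
    rewrite -[1%:R]add0r; apply: lerD; first by rewrite mulr_ge0// sqr_ge0.
    by rewrite /c2 !ler_pdivlMr// mul1r ltW// mulrC.
  rewrite (iter_expD hp) (iter_exp_cst hp) (iter_expZ hp) /C mulrDl lerD//.
  apply: (le_trans (ler_wpM2l c10 (block_variance k Ju))); rewrite -/K.
  have -> : 16 * K / e ^+ 2 / N%:R = c1 * (N%:R * K).
    by rewrite /c1; field; rewrite !gt_eqF.
  by rewrite ler_wpM2l// expr2 mulrA ler_wpM2r// ltW.
rewrite mulrC ler_pdivrMr ?exprn_gt0//.
apply: (@le_trans _ _ (\sum_(s < 2 ^ k) C)).
  apply: ler_sum => s _; rewrite -(site_mean_cst hp (n - k) C).
  by apply: (le_site_mean hp) => u; exact: key.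
by rewrite sumr_const card_ord -natrX mulr_natr.
Qed.

End LawOfLargeNumbers.

(** * The word frequency measure and its generic points *)

Section WordFrequencyMeasure.
Context {R : realType} (p : R).
Hypothesis hp : 0 <= p <= 1.
Implicit Types (u v w : word) (x : int -> letter).

Lemma size_window x m n : size (window x m n) = n.
Proof. by rewrite size_mkseq. Qed.

Lemma nth_window x m n i : (i < n)%N -> nth false (window x m n) i = x (m + i%:Z).
Proof. exact: nth_mkseq. Qed.

Lemma measurable_cylinder m w : measurable (cylinder m w : set full_shift).
Proof. by apply: sub_sigma_algebra; exists m, w. Qed.

(** There are only countably many words. *)
Lemma measurable_window (P : set word) m n :
  measurable ([set x | P (window x m n)] : set full_shift).
Proof.
have -> : [set x | P (window x m n)] =
    \bigcup_(w : word) (if `[< P w /\ size w = n >] then cylinder m w else set0).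
  apply/seteqP; split => [x /= Px|x [w _]].
    exists (window x m n) => //; rewrite size_window.
    by case: asboolP => [_|[]//]; rewrite /cylinder/= size_window.
  by case: asboolP => // -[Pw sw]; rewrite /cylinder/= sw => ->.
apply: countable_bigcupT_measurable; first exact: countableP.
by move=> w; case: asboolP => // _; exact: measurable_cylinder.
Qed.

Lemma measurable_X_rho : measurable (X_rho p : set full_shift).
Proof.
have -> : X_rho p = ~` (\bigcup_(z : int * nat)
    [set x | ~ legal p (window x z.1 z.2)]).
  apply/seteqP; split => [x Xx [[m n] _ /=]|x /= Xx m n].
    by apply; exact: Xx.
  by apply: contrapT => nl; apply: Xx; exists (m, n).
apply: measurableC; apply: countable_bigcupT_measurable; first exact: countableP.
by move=> [m n]; exact: (measurable_window (fun w => ~ legal p w)).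
Qed.

Lemma occurrencesE w v :
  (occurrences w v)%:R = \sum_(i < size v) (prefix w (drop i v))%:R :> R.
Proof.
rewrite -(big_mkord xpredT (fun i => (prefix w (drop i v))%:R)).
rewrite /index_iota subn0 /occurrences -sum1_count natr_sum big_mkcond.
by apply: eq_bigr => i _; case: prefix.
Qed.

Lemma expected_occurrencesE w n :
  2 ^- n * expected_occurrences p w n =
  site_mean p n (fun v => (prefix w v)%:R).
Proof.
rewrite /site_mean /expected_occurrences (law_iter_sum p n (fun v => (occurrences w v)%:R)); congr (_ * _).
by apply: (eq_iter_exp hp) => v _; rewrite occurrencesE.
Qed.

Lemma expected_occurrences_illegal w n : ~ legal p w ->
  expected_occurrences p w n = 0.
Proof.
move=> nl; rewrite /expected_occurrences big1// => v _.
have := law_iter_ge0 hp n v; rewrite le_eqVlt => /predU1P[<-|v0].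
  by rewrite mul0r.
rewrite occurrencesE big1 ?mulr0// => i _; case: (boolP (prefix _ _)) => // wv.
exfalso; apply: nl; exists n, v; split => //.
move/prefixP : wv => [t ht]; apply/infixP; exists (take i v), t.
by rewrite -ht cat_take_drop.
Qed.

Context (mu : probability full_shift R).
Hypothesis hmu : is_word_frequency_measure p mu.

Let muX : mu (X_rho p) = 1%E. Proof. by have [] := hmu. Qed.

Lemma mu_X_rhoC : mu (~` X_rho p) = 0%E.
Proof. by rewrite probability_setC ?muX ?subee//; exact: measurable_X_rho. Qed.

Lemma mu_cylinder m w : mu (cylinder m w) = mu (cylinder 0 w).
Proof.
have S k : mu (cylinder (k + 1) w) = mu (cylinder k w).
  have [_ sh _] := hmu; rewrite -(sh _ (measurable_cylinder k w)).
  congr (mu _); apply/funext => x; rewrite /cylinder/=.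
  suff -> : window (Defs.shift x) k (size w) = window x (k + 1) (size w) by [].
  by apply/eq_mkseq => i; rewrite /Defs.shift; congr x; rewrite addrAC.
case: m => n; first by elim: n => // n IH; rewrite -addn1 PoszD S.
by elim: n => [|n IH]; rewrite -S// -[RHS]IH; congr (mu (cylinder _ _)); lia.
Qed.

Definition word_freq w : R := fine (mu (cylinder 0 w)).

Lemma word_freqE w : (word_freq w)%:E = mu (cylinder 0 w).
Proof. by rewrite /word_freq fineK// fin_num_measure//; exact: measurable_cylinder. Qed.

(** For legal words this is the definition of the measure. An illegal word
never occurs, and its cylinder misses [X_rho]. *)
Lemma word_freq_cvg w : mean_cvg p (fun v => (prefix w v)%:R) (word_freq w).
Proof.
rewrite /mean_cvg; under eq_fun do rewrite -expected_occurrencesE.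
have [l|nl] := pselect (legal p w).
  have [_ _ /(_ _ l)] := hmu; rewrite -word_freqE.
  by move=> /fine_cvgP[_].
have -> : word_freq w = 0.
  apply/EFin_inj; rewrite word_freqE; apply/eqP; rewrite -measure_le0 -mu_X_rhoC.
  rewrite le_measure ?inE//; [exact: measurable_cylinder| |].
    by apply: measurableC; exact: measurable_X_rho.
  move=> x xw Xx; apply: nl; rewrite -xw; exact: Xx.
under eq_fun do rewrite expected_occurrences_illegal// mulr0.
exact: cvg_cst.
Qed.

Lemma mean_cvg_sum (I : Type) (r : seq I) (P : pred I) (F : I -> word -> R) (l : I -> R) :
  (forall i, P i -> mean_cvg p (F i) (l i)) ->
  mean_cvg p (fun v => \sum_(i <- r | P i) F i v) (\sum_(i <- r | P i) l i).
Proof.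
move=> Fl; elim: r => [|i r IH].
  rewrite big_nil; apply: (eq_mean_cvg _ (@mean_cvg_cst _ _ hp 0)) => v.
  by rewrite big_nil.
rewrite big_cons; case: ifP => Pi; last first.
  by apply: (eq_mean_cvg _ IH) => v; rewrite big_cons Pi.
apply: (eq_mean_cvg _ (mean_cvgD hp (@Fl _ Pi) IH)) => v.
by rewrite big_cons Pi.
Qed.

(** Exactly one word of length [L] is a prefix of a given longer word. *)
Lemma sum_prefix (L : nat) (P : pred word) v :
  \sum_(w : L.-tuple letter | P w) (prefix w v)%:R =
  ((L <= size v)%N && P (take L v))%:R :> R.
Proof.
case: leqP => /= Lv; last first.
  rewrite big1// => w _; rewrite prefixE size_tuple.
  case: eqP => // H; move: (congr1 size H); rewrite size_take_min size_tuple => H'.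
  by have := geq_minr L (size v); rewrite H' leqNgt Lv.
have sz : size (take L v) == L by rewrite size_takel.
rewrite big_mkcond (bigD1 (Tuple sz))//= prefixE size_takel// eqxx.
rewrite big1 ?addr0; first by case: (P _).
move=> w nw; case: (P w) => //; rewrite prefixE size_tuple.
by case: eqP => // H; move: nw; rewrite -val_eqE/= H eqxx.
Qed.

Definition pair_corr (m : nat) : R :=
  \sum_(w : m.+1.-tuple letter | nth false w 0 && nth false w m) word_freq w.

Lemma pair_corr_cvg m : mean_cvg p (pair_obs m) (pair_corr m).
Proof.
have := @mean_cvg_sum _ (index_enum _)
  (fun t : m.+1.-tuple letter => nth false t 0 && nth false t m)
  (fun (t : m.+1.-tuple letter) v => (prefix t v)%:R)
  (fun t : m.+1.-tuple letter => word_freq t) (fun t _ => @word_freq_cvg t).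
apply: eq_mean_cvg => v.
rewrite (sum_prefix _ (fun w => nth false w 0 && nth false w m)).
rewrite /pair_obs; case: ltnP => /= mv; first by rewrite !nth_take.
by rewrite [X in _ && X]nth_default// andbF.
Qed.

Lemma pair_obs_loc m v w : (m.+1 <= size v)%N ->
  pair_obs m (v ++ w) = pair_obs m v :> R.
Proof.
move=> mv; rewrite /pair_obs !nth_cat mv.
by rewrite (leq_ltn_trans _ mv).
Qed.

Lemma pair_obs_01 m v : 0 <= (pair_obs m v : R) <= 1.
Proof. by rewrite /pair_obs ler0n lern1 leq_b1. Qed.

Definition pair_count x (m N : nat) : R :=
  \sum_(i < 2 * N) (x (- N%:Z + i%:Z) && x (- N%:Z + (i + m)%:Z))%:R.

Definition deviation_event m (e : R) N : set full_shift :=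
  [set x | (2 * N)%:R * e < `|pair_count x m N - (2 * N)%:R * pair_corr m|].

Lemma deviation_eventE m e N : deviation_event m e N =
  [set x | deviates (pair_obs m) m.+1 (pair_corr m) e (2 * N)
    (window x (- N%:Z) (2 * N + m.+1))].
Proof.
apply/seteqP; split => x; rewrite /deviation_event/= /deviates size_window leqnn/=;
  congr (_ < `|_ - _|); apply: eq_bigr => i _;
  rewrite /pair_obs !nth_drop addn0 !nth_window//; have := ltn_ord i; lia.
Qed.

Lemma measurable_deviation_event m e N : measurable (deviation_event m e N).
Proof. by rewrite deviation_eventE; exact: (@measurable_window (fun w => deviates _ _ _ _ _ w)). Qed.

(** The event depends on finitely many letters, hence it is a finite union of
cylinders, whose measures are limits of site averages. *)
Lemma deviation_event_bound m e : 0 < e ->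
  exists2 C : R, 0 <= C & forall N, (0 < N)%N ->
    (mu (deviation_event m e N) <= (C / (2 * N)%:R)%:E)%E.
Proof.
move=> e0.
have [C C0 [k0 HC]] := deviation_bound hp (pair_obs_01 m) (@pair_obs_loc m)
  (@pair_corr_cvg m) e0.
exists C => // N N0.
set L := (2 * N + m.+1)%N.
pose P w := deviates (pair_obs m) m.+1 (pair_corr m) e (2 * N) w.
have mC w : measurable (cylinder (- N%:Z) w : set full_shift).
  exact: measurable_cylinder.
have sub : deviation_event m e N `<=`
    \big[setU/set0]_(w : L.-tuple letter | P w) cylinder (- N%:Z) w.
  rewrite deviation_eventE => x /= Px.
  have sz : size (window x (- N%:Z) L) == L by rewrite size_window.
  rewrite (bigD1 (Tuple sz))//=; left.
  by rewrite /cylinder/= size_window.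
have [mU leU] : measurable (\big[setU/set0]_(w : L.-tuple letter | P w)
      cylinder (- N%:Z) w : set full_shift) /\
   (mu (\big[setU/set0]_(w : L.-tuple letter | P w) cylinder (- N%:Z) w) <=
    (\sum_(w : L.-tuple letter | P w) word_freq w)%:E)%E.
  elim/big_rec2: _ => [|w y1 y2 Pw [mU leU]]; first by rewrite measure0.
  split; first by apply: measurableU.
  apply: (le_trans (measureU2 _ _ _)) => //.
  rewrite EFinD; apply: leeD => //.
  by rewrite word_freqE -(mu_cylinder (- N%:Z) w).
apply: le_trans; first by apply: le_measure sub; rewrite inE//;
  exact: measurable_deviation_event.
apply: (le_trans leU); rewrite lee_fin.
have H : mean_cvg p (fun v => \sum_(w : L.-tuple letter | P w) (prefix w v)%:R)
    (\sum_(w : L.-tuple letter | P w) word_freq w).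
  by apply: mean_cvg_sum => w _; exact: word_freq_cvg.
rewrite -(cvg_lim _ H)//; apply: limr_le; first by apply/cvg_ex; eexists; exact: H.
exists k0 => // n /= kn; apply: le_trans (HC _ _ _ kn); last first.
  by rewrite muln_gt0.
apply: (le_site_mean hp) => v; rewrite sum_prefix.
case: leqP => //= Lv; rewrite /P /deviates size_takel// leqnn/= Lv/=.
rewrite (_ : \sum_(i < 2 * N) _ = \sum_(i < 2 * N) pair_obs m (drop i v))//.
apply: eq_bigr => i _; rewrite -[in RHS](cat_take_drop L v).
have iL : (i + m.+1 <= L)%N by have := ltn_ord i; rewrite /L; lia.
rewrite drop_cat size_takel// (leq_trans _ iL) ?addnS ?ltnS ?leq_addr//.
by rewrite pair_obs_loc// size_drop size_takel// leq_subRL// (leq_trans _ iL)// leq_addr.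
Qed.

Definition generic x : Prop := forall m (e : R), 0 < e ->
  exists N0, forall N, (N0 <= N)%N ->
    `|pair_count x m N - (2 * N)%:R * pair_corr m| <= N%:R * e.

Lemma pair_corr_bounds m : 0 <= pair_corr m <= 1.
Proof.
exact: (mean_limit_bounds hp (pair_obs_01 m) (@pair_corr_cvg m)).
Qed.

(** The counts over consecutive squares control those in between. *)
Lemma pair_count_mono x m N d :
  0 <= pair_count x m (N + d) - pair_count x m N <= (2 * d)%:R.
Proof.
rewrite /pair_count (_ : (2 * (N + d) = d + (2 * N + d))%N); last by lia.
rewrite big_split_ord/= big_split_ord/=.
set A := \sum_(i < d) _; set B := \sum_(i < _) _; set D := \sum_(i < _) _.
set B' := \sum_(i < _) _.
have -> : B = B'.
  by apply: eq_bigr => i _; congr ((x _ && x _)%:R); rewrite /=; lia.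
have bnd (f : 'I_d -> bool) : 0 <= (\sum_(i < d) (f i)%:R : R) <= d%:R.
  rewrite -natr_sum ler0n ler_nat -[X in (_ <= X)%N]card_ord -sum1_card.
  by apply: leq_sum => i _; case: (f i).
have /andP[A0 A1] := bnd (fun i => x (- (N + d)%N%:Z + i) && x (- (N + d)%N%:Z + (i + m)%N)).
have /andP[D0 D1] : 0 <= D <= d%:R by exact: bnd.
have {}A0 : 0 <= A by [].
have {}A1 : A <= d%:R by [].
by rewrite natrM; apply/andP; split; lra.
Qed.

(** Between s^2 and (s+1)^2 the count changes by at most 4 s, which is small
against s^2. *)
Lemma generic_squares x :
  (forall m (r : nat), exists N0, forall N, (N0 <= N)%N ->
    ~ deviation_event m r.+1%:R^-1 (N.+1 ^ 2) x) -> generic x.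
Proof.
move=> H m e e0.
have [r Hr] : exists r : nat, r.+1%:R^-1 <= e / 8.
  have /cvgrPdist_le /(_ (e / 8)) : (n.+1%:R^-1 : R) @[n --> \oo] --> 0.
    exact: cvg_harmonic.
  have e8 : 0 < e / 8 by rewrite divr_gt0.
  move=> /(_ e8)[r _ /(_ r (leqnn r))]; rewrite /= sub0r normrN ger0_norm// => h.
  by exists r.
have [j0 Hj] := H m r.
pose K := (Num.trunc (16 / e)).+1.
have HK : 16 / e <= K%:R by rewrite /K ltW// truncnS_gt.
(* Beyond this bound the integer square root s of N exceeds both j0 and K. *)
exists ((maxn j0 K).+2 ^ 2)%N => N HN.
have [s /andP[s1 s2]] : exists s, (s ^ 2 <= N < s.+1 ^ 2)%N.
  have : (0 ^ 2 <= N)%N by [].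
  have ubs s : (s ^ 2 <= N)%N -> (s <= N)%N by nia.
  move=> /(ex_intro (fun s => (s ^ 2 <= N)%N) 0%N) ex.
  case: (ex_maxnP ex ubs) => s s1 smax; exists s; rewrite s1 ltnNge.
  by apply/negP => /smax; rewrite ltnn.
have sK : (maxn j0 K < s)%N.
  have : ((maxn j0 K).+2 ^ 2 < s.+1 ^ 2)%N by exact: leq_ltn_trans HN s2.
  by rewrite ltn_sqr; lia.
case: s s1 s2 sK => // s s1 s2; rewrite ltnS geq_max => /andP[js Ks].
have /negP := Hj s js; rewrite /deviation_event/= -leNgt => Hs.
have [d dE] : exists d, (N = s.+1 ^ 2 + d)%N by exists (N - s.+1 ^ 2)%N; lia.
have ds : (d <= 2 * s.+1)%N by rewrite dE in s2; nia.
have := pair_count_mono x m (s.+1 ^ 2) d; rewrite -dE.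
have /andP[c0 c1] := pair_corr_bounds m.
move: Hs; move: (pair_count x m N) (pair_count x m (s.+1 ^ 2)) => a b Hs /andP[h1 h2].
pose S : R := (s.+1 ^ 2)%:R.
have S0 : 0 <= S by exact: ler0n.
have NE : N%:R = S + d%:R :> R by rewrite dE natrD.
have d4 : d%:R <= S * (e / 8).
  apply: (@le_trans _ _ (2 * s.+1%:R)); first by rewrite -natrM ler_nat.
  have : 16 / e <= s.+1%:R by rewrite (le_trans HK)// ler_nat ltnW// ltnS.
  rewrite ler_pdivrMr// /S natrX; move: (ler0n R s.+1); move: (s.+1%:R) => t t0 ht.
  have te : 0 <= t * e - 16 by lra.
  have := mulr_ge0 t0 te; nra.
have Hs' : `|b - 2 * S * pair_corr m| <= 2 * S * (e / 8).
  move: Hs; rewrite natrM -/S => /le_trans; apply.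
  by rewrite ler_wpM2l// mulr_ge0.
move: Hs' h1 h2; rewrite !natrM NE.
have dc : 0 <= d%:R * pair_corr m <= d%:R.
  by rewrite mulr_ge0//= ler_piMr.
have ed : 0 <= d%:R * e by rewrite mulr_ge0// ltW.
rewrite !ler_norml => /andP[? ?] ? ?.
have -> : 2 * (S + d%:R) * pair_corr m = 2 * S * pair_corr m + 2 * (d%:R * pair_corr m) by ring.
have Se : S * (e / 8) = S * e / 8 by rewrite mulrA.
have Se2 : 2 * S * (e / 8) = S * e / 4 by field.
have Se0 : 0 <= S * e by rewrite mulr_ge0// ltW.
move: dc => /andP[? ?].
rewrite mulrDl.
by apply/andP; split; lra.
Qed.

(** Borel-Cantelli along the squares, where the bounds 1/N are summable. *)
Lemma ae_generic : exists E : set full_shift,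
  [/\ measurable E, mu E = 0%E & forall x, ~ E x -> generic x].
Proof.
pose D m (r : nat) N := deviation_event m r.+1%:R^-1 (N.+1 ^ 2).
(* Distance and accuracy range over countable sets, the accuracies being the inverses of the integers. *)
pose E0 (z : nat * nat) := lim_sup_set (D z.1 z.2).
have mE0 z : measurable (E0 z).
  apply: bigcap_measurable => // k _; apply: bigcup_measurable => j _.
  exact: measurable_deviation_event.
have E00 z : mu (E0 z) = 0%E.
  apply: lim_sup_set_cvg0; first by move=> k; exact: measurable_deviation_event.
  have e0 : (0 : R) < z.2.+1%:R^-1 by rewrite invr_gt0.
  have [C C0 HC] := deviation_event_bound z.1 e0.
  apply: (@le_lt_trans _ _ C%:E); last exact: ltry.
  apply: lime_le; first by apply: is_cvg_nneseries.
  apply: nearW => n.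
  apply: (@le_trans _ _ (\sum_(0 <= i < n) (C * (i.+1%:R^-1 - i.+2%:R^-1))%:E)%E).
    apply: lee_sum => i _; apply: (le_trans (HC _ _)); first by rewrite expn_gt0.
    rewrite lee_fin ler_wpM2l//.
    have i1 : (i.+1%:R : R) != 0 by rewrite pnatr_eq0.
    have i2 : (i.+2%:R : R) != 0 by rewrite pnatr_eq0.
    have -> : i.+1%:R^-1 - i.+2%:R^-1 = (i.+1 * i.+2)%:R^-1 :> R.
      rewrite natrM; move: i1 i2; rewrite -(natr1 i.+1); move: (i.+1%:R : R) => t t0 t1.
      by field; rewrite t0 t1.
    by rewrite lef_pV2 ?posrE ?ltr0n ?muln_gt0 ?expn_gt0// ler_nat; nia.
  rewrite sumEFin lee_fin -mulr_sumr -[X in _ <= X]mulr1 ler_wpM2l//.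
  rewrite (telescope_sumr_eq (fun i => - i.+1%:R^-1))//.
    by rewrite opprK addrC lerBlDr invr1 lerDl invr_ge0.
  by move=> i _; rewrite opprK addrC.
have mE : measurable (\bigcup_m \bigcup_r E0 (m, r) : set full_shift).
  by apply: bigcupT_measurable => m; apply: bigcupT_measurable => r.
exists (\bigcup_m \bigcup_r E0 (m, r)); split => //.
- apply/(negligibleP _ mE).
  apply: negligible_bigcup => m; apply: negligible_bigcup => r.
  by apply/(negligibleP _ (mE0 (m, r))); exact: E00.
- move=> x nE; apply: generic_squares => m r.
  apply: contrapT => nN; apply: nE; exists m => //; exists r => //= k _.
  apply: contrapT => nk; apply: nN; exists k => N kN DN; apply: nk.
  by exists N.
Qed.

End WordFrequencyMeasure.

(** * Transfer to the geometric hull *)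

Section HullTransfer.
Context {R : realType} (p : R).
Implicit Types (x : int -> letter) (t s : R).

Lemma translate_tilingE t x (y : R) c :
  translate t (tiling_of x) (y, c) <-> exists2 n : int, y = n%:~R + t & c = x n.
Proof.
rewrite /translate /tiling_of/=; split => [[n [yE ->]]|[n -> ->]].
  by exists n => //; rewrite -yE subrK.
by exists n; rewrite addrK.
Qed.

Lemma translate_tiling_shift t x (k : int) :
  translate (t + k%:~R) (tiling_of x) =
  translate t (tiling_of (fun n => x (n - k))).
Proof.
apply/seteqP; split => -[y c] /translate_tilingE[n -> ->];
  apply/translate_tilingE.
  by exists (n + k); rewrite ?addrK// intrD; ring.
by exists (n - k) => //; rewrite intrB; ring.
Qed.

Lemma X_rho_shift x (k : int) : X_rho p x -> X_rho p (fun n => x (n - k)).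
Proof.
move=> Xx m n; rewrite (_ : window _ m n = window x (m - k) n)//.
by apply/eq_mkseq => i; congr x; rewrite addrAC.
Qed.

Lemma tiling_phase_unique t t' x x' : 0 <= t < 1 -> 0 <= t' < 1 ->
  translate t (tiling_of x) = translate t' (tiling_of x') -> t = t' /\ x = x'.
Proof.
move=> t01 t'01 TT'.
have tt' : t = t'.
  have : translate t (tiling_of x) (t, x 0).
    by apply/translate_tilingE; exists 0; rewrite ?add0r.
  rewrite TT' => /translate_tilingE[n tE _].
  move/andP: t01 => [t0 t1]; move/andP: t'01 => [t'0 t'1].
  have n1 : n < 1 by rewrite -(ltr_int R); lra.
  have n2 : - 1 < n by rewrite -(ltr_int R) intrN; lra.
  have n0 : n = 0 by lia.
  by rewrite tE n0 add0r.
split => //; apply/funext => n.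
have : translate t (tiling_of x) (n%:~R + t, x n).
  by apply/translate_tilingE; exists n.
rewrite TT' -tt' => /translate_tilingE[k /addIr/intr_inj <- ].
by [].
Qed.

(** Phase 0 is excluded: the lift of a cylinder is then open in the hull
([lifted_cylinder_open]), because a small translation cannot move a tile
boundary across the origin. *)
Definition lifted (E : set (int -> letter)) : set (tiling R) :=
  [set T | exists x t, [/\ X_rho p x, E x, 0 < t < 1 &
                           T = translate t (tiling_of x)]].

Lemma lifted_hull E : lifted E `<=` geometric_hull p.
Proof. by move=> T [x [t [Xx _ _ ->]]]; exists x, t. Qed.

Lemma liftedP E x t : 0 <= t < 1 ->
  lifted E (translate t (tiling_of x)) <-> [/\ X_rho p x, E x & 0 < t].
Proof.
move=> t01; split => [[x' [t' [Xx' Ex' t'01 eqT]]]|[Xx Ex t0]].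
  have t'01' : 0 <= t' < 1 by case/andP: t'01 => /ltW -> ->.
  have [-> ->] := tiling_phase_unique t01 t'01' eqT.
  by case/andP: t'01.
by exists x, t; split => //; rewrite t0; case/andP: t01.
Qed.

(** A tiling that agrees with a given one on a large interval, up to a
translation smaller than the distance of the phase from 0 and 1, has the
same word at the same position and again an interior phase. *)
Lemma lifted_cylinder_open m w : hull_open p (lifted (cylinder m w)).
Proof.
split; first exact: lifted_hull.
move=> T [x [t [Xx wx t01 TE]]].
have /andP[t0 t1] := t01.
(* Large enough for all tiles of the cylinder, after a small translation, to meet the window. *)
pose M : R := `|m|%:~R + (size w)%:R + 2.
have M0 : 0 < M by rewrite ltr_wpDl// addr_ge0// ler0z.
pose e := Num.min (Num.min (t / 2) ((1 - t) / 2)) M^-1.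
have e0 : 0 < e by rewrite !lt_min invr_gt0 M0 !divr_gt0// subr_gt0.
have et : e <= t / 2 by rewrite /e !ge_min lexx.
have et' : e <= (1 - t) / 2 by rewrite /e !ge_min lexx orbT.
have eM : M <= e^-1.
  by rewrite -[M]invrK lef_pV2 ?posrE ?invr_gt0// /e !ge_min lexx !orbT.
exists e => // T' [x0 [t0' [Xx0 T'E]]] [s [se H]].
move: se; rewrite ler_norml => /andP[se1 se2].
have key n : `|n%:~R : R| <= M - 2 -> T' (n%:~R + (t + s), x n).
  move=> nM; apply/H => /=.
    exists (n%:~R + (t + s)) => /=; split; rewrite /= in_itv/=.
      by rewrite lexx lerDl ler01.
    by move: nM; rewrite ler_norml => /andP[? ?]; apply/andP; split; lra.
  rewrite /translate TE/=; apply/translate_tilingE; exists n => //; ring.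
have /translate_tilingE : translate t0' (tiling_of x0) (0%:~R + (t + s), x 0).
  by rewrite -T'E; apply: key; rewrite normr0 /M addrK addr_ge0// ler0z.
move=> [n0]; rewrite add0r => tsE _.
pose x1 n := x0 (n - - n0).
have T'E' : T' = translate (t + s) (tiling_of x1).
  have tE : t0' = (t + s) + (- n0)%:~R by rewrite tsE intrN; ring.
  by rewrite T'E tE translate_tiling_shift.
exists x1, (t + s); split => //.
- exact: X_rho_shift.
- rewrite /cylinder/= -[RHS]wx.
  apply: (@eq_from_nth _ false); rewrite !size_window// => i iw.
  rewrite !nth_window//.
  have : T' ((m + i%:Z)%:~R + (t + s), x (m + i%:Z)).
    apply: key; rewrite intrD /M addrK (le_trans (ler_normD _ _))//.
    rewrite -intr_norm lerD2l ger0_norm ?ler0z// -[i%:Z%:~R]/(i%:R) ler_nat.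
    exact: ltnW.
  by rewrite T'E' => /translate_tilingE[k /addIr/intr_inj <- ->].
- by apply/andP; split; lra.
Qed.

(** The sets with a measurable lift form a sigma-algebra, since phase and
sequence are determined by the tiling ([tiling_phase_unique]). *)
Lemma measurable_lifted (E : set full_shift) : measurable E ->
  measurable (lifted E : set (hull_space p)).
Proof.
have mO (A : set (tiling R)) : hull_open p A -> measurable (A : set (hull_space p)).
  by move=> Ao; exact: sub_sigma_algebra.
have liftT : lifted setT = lifted (cylinder 0 [::]).
  by congr lifted; apply/seteqP; split.
have mT : measurable (lifted setT : set (hull_space p)).
  by rewrite liftT; apply: mO; exact: lifted_cylinder_open.
pose C := [set E : set (int -> letter) | measurable (lifted E : set (hull_space p))].
suff : <<s cylinders >> `<=` C by apply.
apply: smallest_sub; last first.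
  by move=> _ [m [w ->]]; apply: mO; exact: lifted_cylinder_open.
split => [|A mA|F mF]; rewrite /C/=.
- rewrite (_ : lifted set0 = set0); first exact: measurable0.
  by apply/seteqP; split => // T [x [t []]].
- rewrite (_ : lifted (setT `\` A) = lifted setT `\` lifted A).
    exact: measurableD.
  apply/seteqP; split => T.
    move=> [x [t [Xx [_ nA] t01 ->]]].
    have t01' : 0 <= t < 1 by case/andP: t01 => /ltW -> ->.
    split; first by exists x, t.
    by move/(liftedP _ _ t01') => [].
  move=> [[x [t [Xx _ t01 ->]]]].
  have t01' : 0 <= t < 1 by case/andP: t01 => /ltW -> ->.
  move=> nl; exists x, t; split => //; split => // Ax; apply: nl.
  by apply/(liftedP _ _ t01'); split => //; case/andP: t01.
- rewrite (_ : lifted (\bigcup_k F k) = \bigcup_k lifted (F k)).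
    exact: bigcupT_measurable.
  apply/seteqP; split => T.
    by move=> [x [t [Xx [k _ Fx] t01 ->]]]; exists k => //; exists x, t.
  by move=> [k _ [x [t [Xx Fx t01 ->]]]]; exists x, t; split => //; exists k.
Qed.

(** The suspension measure of a lift is the measure of its base, so the lift of
a null set is null and the lift of everything has full measure. *)
Lemma ae_lifted (mu : probability full_shift R) (nu : probability (hull_space p) R)
    (E : set full_shift) :
  mu (X_rho p) = 1%E ->
  (forall A : set (hull_space p), measurable A ->
    nu A = (mu \x @lebesgue_measure R)%E
      [set xt | 0 <= xt.2 < 1 /\ A (translate xt.2 (tiling_of xt.1))]) ->
  measurable E -> mu E = 0%E ->
  {ae nu, forall T : hull_space p, exists x t,
    [/\ ~ E x, 0 < t < 1 & T = translate t (tiling_of x)]}.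
Proof.
move=> muX nuE mE E0.
have nul (A : set full_shift) : measurable A ->
    nu (lifted A : set (hull_space p)) = mu (A `&` X_rho p).
  move=> mA; rewrite nuE; last exact: measurable_lifted.
  rewrite (_ : [set xt | _] = (A `&` X_rho p) `*` `]0, 1[); last first.
    apply/seteqP; split => -[x t] /=.
      move=> [t01 /(liftedP _ _ t01)[Xx Ax t0]]; split => //.
      by rewrite in_itv/= t0; case/andP: t01.
    rewrite in_itv/= => -[[Ax Xx] /andP[t0 t1]].
    by rewrite ltW//; split => //; apply/liftedP; rewrite ?ltW.
  rewrite product_measure1E//; last first.
    by apply: measurableI => //; exact: measurable_X_rho.
  have l01 : @lebesgue_measure R `]0%R, 1%R[%classic = 1%E.
    by rewrite lebesgue_measure_itv/= lte_fin ltr01 sube0.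
  by transitivity (mu (A `&` X_rho p) * 1)%E; [congr (_ * _)%E; exact: l01|rewrite mule1].
have lE0 : nu (lifted E : set (hull_space p)) = 0%E.
  rewrite nul//; apply/eqP; rewrite -measure_le0 -E0 le_measure ?inE//.
  by apply: measurableI => //; exact: measurable_X_rho.
have lT0 : nu (~` lifted setT : set (hull_space p)) = 0%E.
  rewrite probability_setC; last exact: measurable_lifted.
  by rewrite nul// setTI muX subee.
have mlE : measurable (lifted E : set (hull_space p)) by exact: measurable_lifted.
have mlT : measurable (~` lifted setT : set (hull_space p)).
  by apply: measurableC; exact: measurable_lifted.
exists (lifted E `|` ~` lifted setT); split.
- exact: measurableU.
- by rewrite measureU0.
- move=> T /= nT; apply: contrapT => nl; apply: nT.
  have lT : lifted setT T by apply: contrapT => h; apply: nl; right.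
  case: lT => x [t [Xx _ t01 TE]]; exists x, t; split => // Ex; apply: nl; left.
  by exists x, t.
Qed.

End HullTransfer.

(** * The autocorrelation of a generic tiling *)

Section Counting.
Context {R : realType}.
Implicit Types (x : int -> letter) (t r : R).

Lemma vol_centred (A : set R) r : is_interval A -> 0 <= r ->
  `]- r, r[ `<=` A -> A `<=` `[- r, r] -> vol A = 2 * r.
Proof.
move=> iA r0 rA Ar.
have mA : measurable (A : set (measurableTypeR R)) by exact: measurable_realfun.is_interval_measurable.
rewrite /vol; suff -> : @lebesgue_measure R A = (2 * r)%:E by [].
have E b1 b2 : @lebesgue_measure R [set` Interval (BSide b1 (- r)) (BSide b2 r)] = (2 * r)%:E.
  rewrite lebesgue_measure_itv/= lte_fin.
  case: ltP => h; first by rewrite -EFinD opprK; congr EFin; ring.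
  by congr EFin; lra.
by apply/eqP; rewrite eq_le -{1}(E true false) -(E false true) !le_measure ?inE.
Qed.

(** With N <= r < N + 1 and a phase in ]0, 1[, every point of the tiling in
[-r, r] is the left endpoint of a tile at one of the sites -N-1, ..., N. *)
Let site N (i : nat) : int := - N.+1%:Z + i%:Z.

Lemma double_sum_by_difference (W M : nat) (e : nat -> R) (f : int -> R) :
  (forall d : int, (M < `|d|)%N -> f d = 0) ->
  \sum_(i < W) \sum_(j < W) e i * e j * f (i%:Z - j%:Z) =
  \sum_(d < 2 * M + 1) f (d%:Z - M%:Z) *
    \sum_(i < W) \sum_(j < W) e i * e j * (i + M == j + d)%N%:R.
Proof.
move=> fM.
under [RHS]eq_bigr do rewrite mulr_sumr.
rewrite [RHS]exchange_big/=; apply: eq_bigr => i _.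
under [RHS]eq_bigr do rewrite mulr_sumr.
rewrite [RHS]exchange_big/=; apply: eq_bigr => j _.
have [ijM|Mij] := leqP `|i%:Z - j%:Z| M; last first.
  rewrite fM// mulr0 big1// => d _.
  case: eqP => [h|_]; last by rewrite !mulr0.
  by exfalso; have := ltn_ord d; move: h Mij; lia.
pose D := absz (i%:Z - j%:Z + M%:Z).
have hd : (D < 2 * M + 1)%N by rewrite /D; lia.
rewrite (bigD1 (Ordinal hd))//= big1 ?addr0.
  have -> : ((i + M)%N == (j + D)%N) by apply/eqP; rewrite /D; lia.
  by rewrite mulr1 mulrC; congr (f _ * _); rewrite /D; lia.
move=> d /negP nd; case: eqP => [h|_]; last by rewrite !mulr0.
by exfalso; apply: nd; apply/eqP/val_inj => /=; lia.
Qed.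

Lemma pair_sum_shift (W d : nat) (e : nat -> R) :
  \sum_(i < W) \sum_(j < W) e i * e j * ((i : nat) == (j + d)%N)%:R =
  \sum_(j < W) e j * e (j + d)%N * (j + d < W)%N%:R.
Proof.
rewrite exchange_big/=; apply: eq_bigr => j _.
case: ltnP => h.
  rewrite (bigD1 (Ordinal h))//= eqxx big1 ?addr0; first by rewrite !mulr1 mulrC.
  by move=> i /negP ni; case: eqP => [ie|_]; rewrite ?mulr0//;
    exfalso; apply: ni; apply/eqP/val_inj.
rewrite mulr0 big1// => i _; case: eqP => [ie|_]; rewrite ?mulr0//.
by exfalso; have := ltn_ord i; lia.
Qed.

(** Only the two outermost sites may differ from the window of [pair_count],
and only the last [d] sites have their partner outside of it. *)
Lemma pair_sum_near x (N d : nat) (e : nat -> bool) :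
  (forall i, e i -> x (site N i)) ->
  (forall i, (0 < i <= 2 * N)%N -> x (site N i) -> e i) ->
  `|\sum_(j < 2 * N + 2) (e j)%:R * (e (j + d)%N)%:R * (j + d < 2 * N + 2)%N%:R -
    (pair_count x d N : R)| <= d%:R + 2.
Proof.
move=> ex xe.
have -> : (2 * N + 2 = (2 * N).+2)%N by lia.
rewrite big_ord_recl big_ord_recr/=.
set a := _ * _ * _; set c := _ * _ * _.
have b01 (b1 b2 b3 : bool) : 0 <= (b1%:R * b2%:R * b3%:R : R) <= 1.
  by rewrite -!natrM ler0n/= lern1; case: b1; case: b2; case: b3.
have /andP[a0 a1] : 0 <= a <= 1 by exact: b01.
have /andP[c0 c1] : 0 <= c <= 1 by exact: b01.
rewrite /pair_count.
set S := \sum_(i < _) _; set T := \sum_(i < _) _.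
suff : `|S - T| <= d%:R.
  by rewrite !ler_norml => /andP[? ?]; apply/andP; split; lra.
rewrite /S /T -sumrB (le_trans (ler_norm_sum _ _ _))//.
apply: (@le_trans _ _ (\sum_(i < 2 * N) (2 * N - i <= d)%N%:R)).
  apply: ler_sum => i _.
  rewrite /bump /= !add1n.
  have iN := ltn_ord i.
  have s1 : site N i.+1 = - N%:Z + i%:Z by rewrite /site; lia.
  have s2 : site N (i.+1 + d) = - N%:Z + (i + d)%:Z by rewrite /site; lia.
  rewrite -s1 -s2.
  have e1 : e i.+1 = x (site N i.+1).
    by apply/idP/idP => [/ex//|xi]; apply: xe => //; lia.
  have [id|id] := leqP (2 * N - i)%N d.
    have := b01 (e i.+1) (e (i.+1 + d)%N) (i.+1 + d < (2 * N).+2)%N.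
    rewrite ler_norml /= => /andP[? ?].
    have h01 (c' : bool) : 0 <= (c'%:R : R) <= 1 by rewrite ler0n lern1 leq_b1.
    have /andP[? ?] := h01 (x (site N i.+1) && x (site N (i.+1 + d))).
    by apply/andP; split; lra.
  have e2 : e (i.+1 + d)%N = x (site N (i.+1 + d)).
    by apply/idP/idP => [/ex//|xi]; apply: xe => //; lia.
  have -> : (i.+1 + d < (2 * N).+2)%N by lia.
  by rewrite e1 e2 mulr1 -natrM mulnb subrr normr0.
by rewrite -natr_sum ler_nat sum_near_end.
Qed.

(** The occupied points in the averaging interval, as an indicator on the
2N + 2 candidate sites. *)
Lemma autocorr_sumE (B : set R) t x (f : R -> R) r (N : nat) :
  0 < t < 1 -> `]- r, r[ `<=` B -> B `<=` `[- r, r] ->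
  N%:R <= r < N.+1%:R ->
  exists e : nat -> bool,
  [/\ (forall i, e i -> x (site N i)),
      (forall i, (0 < i <= 2 * N)%N -> x (site N i) -> e i) &
      let L := left_endpoints (translate t (tiling_of x)) true in
      \sum_(z \in (L `&` B) `*` (L `&` B)) f (z.1 - z.2) =
      \sum_(i < 2 * N + 2) \sum_(j < 2 * N + 2)
         (e i)%:R * (e j)%:R * f (i%:Z - j%:Z)%:~R].
Proof.
move=> /andP[t0 t1] rB Br /andP[Nr rN].
pose pt (i : nat) : R := (site N i)%:~R + t.
have ptE i : pt i = i%:R + t - N.+1%:R.
  by rewrite /pt /site intrD intrN -!pmulrn; ring.
pose e i := x (site N i) && `[< B (pt i) >].
exists e; split.
- by move=> i /andP[].
- move=> i iN xi; rewrite /e xi; apply/asboolP/rB => /=; rewrite in_itv/= ptE.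
  have [i1 i2] : (1 : R) <= i%:R /\ i%:R <= 2 * N%:R :> R.
    by rewrite -natrM ler1n ler_nat; lia.
  by rewrite -natr1; apply/andP; split; lra.
move=> L; set W := (2 * N + 2)%N.
pose s := [seq i <- iota 0 W | e i].
have LB : L `&` B = [set pt i | i in [set` s]].
  apply/seteqP; split => y /=.
    rewrite /L /left_endpoints/= /translate /tiling_of => -[[n [yn xn]] By].
    have yE : y = n%:~R + t by rewrite -[n%:~R]yn subrK.
    have := Br _ By; rewrite /= in_itv/= yE => /andP[h1 h2].
    have n1 : - N.+2%:Z < n.
      by rewrite -(ltr_int R) intrN -pmulrn -natr1; move: rN; rewrite -natr1; lra.
    have n2 : n < N.+1%:Z by rewrite -(ltr_int R) -pmulrn; lra.
    have sE : site N `|n + N.+1%:Z| = n by rewrite /site; lia.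
    exists (absz (n + N.+1%:Z)); last by rewrite /pt sE.
    rewrite /= mem_filter mem_iota /e sE -xn /=; apply/andP; split; last by rewrite /W; lia.
    by apply/asboolP; rewrite /pt sE -yE.
  case=> i; rewrite mem_filter => /andP[/andP[xi /asboolP Bi] _] <-; split => //.
  by exists (site N i); rewrite addrK xi.
have inj : injective pt by move=> i j; rewrite !ptE => /addIr/addIr/eqP; rewrite eqr_nat => /eqP.
have -> : (L `&` B) `*` (L `&` B) =
   [set` [seq (pt i, pt j) | i <- s, j <- s]].
  rewrite LB; apply/seteqP; split => -[a b] /=.
    by move=> [[i si <-] [j sj <-]]; apply/allpairsP; exists (i, j).
  by move=> /allpairsP[[i j] /= [si sj [-> ->]]]; split; [exists i|exists j].
rewrite -fsbig_seq; last first.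
  apply: allpairs_uniq; rewrite ?filter_uniq ?iota_uniq//.
  by move=> [i j] [i' j'] _ _ /= [/inj -> /inj ->].
rewrite big_allpairs_dep/= /s big_filter.
have eqs (F : nat -> R) : \sum_(i <- iota 0 W | e i) F i = \sum_(i < W) (e i)%:R * F i.
  rewrite -(big_mkord xpredT (fun i => (e i)%:R * F i)) /index_iota subn0 big_mkcond/=.
  by apply: eq_bigr => i _; case: (e i); rewrite ?mul1r ?mul0r.
rewrite eqs; apply: eq_bigr => i _; rewrite big_filter eqs mulr_sumr.
apply: eq_bigr => j _; rewrite mulrA; congr (_ * f _).
by rewrite !ptE intrB -!pmulrn; ring.
Qed.

Variable eta : nat -> R.

Lemma pair_average_cvg x d (V : nat -> R) (N : nat -> nat) (C : nat -> R) K :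
  (forall (e : R), 0 < e -> exists N0, forall N, (N0 <= N)%N ->
    `|pair_count x d N - (2 * N)%:R * eta d| <= N%:R * e) ->
  `|eta d| <= 1 ->
  (forall n, 2 * (N n)%:R <= V n <= 2 * (N n)%:R + 2) ->
  V n @[n --> \oo] --> +oo ->
  (forall n, `|C n - pair_count x d (N n)| <= K) ->
  (V n)^-1 * C n @[n --> \oo] --> eta d.
Proof.
move=> gx e1 NV Voo CK.
apply/cvgrPdist_le => e e0.
have e20 : 0 < e / 2 by rewrite divr_gt0.
have [N0 HN0] := gx _ e20.
near=> n.
have K0 : 0 <= K by exact: le_trans (normr_ge0 _) (CK n).
have Vn : (4 * (K + 2) / e + 2 * N0%:R + 4) <= V n by near: n; move/cvgryPge: Voo; exact.
have Ke : 0 <= 4 * (K + 2) / e by apply: divr_ge0; [apply: mulr_ge0 => //; apply: addr_ge0|exact: ltW].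
have V0 : 0 < V n.
  by rewrite (lt_le_trans _ Vn)// ltr_wpDl// addr_ge0// mulr_ge0.
have /andP[V1 V2] := NV n.
have NN0 : (N0 <= N n)%N.
  by rewrite -(ler_nat R); move: Ke Vn V2; move: (4 * (K + 2) / e) => a *; lra.
have := HN0 _ NN0; have := CK n; rewrite natrM.
move: (pair_count _ _ _) => P h1 h2.
have -> : eta d - (V n)^-1 * C n = (V n)^-1 * (V n * eta d - C n).
  by rewrite mulrBr mulrA mulVf ?mul1r// gt_eqF.
have Vi : 0 <= (V n)^-1 by rewrite invr_ge0 ltW.
rewrite normrM [X in X * _]ger0_norm//.
rewrite [X in X <= _]mulrC ler_pdivrMr//.
have h3 : `|V n * eta d - C n| <= K + (N n)%:R * (e / 2) + 2.
  have -> : V n * eta d - C n = (P - C n) + (2 * (N n)%:R * eta d - P) +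
      (V n - 2 * (N n)%:R) * eta d by ring.
  apply: (le_trans (ler_normD _ _)); apply: lerD.
    apply: (le_trans (ler_normD _ _)); apply: lerD; first by rewrite distrC.
    by rewrite distrC.
  rewrite normrM -[2]mulr1; apply: ler_pM => //.
  by rewrite ger0_norm; lra.
apply: (le_trans h3).
have h4 : K + 2 <= V n * e / 4.
  have : 4 * (K + 2) / e <= V n.
    have N00 : 0 <= 2 * N0%:R :> R by rewrite mulr_ge0.
    by move: Vn; move: (4 * (K + 2) / e) => a ?; lra.
  by rewrite ler_pdivrMr// => ?; lra.
have h5 : (N n)%:R * e <= V n * e / 2.
  have : 2 * (N n)%:R * e <= V n * e by rewrite ler_wpM2r// ltW.
  by move=> ?; lra.
have -> : (N n)%:R * (e / 2) = (N n)%:R * e / 2 by rewrite mulrA.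
by rewrite mulrC; move: h4 h5; rewrite [V n * e]mulrC => *; lra.
Unshelve. all: by end_near.
Qed.

(** A compactly supported function meets only finitely many differences of
points; for each of them the sum counts pairs in a window whose length differs
from the volume by a bounded amount. *)
Lemma autocorrelation_cvg x t (B : nat -> set R) (f : R -> R) (M : nat) :
  (forall d (e : R), 0 < e -> exists N0, forall N, (N0 <= N)%N ->
    `|pair_count x d N - (2 * N)%:R * eta d| <= N%:R * e) ->
  (forall d, `|eta d| <= 1) ->
  0 < t < 1 -> averaging_sequence B ->
  (forall z, M%:R < `|z| -> f z = 0) ->
  let L := left_endpoints (translate t (tiling_of x)) true in
  (vol (B n))^-1 * \sum_(z \in (L `&` B n) `*` (L `&` B n)) f (z.1 - z.2)
    @[n --> \oo] -->
  \sum_(d < 2 * M + 1) f (d%:Z - M%:Z)%:~R * eta `|d%:Z - M%:Z|%N.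
Proof.
move=> gx pair_mean_1 t01 [cB incB volB] fM L.
have /choice[rr Hr] : forall n, exists r, [/\ 0 <= r, `]- r, r[ `<=` B n & B n `<=` `[- r, r] ].
  by move=> n; have [_ [r r0 [h1 h2]]] := cB n; exists r.
have volE n : vol (B n) = 2 * rr n.
  by have [r0 h1 h2] := Hr n; apply: vol_centred => //; have [] := cB n.
pose N n := Num.trunc (rr n).
have NE n : (N n)%:R <= rr n < (N n).+1%:R.
  by apply: truncn_itv; have [] := Hr n.
have /choice[ee He] : forall n, exists e : nat -> bool,
  [/\ (forall i, e i -> x (site (N n) i)),
      (forall i, (0 < i <= 2 * N n)%N -> x (site (N n) i) -> e i) &
      \sum_(z \in (L `&` B n) `*` (L `&` B n)) f (z.1 - z.2) =
      \sum_(i < 2 * N n + 2) \sum_(j < 2 * N n + 2)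
         (e i)%:R * (e j)%:R * f (i%:Z - j%:Z)%:~R].
  move=> n; have [r0 h1 h2] := Hr n.
  exact: (autocorr_sumE x f t01 h1 h2 (NE n)).
have fM' (d : int) : (M < `|d|)%N -> f d%:~R = 0.
  move=> Md; apply: fM; rewrite -intr_norm -abszE -pmulrn ltr_nat.
  by [].
have -> : (fun n => (vol (B n))^-1 *
     \sum_(z \in (L `&` B n) `*` (L `&` B n)) f (z.1 - z.2)) =
  (fun n => \sum_(d < 2 * M + 1) f (d%:Z - M%:Z)%:~R *
    ((vol (B n))^-1 * \sum_(i < 2 * N n + 2) \sum_(j < 2 * N n + 2)
      (ee n i)%:R * (ee n j)%:R * (i + M == j + d)%N%:R)).
  apply/funext => n; have [_ _ ->] := He n.
  rewrite (@double_sum_by_difference _ M (fun i => (ee n i)%:R) (fun d => f d%:~R))//.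
  by rewrite mulr_sumr; apply: eq_bigr => d _; rewrite mulrCA.
apply: cvg_big => [|d _]; first exact: add_continuous.
apply: cvgMr.
pose D := `|d%:Z - M%:Z|%N.
apply: (@pair_average_cvg x D (fun n => vol (B n)) N _ (D%:R + 2)) => //.
- exact: gx.
- move=> n; rewrite volE; have /andP[h1 h2] := NE n.
  by rewrite -natr1 in h2; apply/andP; split; lra.
- move=> n; have [e1 e2 _] := He n.
  have := pair_sum_near D e1 e2.
  rewrite -(@pair_sum_shift _ D (fun i => (ee n i)%:R)).
  have [Md|dM] := leqP M d.
    congr (`|_ - _| <= _); apply: eq_bigr => i _; apply: eq_bigr => j _.
    by congr (_ * _%:R); congr nat_of_bool; apply/eqP/eqP; rewrite /D; lia.
  rewrite exchange_big/=.
  congr (`|_ - _| <= _); apply: eq_bigr => i _; apply: eq_bigr => j _.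
  rewrite [X in X * _]mulrC; congr (_ * _%:R); congr nat_of_bool.
  by apply/eqP/eqP; rewrite /D; lia.
Qed.

End Counting.

(** * Bilateral series and the renormalisation of the pairing with the autocorrelation *)

Section BilateralSeries.
Context {R : realType}.
Implicit Types (a b : int -> R) (K : R).

(** The window -N <= m < N is not symmetric: this is the choice for which the
window of radius 2N splits exactly into even and odd indices
([bisum_evenodd]). *)
Definition bisum a (N : nat) : R :=
  \sum_(i < N) a i%:Z + \sum_(i < N) a (- i.+1%:Z).

Definition bilim a : R := limn (bisum a).

Definition bisummable_by K a := forall N, bisum (fun m => `|a m|) N <= K.
Definition bisummable a := exists K, bisummable_by K a.

Lemma bisumD a b N : bisum (fun m => a m + b m) N = bisum a N + bisum b N.
Proof. by rewrite /bisum !big_split/=; ring. Qed.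

Lemma bisumZ (k : R) a N : bisum (fun m => k * a m) N = k * bisum a N.
Proof. by rewrite /bisum -!mulr_sumr mulrDr. Qed.

Lemma ler_bisum a b N : (forall m, a m <= b m) -> bisum a N <= bisum b N.
Proof. by move=> ab; apply: lerD; apply: ler_sum. Qed.

Lemma bisum_ge0 a N : (forall m, 0 <= a m) -> 0 <= bisum a N.
Proof. by move=> a0; apply: addr_ge0; apply: sumr_ge0. Qed.

Lemma ler_norm_bisum a N : `|bisum a N| <= bisum (fun m => `|a m|) N.
Proof.
by apply: (le_trans (ler_normD _ _)); apply: lerD; exact: ler_norm_sum.
Qed.

Lemma bisummable_le a b : (forall m, `|a m| <= `|b m|) -> bisummable b -> bisummable a.
Proof.
by move=> ab [K HK]; exists K => N; apply: le_trans (HK N); exact: ler_bisum.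
Qed.

Lemma bisummableD a b : bisummable a -> bisummable b ->
  bisummable (fun m => a m + b m).
Proof.
move=> [K HK] [K' HK']; exists (K + K') => N.
apply: (@le_trans _ _ (bisum (fun m => `|a m| + `|b m|) N)).
  by apply: ler_bisum => m; exact: ler_normD.
by rewrite bisumD lerD.
Qed.

Lemma bisummableM a b : (forall m, `|b m| <= 1) -> bisummable a ->
  bisummable (fun m => b m * a m).
Proof.
by move=> b1; apply: bisummable_le => m; rewrite normrM ler_piMl.
Qed.

Lemma bisummableZ (k : R) a : bisummable a -> bisummable (fun m => k * a m).
Proof.
move=> [K HK]; exists (`|k| * K) => N.
rewrite (_ : (fun m => _) = (fun m => `|k| * `|a m|)) ?bisumZ ?ler_wpM2l//.
by apply/funext => m; rewrite normrM.
Qed.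

Lemma bisum_subseries a b K : bisummable_by K a ->
  (forall N, exists N', bisum (fun m => `|b m|) N <= bisum (fun m => `|a m|) N') ->
  bisummable_by K b.
Proof.
by move=> aK ab N; have [N' H] := ab N; exact: le_trans H (aK N').
Qed.

Lemma eq_cvgn (u v : nat -> R) (l : R) : u =1 v ->
  u @ \oo --> l -> v @ \oo --> l.
Proof. by move=> /funext ->. Qed.

Lemma series_abs_cvg (u : nat -> R) K :
  (forall N, \sum_(i < N) `|u i| <= K) -> cvgn (fun N => \sum_(i < N) u i).
Proof.
move=> uK; have E : series (fun i => `|u i|) = (fun N => \sum_(i < N) `|u i|).
  by apply/funext => N; rewrite /series/= big_mkord.
have H : cvgn (series (fun i => `|u i|)).
  rewrite E; apply: nondecreasing_is_cvgn.
    by apply/nondecreasing_seqP => n; rewrite big_ord_recr lerDl.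
  by exists K => _ [n _ <-]; exact: uK.
suff -> : (fun N => \sum_(i < N) u i) = series u by exact: normed_cvg H.
by apply/funext => N; rewrite /series/= big_mkord.
Qed.

Lemma bisum_cvg a : bisummable a -> bisum a @ \oo --> bilim a.
Proof.
move=> [K HK].
suff : cvgn (bisum a) by [].
have h1 : cvgn (fun N => \sum_(i < N) a i%:Z).
  apply: (@series_abs_cvg (fun i => a i%:Z) K) => N; apply: le_trans (HK N).
  by rewrite lerDl sumr_ge0.
have h2 : cvgn (fun N => \sum_(i < N) a (- i.+1%:Z)).
  apply: (@series_abs_cvg (fun i => a (- i.+1%:Z)) K) => N; apply: le_trans (HK N).
  by rewrite lerDr sumr_ge0.
exact: is_cvgD h1 h2.
Qed.

Lemma bilim_eq a (l : R) : bisum a @ \oo --> l -> bilim a = l.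
Proof. by move/cvg_lim; apply. Qed.

Lemma bilimD a b : bisummable a -> bisummable b ->
  bilim (fun m => a m + b m) = bilim a + bilim b.
Proof.
move=> /bisum_cvg ca /bisum_cvg cb; apply: bilim_eq.
by apply: eq_cvgn (cvgD ca cb) => N; rewrite bisumD.
Qed.

Lemma bilimZ (k : R) a : bisummable a -> bilim (fun m => k * a m) = k * bilim a.
Proof.
move=> /bisum_cvg ca; apply: bilim_eq.
apply: (@eq_cvgn (fun N => k * bisum a N)) => [N|]; first by rewrite bisumZ.
exact: cvgMr.
Qed.

Lemma bilim_norm K a : bisummable_by K a -> `|bilim a| <= K.
Proof.
move=> aK; have ca : bisum a @ \oo --> bilim a by apply: bisum_cvg; exists K.
have ca' : (fun N => `|bisum a N|) @ \oo --> `|bilim a| by exact: cvg_norm ca.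
rewrite -(cvg_lim _ ca')//; apply: limr_le; first by apply/cvg_ex; eexists; exact: ca'.
by apply: nearW => N; apply: le_trans (ler_norm_bisum _ _) (aK N).
Qed.

Lemma bisummable_pos a : bisummable a -> a n%:Z @[n --> \oo] --> (0 : R).
Proof.
move=> [K HK]; have := @series_abs_cvg (fun i => a i%:Z) K.
have H N : \sum_(i < N) `|a i%:Z| <= K.
  by apply: le_trans (HK N); rewrite lerDl sumr_ge0.
move=> /(_ H); under eq_fun do rewrite -(big_mkord xpredT (fun i => a i%:Z)).
exact: cvg_series_cvg_0.
Qed.

Lemma bisummable_neg a : bisummable a -> a (- n%:Z) @[n --> \oo] --> (0 : R).
Proof.
move=> [K HK]; have := @series_abs_cvg (fun i => a (- i.+1%:Z)) K.
have H N : \sum_(i < N) `|a (- i.+1%:Z)| <= K.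
  by apply: le_trans (HK N); rewrite lerDr sumr_ge0.
move=> /(_ H); under eq_fun do rewrite -(big_mkord xpredT (fun i => a (- i.+1%:Z))).
move/cvg_series_cvg_0 => h.
by have := h; rewrite (cvg_shiftS (fun n => a (- n%:Z))).
Qed.

Lemma bisum_evenodd a N :
  bisum a (2 * N) = bisum (fun j => a (2 * j)) N + bisum (fun j => a (2 * j + 1)) N.
Proof.
rewrite /bisum; elim: N => [|N IH]; first by rewrite !big_ord0 !addr0.
rewrite (_ : (2 * N.+1 = (2 * N).+2)%N); last by lia.
rewrite !big_ord_recr/=; move: IH.
have -> : 2 * N%:Z = (2 * N)%N%:Z by lia.
have -> : (2 * N)%N%:Z + 1 = (2 * N).+1%:Z by lia.
have -> : 2 * - N.+1%:Z = - (2 * N).+2%:Z by lia.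
have -> : - (2 * N).+2%:Z + 1 = - (2 * N).+1%:Z by lia.
move: (\sum_(i < 2 * N) _) (\sum_(i < 2 * N) _) (\sum_(i < N) _) (\sum_(i < N) _)
  (\sum_(i < N) _) (\sum_(i < N) _) => x1 x2 x3 x4 x5 x6 h.
by lra.
Qed.

Lemma bisum_shift a N :
  bisum (fun j => a (j + 1)) N = bisum a N + (a N%:Z - a (- N%:Z)).
Proof.
rewrite /bisum; elim: N => [|N IH]; first by rewrite !big_ord0 oppr0 subrr !addr0.
rewrite !big_ord_recr/=; move: IH.
have -> : N%:Z + 1 = N.+1%:Z by lia.
have -> : - N.+1%:Z + 1 = - N%:Z by lia.
move: (\sum_(i < N) _) (\sum_(i < N) _) (\sum_(i < N) _) (\sum_(i < N) _) => x1 x2 x3 x4 h.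
by lra.
Qed.

Lemma bisum_opp a N :
  bisum (fun j => a (- j)) N = bisum a N + (a N%:Z - a (- N%:Z)).
Proof.
rewrite -bisum_shift /bisum addrC; congr (_ + _); apply: eq_bigr => i _; congr a; lia.
Qed.

Lemma bisummable_even K a : bisummable_by K a -> bisummable_by K (fun j => a (2 * j)).
Proof.
move=> aK; apply: bisum_subseries aK _ => N; exists (2 * N)%N.
by rewrite bisum_evenodd lerDl bisum_ge0.
Qed.

Lemma bisummable_odd K a : bisummable_by K a -> bisummable_by K (fun j => a (2 * j + 1)).
Proof.
move=> aK; apply: bisum_subseries aK _ => N; exists (2 * N)%N.
by rewrite bisum_evenodd lerDr bisum_ge0.
Qed.

Lemma bisummable_odd_pred K a : bisummable_by K a -> bisummable_by K (fun j => a (2 * j - 1)).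
Proof.
move=> aK; apply: bisum_subseries aK _ => N; exists (2 * N.+1)%N.
rewrite bisum_evenodd -[X in X <= _]add0r; apply: lerD; first exact: bisum_ge0.
pose b j := `|a (2 * j + 1)|.
have -> : bisum (fun j => `|a (2 * j - 1)|) N = bisum (fun j => b (j - 1)) N.
  by congr bisum; apply/funext => j; rewrite /b; congr (`|a _|); ring.
have := bisum_shift (fun j => b (j - 1)) N.
have -> : (fun j => b (j + 1 - 1)) = b by apply/funext => j; rewrite addrK.
move=> h; have {h}-> : bisum (fun j => b (j - 1)) N =
   bisum b N - (b (N%:Z - 1) - b (- N%:Z - 1)) by rewrite h; ring.
rewrite /bisum !big_ord_recr/= -/(b _).
have -> : - N%:Z - 1 = - N.+1%:Z by lia.
have b0 j : 0 <= b j by exact: normr_ge0.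
have := b0 N%:Z; have := b0 (N%:Z - 1); have := b0 (- N.+1%:Z).
by rewrite -!/(b _) => *; lra.
Qed.

Lemma bilim_evenodd a : bisummable a ->
  bilim a = bilim (fun j => a (2 * j)) + bilim (fun j => a (2 * j + 1)).
Proof.
move=> sa; have [K aK] := sa.
have ce := @bisum_cvg (fun j => a (2 * j)) (ex_intro _ K (bisummable_even aK)).
have co := @bisum_cvg (fun j => a (2 * j + 1)) (ex_intro _ K (bisummable_odd aK)).
have h : (fun N => bisum (fun j => a (2 * j)) N + bisum (fun j => a (2 * j + 1)) N) @ \oo
    --> bilim (fun j => a (2 * j)) + bilim (fun j => a (2 * j + 1)).
  exact: cvgD.
have h2 : bisum a (2 * N)%N @[N --> \oo] --> bilim a.
  apply: (cvg_comp _ _ _ (bisum_cvg sa)).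
  apply/cvgnyPge => A; exists A => // n /= An; lia.
apply: (cvg_unique _ h2) => //.
by apply: (eq_cvgn _ h) => N; rewrite bisum_evenodd.
Qed.

(** The shifted window differs by two boundary terms, and those of a summable
family tend to 0. The same holds for the reflection in [bilim_odd_eq0]. *)
Lemma bilim_shift a : bisummable a -> bilim (fun j => a (j + 1)) = bilim a.
Proof.
move=> sa; apply: bilim_eq; apply: (@eq_cvgn (fun N => bisum a N + (a N%:Z - a (- N%:Z)))) => [N|].
  by rewrite bisum_shift.
rewrite -[X in _ --> X]addr0 -[X in _ --> _ + X](subrr 0).
apply: cvgD; first exact: bisum_cvg.
by apply: cvgB; [exact: bisummable_pos|exact: bisummable_neg].
Qed.

Lemma bisummable_shift a : bisummable a -> bisummable (fun j => a (j + 1)).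
Proof.
move=> [K aK]; exists (K + K) => N; rewrite (bisum_shift (fun j => `|a j|)).
have h := aK N.+1; rewrite /bisum !big_ord_recr/= in h.
apply: lerD; first exact: aK.
rewrite lerBlDr; apply: ler_wpDr => //.
apply: le_trans h; rewrite -addrA; apply: ler_wpDl; first exact: sumr_ge0.
by rewrite lerDl addr_ge0// sumr_ge0.
Qed.

Lemma bilim_odd_eq0 a : bisummable a -> (forall j, a (- j) = - a j) -> bilim a = 0.
Proof.
move=> sa odda; suff h : - bilim a = bilim a by lra.
rewrite -mulN1r -bilimZ//; apply: bilim_eq.
have -> : (fun m => -1 * a m) = (fun m => a (- m)).
  by apply/funext => m; rewrite odda mulN1r.
apply: (@eq_cvgn (fun N => bisum a N + (a N%:Z - a (- N%:Z)))) => [N|].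
  by rewrite bisum_opp.
rewrite -[X in _ --> X]addr0 -[X in _ --> _ + X](subrr 0).
apply: cvgD; first exact: bisum_cvg.
by apply: cvgB; [exact: bisummable_pos|exact: bisummable_neg].
Qed.

Lemma bisum_delta a (k : int) N : (absz k < N)%N ->
  bisum (fun m => (m == k)%:R * a m) N = a k.
Proof.
case: k => k /= kN; rewrite /bisum.
  rewrite (bigD1 (Ordinal kN))//= eqxx mul1r !big1 ?addr0// => i.
    by move=> _; rewrite mul0r.
  move=> ni; rewrite (_ : (_ == _) = false) ?mul0r//; apply/eqP => -[ik].
  by move/eqP: ni; apply; apply/val_inj.
have kN' : (k < N)%N by lia.
have kE : Negz k = - k.+1%:Z by [].
rewrite kE [X in _ + X](bigD1 (Ordinal kN'))//= eqxx mul1r !big1 ?addr0 ?add0r// => i.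
  move=> ni; rewrite (_ : (_ == _) = false) ?mul0r//; apply/eqP => ik.
  by move/eqP: ni; apply; apply/val_inj => /=; lia.
by rewrite mul0r.
Qed.

Lemma bilim_delta a (k : int) : bilim (fun m => (m == k)%:R * a m) = a k.
Proof.
apply: bilim_eq; apply: cvg_near_cst; exists (absz k).+1 => // N /= kN.
exact: bisum_delta.
Qed.

Lemma bisummable_delta a (k : int) : bisummable (fun m => (m == k)%:R * a m).
Proof.
exists `|a k| => N.
rewrite (_ : (fun m => _) = (fun m => (m == k)%:R * `|a m|)); last first.
  by apply/funext => m; rewrite normrM ger0_norm.
have : bisum (fun m => (m == k)%:R * `|a m|) N <=
   bisum (fun m => (m == k)%:R * `|a m|) (N + (absz k).+1).
  rewrite /bisum !big_split_ord/=; apply: lerD; rewrite lerDl;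
  by apply: sumr_ge0 => i _; rewrite mulr_ge0.
move/le_trans; apply; rewrite bisum_delta//; lia.
Qed.

Section PairCorrelationSeries.
Variables (p : R) (eta : nat -> R).
Hypothesis hp : 0 <= p <= 1.
Hypothesis eta_bound : forall m, `|eta m| <= 1.
Hypothesis eta_0 : eta 0%N = 2 / 3.
Hypothesis eta_1 : eta 1%N = 1 / 3 + p * (1 - p) / 2 * eta 1%N.
Hypothesis eta_e : forall j, (0 < j)%N ->
  eta (2 * j)%N = 1 / 3 + (p ^+ 2 + (1 - p) ^+ 2) / 2 * eta j.
Hypothesis eta_o : forall j, (0 < j)%N ->
  eta (2 * j).+1 = 1 / 3 + p * (1 - p) / 2 * (eta j + eta j.+1).

Let Eta (j : int) : R := eta (absz j).
Let q := 1 - p.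

(** The recursion in one formula for all integers; the Kronecker symbols carry
the defects at the distances 0 and 1. *)
Lemma int_pair_mean_even (j : int) : Eta (2 * j) =
  1 / 3 + (p ^+ 2 + q ^+ 2) / 2 * Eta j + (j == 0)%:R * (2 * p * q / 3).
Proof.
have [->|j0] := eqVneq j 0.
  by rewrite /Eta mulr0 absz0 eta_0 /q/=; field.
rewrite /Eta mul0r addr0 abszM -eta_e//; lia.
Qed.

Lemma int_pair_mean_odd (j : int) : Eta (2 * j + 1) =
  1 / 3 + p * q / 2 * (Eta j + Eta (j + 1)) -
    ((j == 0)%:R + (j == -1)%:R) * (p * q / 3).
Proof.
have [->|j0] := eqVneq j 0.
  rewrite (_ : (0 == -1 :> int) = false)// /Eta mulr0 add0r absz0 absz1 eta_0 {1}eta_1 /q/=.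
  by field.
have [->|j1] := eqVneq j (-1).
  rewrite /Eta (_ : absz (2 * (-1) + 1 : int) = 1%N)// (_ : absz (-1 + 1 : int) = 0%N)//.
  by rewrite eta_0 {1}eta_1 /q/=; field.
rewrite addr0 mul0r subr0 /Eta.
have [jp|jn] : (0 < j) \/ (j < -1) by lia.
  have -> : absz (2 * j + 1) = (2 * absz j).+1 by lia.
  have -> : absz (j + 1) = (absz j).+1 by lia.
  by rewrite eta_o//; lia.
have -> : absz (2 * j + 1) = (2 * absz (j + 1)).+1 by lia.
have -> : absz j = (absz (j + 1)).+1 by lia.
rewrite eta_o; first by rewrite [eta _ + _]addrC.
lia.
Qed.

(** The pairing of the autocorrelation with a function whose values at the
integers are [c]. *)
Definition pair_series (c : int -> R) : R := bilim (fun m => Eta m * c m).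

(** The adjoint of the recursion, up to the factor 4. By [cos_coef_transfer] it
is the action of [transfer] on Fourier coefficients. *)
Definition coef_subst (c : int -> R) (j : int) : R :=
  2 * ((p ^+ 2 + q ^+ 2) * c (2 * j) + p * q * (c (2 * j + 1) + c (2 * j - 1))).

(** An even index of [c] is used with total weight 2 (p^2 + q^2), an odd one with
total weight 4 p q, and the two weights add up to 2. *)
Lemma coef_subst_summable K c : bisummable_by K c -> bisummable_by (2 * K) (coef_subst c).
Proof.
move=> cK N; have /andP[p0 p1] := hp.
have q0 : 0 <= q by rewrite subr_ge0.
have pq0 : 0 <= p * q by rewrite mulr_ge0.
apply: (@le_trans _ _ (bisum (fun j => 2 * ((p ^+ 2 + q ^+ 2) * `|c (2 * j)| +
   p * q * (`|c (2 * j + 1)| + `|c (2 * j - 1)|))) N)).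
  apply: ler_bisum => j; rewrite /coef_subst normrM ger0_norm// ler_wpM2l//.
  apply: (le_trans (ler_normD _ _)); rewrite !normrM.
  rewrite [`|p ^+ 2 + _|]ger0_norm ?addr_ge0 ?sqr_ge0//.
  rewrite lerD2l -normrM [`|p * q|]ger0_norm// ler_wpM2l//; exact: ler_normD.
rewrite bisumZ bisumD !bisumZ bisumD ler_wpM2l//.
have h1 := bisummable_even cK N; have h2 := bisummable_odd cK N.
have h3 := bisummable_odd_pred cK N.
have -> : K = (p ^+ 2 + q ^+ 2) * K + p * q * (K + K) by rewrite /q; ring.
apply: lerD; first by rewrite ler_wpM2l// addr_ge0// sqr_ge0.
by rewrite ler_wpM2l// lerD.
Qed.

Lemma pair_series_bound K c : bisummable_by K c -> `|pair_series c| <= K.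
Proof.
move=> cK; apply: bilim_norm => N; apply: le_trans (cK N).
by apply: ler_bisum => m; rewrite normrM ler_piMl// /Eta eta_bound.
Qed.

(** Split into even and odd indices and insert the recursion; its constant 1/3
gives the sum of all coefficients and its defects the middle term. *)
Lemma pair_series_step c : bisummable c ->
  pair_series c = 1 / 3 * bilim c +
    2 * p * q / 3 * (c 0 - (c 1 + c (-1)) / 2) + 4^-1 * pair_series (coef_subst c).
Proof.
move=> sc; have [K cK] := sc.
have se : bisummable (fun j => c (2 * j)) by exists K; exact: bisummable_even.
have so : bisummable (fun j => c (2 * j + 1)) by exists K; exact: bisummable_odd.
have so' : bisummable (fun j => c (2 * j - 1)) by exists K; exact: bisummable_odd_pred.
have Eta1 j : `|Eta j| <= 1 by exact: eta_bound.
have Ese := bisummableM Eta1 se; have Eso := bisummableM Eta1 so.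
have Eso' := bisummableM Eta1 so'.
have Esos := bisummable_shift Eso'.
have Esos' : bisummable (fun j => Eta (j + 1) * c (2 * j + 1)).
  rewrite (_ : (fun j => _) = (fun j => Eta (j + 1) * c (2 * (j + 1) - 1)))//.
  by apply/funext => j; congr (_ * c _); ring.
have EE : bilim (fun j => Eta (j + 1) * c (2 * j + 1)) =
    bilim (fun j => Eta j * c (2 * j - 1)).
  rewrite -(bilim_shift Eso'); congr bilim; apply/funext => j.
  by congr (_ * c _); ring.
rewrite /pair_series bilim_evenodd; last exact: bisummableM.
rewrite (bilim_evenodd sc).
have -> : (fun j => Eta (2 * j) * c (2 * j)) =
  (fun j => (1 / 3 * c (2 * j) + (p ^+ 2 + q ^+ 2) / 2 * (Eta j * c (2 * j))) +
     (j == 0)%:R * (2 * p * q / 3 * c (2 * j))).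
  by apply/funext => j; rewrite int_pair_mean_even; ring.
have -> : (fun j => Eta (2 * j + 1) * c (2 * j + 1)) =
  (fun j => (1 / 3 * c (2 * j + 1) + (p * q / 2 * (Eta j * c (2 * j + 1)) +
      p * q / 2 * (Eta (j + 1) * c (2 * j + 1)))) +
     ((j == 0)%:R * (- (p * q / 3) * c (2 * j + 1)) +
      (j == -1)%:R * (- (p * q / 3) * c (2 * j + 1)))).
  by apply/funext => j; rewrite int_pair_mean_odd; ring.
have -> : (fun j => Eta j * coef_subst c j) =
  (fun j => 2 * (p ^+ 2 + q ^+ 2) * (Eta j * c (2 * j)) +
    (2 * p * q * (Eta j * c (2 * j + 1)) + 2 * p * q * (Eta j * c (2 * j - 1)))).
  by apply/funext => j; rewrite /coef_subst; ring.
have D a (k : int) := bisummable_delta a k.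
rewrite !bilimD ?bilimZ ?bilim_delta;
  do ?[exact: D|exact: se|exact: so|exact: Ese|exact: Eso|exact: Eso'
      |exact: Esos'|apply: bisummableZ|apply: bisummableD].
rewrite EE mulr0 add0r (_ : 2 * -1 + 1 = -1 :> int)//.
by field.
Qed.

Lemma iter_coef_subst_summable K c n : bisummable_by K c ->
  bisummable_by (2 ^+ n * K) (iter n coef_subst c).
Proof.
move=> cK; elim: n => [|n IH]; first by rewrite expr0 mul1r.
by rewrite iterS exprS -mulrA; exact: coef_subst_summable.
Qed.

(** Iterating [pair_series_step] leaves a remainder of order 4^-n 2^n. *)
Lemma pair_series_cvg c : bisummable c ->
  \sum_(i < n) 4 ^- i * (1 / 3 * bilim (iter i coef_subst c) +
    2 * p * q / 3 * (iter i coef_subst c 0 -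
      (iter i coef_subst c 1 + iter i coef_subst c (-1)) / 2)) @[n --> \oo]
  --> pair_series c.
Proof.
move=> [K cK].
have it n : pair_series c = \sum_(i < n) 4 ^- i * (1 / 3 * bilim (iter i coef_subst c) +
    2 * p * q / 3 * (iter i coef_subst c 0 -
      (iter i coef_subst c 1 + iter i coef_subst c (-1)) / 2)) +
    4 ^- n * pair_series (iter n coef_subst c).
  elim: n => [|n IH]; first by rewrite big_ord0 add0r expr0 invr1 mul1r.
  rewrite {1}IH big_ord_recr/= -addrA; congr (_ + _).
  rewrite pair_series_step; last by eexists; exact: iter_coef_subst_summable cK.
  by rewrite exprS invfM; ring.
have r0 : 4 ^- n * pair_series (iter n coef_subst c) @[n --> \oo] --> (0 : R).
  apply/norm_cvg0P; apply: (@squeeze_cvgr _ _ _ _ (cst 0) (fun n => 2^-1 ^+ n * K)).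
  - apply: nearW => n; rewrite normr_ge0/= normrM ger0_norm ?invr_ge0 ?exprn_ge0//.
    have h4 : 0 <= 4 ^- n :> R by rewrite invr_ge0 exprn_ge0.
    apply: (le_trans (ler_wpM2l h4 (pair_series_bound (iter_coef_subst_summable n cK)))).
    by rewrite mulrA -exprVn -exprMn (_ : 4^-1 * 2 = 2^-1 :> R)//; field.
  - exact: cvg_cst.
  - rewrite -[X in _ --> X](mul0r K); apply: cvgMl; apply: cvg_expr.
    by rewrite ger0_norm//; lra.
have -> : (fun n => \sum_(i < n) 4 ^- i * (1 / 3 * bilim (iter i coef_subst c) +
    2 * p * q / 3 * (iter i coef_subst c 0 -
      (iter i coef_subst c 1 + iter i coef_subst c (-1)) / 2))) =
   (fun n => pair_series c - 4 ^- n * pair_series (iter n coef_subst c)).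
  by apply/funext => n; rewrite {1}(it n) addrK.
by rewrite -[X in _ --> X]subr0; apply: cvgB => //; exact: cvg_cst.
Qed.

End PairCorrelationSeries.
End BilateralSeries.

(** * Integrals of decaying functions *)

Section DecayingFunctions.
Context {R : realType}.
Implicit Types (f g b : R -> R) (C K : R).
Local Notation mu := (@lebesgue_measure R).

Definition decays f := continuous f /\ exists C, forall x, `|f x| <= C / oneDsqr x.

Lemma decays_const_ge0 f C : (forall x, `|f x| <= C / oneDsqr x) -> 0 <= C.
Proof.
move=> /(_ 0); rewrite /oneDsqr expr0n/= addr0 divr1; exact: le_trans.
Qed.

Lemma oneDsqr_pos (x : R) : 0 < oneDsqr x.
Proof. by rewrite (lt_le_trans _ (oneDsqr_ge1 x)). Qed.

Lemma integrable_oneDsqrV : mu.-integrable setT (fun x => ((oneDsqr x)^-1)%:E).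
Proof.
have c : continuous (fun x : R => (oneDsqr x)^-1) by exact: continuous_oneDsqrV.
apply/integrableP; split.
  by apply/measurable_EFinP; exact: continuous_measurable_fun.
under eq_integral => x _ do rewrite /= ger0_norm ?invr_ge0 ?ltW ?oneDsqr_pos//.
rewrite ge0_symfun_integralT//.
- rewrite -set_itvcy integral0y_oneDsqr -EFinM; exact: ltry.
- by move=> x /=; rewrite /oneDsqr sqrrN.
Qed.

Lemma decays_integrable f : decays f -> mu.-integrable setT (EFin \o f).
Proof.
move=> [cf [C fC]].
apply: (le_integrable measurableT _ _
  (integrableZl measurableT C integrable_oneDsqrV)).
  by apply/measurable_EFinP; exact: continuous_measurable_fun.
by move=> x _; rewrite /= lee_fin (le_trans (fC x))// ler_norm.
Qed.

Lemma decaysD f g : decays f -> decays g -> decays (fun x => f x + g x).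
Proof.
move=> [cf [C fC]] [cg [D gD]]; split.
  by move=> x; apply: cvgD; [exact: cf|exact: cg].
exists (C + D) => x; rewrite mulrDl (le_trans (ler_normD _ _))//; exact: lerD.
Qed.

Lemma decaysM f b K : (forall x, `|b x| <= K) -> continuous b -> decays f ->
  decays (fun x => b x * f x).
Proof.
move=> bK cb [cf [C fC]]; split.
  by move=> x; apply: cvgM; [exact: cb|exact: cf].
exists (K * C) => x; rewrite normrM -mulrA ler_pM//.
Qed.

Lemma decaysZ (k : R) f : decays f -> decays (fun x => k * f x).
Proof. by apply: decaysM => //; exact: cst_continuous. Qed.

Lemma decays_norm f : decays f -> decays (fun x => `|f x|).
Proof.
move=> [cf [C fC]]; split; last by exists C => x; rewrite normr_id.
by move=> x; apply: cvg_norm; exact: cf.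
Qed.

Definition rint f : R := \int[mu]_x f x.

Lemma rintD f g : decays f -> decays g ->
  rint (fun x => f x + g x) = rint f + rint g.
Proof. by move=> df dg; apply: RintegralD => //; exact: decays_integrable. Qed.

Lemma rintZ (k : R) f : decays f -> rint (fun x => k * f x) = k * rint f.
Proof. by move=> df; apply: RintegralZl => //; exact: decays_integrable. Qed.

Lemma ler_rint f g : decays f -> decays g -> (forall x, f x <= g x) ->
  rint f <= rint g.
Proof. by move=> df dg fg; apply: le_Rintegral => //; exact: decays_integrable. Qed.

Lemma ler_norm_rint f : decays f -> `|rint f| <= rint (fun x => `|f x|).
Proof. by move=> df; apply: le_normr_Rintegral => //; exact: decays_integrable. Qed.

Lemma decays_affine (a c : R) f : 0 < a -> decays f -> decays (fun x => f (a * x + c)).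
Proof.
move=> a0 [cf [C fC]]; split.
  move=> x; apply: (@continuous_comp _ _ _ (fun x => a * x + c) f); last exact: cf.
  apply: cvgD; last exact: cvg_cst.
  by apply: cvgM; [exact: cvg_cst|exact: cvg_id].
have C0 := decays_const_ge0 fC.
pose K := 1 + (2 * c ^+ 2 + 2) / a ^+ 2.
have a2 : 0 < a ^+ 2 by rewrite exprn_gt0.
exists (C * K) => x; rewrite (le_trans (fC _))// -mulrA ler_wpM2l//.
rewrite ler_pdivlMr ?oneDsqr_pos// mulrC ler_pdivrMr ?oneDsqr_pos//.
rewrite /oneDsqr; set y := a * x + c.
have xE : x ^+ 2 = (y - c) ^+ 2 / a ^+ 2 by rewrite /y; field; rewrite gt_eqF.
have h : (y - c) ^+ 2 <= 2 * y ^+ 2 + 2 * c ^+ 2.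
  by rewrite -subr_ge0 (_ : _ - _ = (y + c) ^+ 2) ?sqr_ge0//; ring.
have h2 : x ^+ 2 <= (2 * y ^+ 2 + 2 * c ^+ 2) / a ^+ 2.
  by rewrite xE ler_wpM2r ?invr_ge0// ltW.
apply: (@le_trans _ _ (1 + (2 * y ^+ 2 + 2 * c ^+ 2) / a ^+ 2)); first by rewrite lerD2l.
have y2 := sqr_ge0 y; have c2 := sqr_ge0 c.
rewrite -subr_ge0 (_ : _ - _ = y ^+ 2 + (2 * c ^+ 2 * y ^+ 2 + 2) / a ^+ 2).
  apply: addr_ge0 => //; apply: divr_ge0; last exact: ltW.
  by apply: addr_ge0 => //; apply: mulr_ge0 => //; exact: mulr_ge0.
by rewrite /K; field; rewrite gt_eqF.
Qed.

(** Nonnegative functions suffice for the substitution rule, since f is the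
difference of f + |f| and |f|; see [rint_affine]. *)
Lemma ge0_integral_affine (a c : R) f : 0 < a -> continuous f -> (forall x, 0 <= f x) ->
  (\int[mu]_x (f x)%:E = a%:E * \int[mu]_x (f (a * x + c))%:E)%E.
Proof.
move=> a0 cf f0; pose F x := a * x + c.
have dF (x : R) : is_derive x (1 : R) F a.
  rewrite /F; apply: is_derive_eq; rewrite ?scaler0.
  by rewrite ?addr0 -[_ *: _]/(_ * _) mulr1.
have cfF : continuous (fun x => f (a * x + c)).
  move=> x; apply: (@continuous_comp _ _ _ F f); last exact: cf.
  apply: cvgD; last exact: cvg_cst.
  by apply: cvgM; [exact: cvg_cst|exact: cvg_id].
have F' : derive1 F = cst a by apply/funext => x; rewrite derive1E; exact: derive_val.
rewrite (@increasing_ge0_integration_by_substitutionT _ F f); rewrite ?F'.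
- rewrite -ge0_integralZl//=.
  + by apply: eq_integral => x _; rewrite /= -EFinM mulrC.
  + by apply/measurable_EFinP; exact: continuous_measurable_fun.
  + by move=> x _; rewrite lee_fin.
  + by rewrite lee_fin ltW.
- by move=> x y xy; rewrite /F ltrD2r ltr_pM2l.
- exact: cst_continuous.
- exact: is_cvg_cst.
- exact: is_cvg_cst.
- by move=> x; have [] := dF x.
- apply/cvgrNyPle => A; exists ((A - c) / a); split; first exact: num_real.
  by move=> x; rewrite ltr_pdivlMr// /F mulrC ltrBrDr => /ltW.
- apply/cvgryPge => A; exists ((A - c) / a); split; first exact: num_real.
  by move=> x; rewrite ltr_pdivrMr// /F mulrC ltrBlDr => /ltW.
- exact: cf.
- exact: f0.
Qed.

Lemma rint_affine (a c : R) f : 0 < a -> decays f ->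
  rint f = a * rint (fun x => f (a * x + c)).
Proof.
move=> a0 df.
have pos g : decays g -> (forall x, 0 <= g x) ->
    rint g = a * rint (fun x => g (a * x + c)).
  move=> dg g0; rewrite /rint /Rintegral (ge0_integral_affine c a0 dg.1 g0).
  rewrite fineM//; apply: integrable_fin_num => //.
  exact: (decays_integrable (decays_affine c a0 dg)).
have dn := decays_norm df.
have h : decays (fun x => f x + `|f x|) by exact: decaysD.
have := pos _ h; have := pos _ dn (fun x => normr_ge0 _).
rewrite rintD// => ->.
rewrite (rintD (decays_affine c a0 df) (decays_affine c a0 dn)) mulrDr.
have f0 x : 0 <= f x + `|f x| by have := ler_norm (- f x); rewrite normrN => ?; lra.
by move=> /(_ f0)/addIr.
Qed.

Lemma decays_shift (c : R) f : decays f -> decays (fun x => f (x + c)).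
Proof. by move=> /(decays_affine c ltr01); under eq_fun do rewrite mul1r. Qed.

Lemma rint_shift (c : R) f : decays f -> rint (fun x => f (x + c)) = rint f.
Proof.
move=> df; rewrite (rint_affine c ltr01 df) mul1r.
by under [in RHS]eq_fun do rewrite mul1r.
Qed.

Lemma cos_lip (x y : R) : `|cos x - cos y| <= `|x - y|.
Proof.
wlog xy : x y / x <= y.
  by move=> H; case: (leP x y) => [|/ltW] /H//; rewrite distrC [X in _ <= X]distrC.
have [c _ E] := @MVT_segment R cos (fun x => - sin x) x y xy
  (fun z _ => is_derive_cos z) (continuous_subspaceT (@continuous_cos R)).
rewrite distrC E distrC normrM ler_piMl// normrN.
by rewrite ler_norml sin_geN1 sin_le1.
Qed.

Lemma sin_lip (x y : R) : `|sin x - sin y| <= `|x - y|.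
Proof.
wlog xy : x y / x <= y.
  by move=> H; case: (leP x y) => [|/ltW] /H//; rewrite distrC [X in _ <= X]distrC.
have [c _ E] := @MVT_segment R sin cos x y xy
  (fun z _ => is_derive_sin z) (continuous_subspaceT (@continuous_sin R)).
rewrite distrC E distrC normrM ler_piMl//.
by rewrite ler_norml cos_geN1 cos_le1.
Qed.

Lemma norm_cos_le1 (x : R) : `|cos x| <= 1.
Proof. by rewrite ler_norml cos_geN1 cos_le1. Qed.

Lemma norm_sin_le1 (x : R) : `|sin x| <= 1.
Proof. by rewrite ler_norml sin_geN1 sin_le1. Qed.

Lemma lipschitz_continuous g (K : R) : (forall x y, `|g x - g y| <= K * `|x - y|) ->
  continuous g.
Proof.
move=> gK x; apply/cvgrPdist_le => e e0.
have K1 : 0 < `|K| + 1 by rewrite ltr_wpDl.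
near=> y; apply: (le_trans (gK x y)).
apply: (@le_trans _ _ ((`|K| + 1) * `|x - y|)).
  by rewrite ler_wpM2r// (le_trans (ler_norm K))// lerDl.
rewrite mulrC -ler_pdivlMr//.
near: y; apply: cvgr_dist_le; first exact: cvg_id.
by rewrite divr_gt0.
Unshelve. all: by end_near.
Qed.

Lemma continuous_lin (g : R -> R) (k : R) : continuous g -> continuous (fun x => g (k * x)).
Proof.
move=> cg x; apply: (@continuous_comp _ _ _ (fun x => k * x) g); last exact: cg.
by apply: cvgM; [exact: cvg_cst|exact: cvg_id].
Qed.

Definition cos_coef f (k : R) : R := rint (fun x => cos (2 * pi * k * x) * f x).
Definition sin_coef f (k : R) : R := rint (fun x => sin (2 * pi * k * x) * f x).

Lemma decays_cos f (k : R) : decays f -> decays (fun x => cos (k * x) * f x).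
Proof.
apply: (@decaysM _ _ 1) => [x|]; first exact: norm_cos_le1.
by apply: continuous_lin; exact: continuous_cos.
Qed.

Lemma decays_sin f (k : R) : decays f -> decays (fun x => sin (k * x) * f x).
Proof.
apply: (@decaysM _ _ 1) => [x|]; first exact: norm_sin_le1.
by apply: continuous_lin; exact: continuous_sin.
Qed.

(** Translating by h = 1 / (2m) changes the sign of the oscillating factor, so
four times the integral is the integral against a second difference of [f],
which is of order h^2. *)
Lemma osc_bound (u : R -> R) f C (m : nat) : (0 < m)%N ->
  continuous u -> (forall x, `|u x| <= 1) -> (forall x, u (x + pi) = - u x) ->
  decays f ->
  (forall x h, 0 <= h <= 1 ->
    `|2 * f x - f (x + h) - f (x - h)| <= C * h ^+ 2 / oneDsqr x) ->
  `|rint (fun x => u (2 * pi * m%:R * x) * f x)| <=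
    C / 16 * rint (fun x => (oneDsqr x)^-1) / m%:R ^+ 2.
Proof.
move=> m0 cu u1 upi df D2.
have mR : 0 < m%:R :> R by rewrite ltr0n.
(* Half a period of the oscillating factor. *)
pose h : R := (2 * m%:R)^-1.
have h01 : 0 <= h <= 1.
  rewrite /h invr_ge0 mulr_ge0//= invf_le1 ?mulr_gt0//.
  by rewrite -natrM ler1n muln_gt0.
pose U x := u (2 * pi * m%:R * x).
have U1 x : `|U x| <= 1 by exact: u1.
have cU : continuous U by apply: continuous_lin.
have Uh x : U (x + h) = - U x.
  rewrite /U -upi; congr u; rewrite mulrDr /h; congr (_ + _); field.
  by rewrite gt_eqF.
have Uh' x : U (x - h) = - U x by rewrite -[X in - U X](subrK h x) Uh opprK.
have dU g : decays g -> decays (fun x => U x * g x) by exact: decaysM.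
set I := rint _.
have IE : I = rint (fun x => U x * f x) by [].
have half (c : R) : (forall x, U (x + c) = - U x) ->
    rint (fun x => U x * f (x + c)) = - I.
  move=> Uc; rewrite IE -(rint_shift c (dU _ df)) -mulN1r -rintZ.
    by congr rint; apply/funext => x; rewrite Uc mulN1r mulNr opprK.
  exact: (decays_shift c (dU _ df)).
have I4 : 4 * I = rint (fun x => U x * (2 * f x - f (x + h) - f (x - h))).
  have -> : (fun x => U x * (2 * f x - f (x + h) - f (x - h))) =
      (fun x => 2 * (U x * f x) + (-1 * (U x * f (x + h)) + -1 * (U x * f (x - h)))).
    by apply/funext => x; ring.
  have d1 := dU _ (decays_shift h df); have d2 := dU _ (decays_shift (- h) df).
  rewrite rintD; [|exact/decaysZ/dU|by apply: decaysD; exact: decaysZ].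
  rewrite rintD; [|exact: decaysZ|exact: decaysZ].
  rewrite rintZ; last exact: dU.
  by rewrite !rintZ// half// half// -IE; ring.
have dO : decays (fun x => (oneDsqr x)^-1).
  split; first exact: continuous_oneDsqrV.
  by exists 1 => x; rewrite mul1r ger0_norm// invr_ge0 ltW// oneDsqr_pos.
have dD : decays (fun x => U x * (2 * f x - f (x + h) - f (x - h))).
  apply: dU; have -> : (fun x => 2 * f x - f (x + h) - f (x - h)) =
    (fun x => 2 * f x + (-1 * f (x + h) + -1 * f (x - h))).
    by apply/funext => x; ring.
  by apply: decaysD; [exact: decaysZ|apply: decaysD; apply: decaysZ;
    exact: decays_shift].
have : `|4 * I| <= C * h ^+ 2 * rint (fun x => (oneDsqr x)^-1).
  rewrite I4 (le_trans (ler_norm_rint dD))// -rintZ//.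
  apply: ler_rint => [||x]; [exact: decays_norm|exact: decaysZ|].
  by rewrite normrM (le_trans (ler_piMl _ (U1 x)))// D2.
rewrite normrM ger0_norm// => H.
rewrite -(ler_pM2l (_ : 0 < 4 :> R))// (le_trans H)//.
by rewrite /h le_eqVlt; apply/orP; left; apply/eqP; field; rewrite gt_eqF.
Qed.

End DecayingFunctions.

(** * The Fejer kernel *)

Section Poisson.
Context {R : realType}.
Implicit Types (f g b : R -> R) (C K : R).
Local Notation mu := (@lebesgue_measure R).

(** The class of test functions for the Poisson formula. It contains the
Schwartz functions and is stable under [transfer] by elementary estimates. *)
Definition lip_decay f := exists2 C, (forall x, `|f x| <= C / oneDsqr x) &
  forall x h, `|h| <= 1 -> `|f (x + h) - f x| <= C * `|h| / oneDsqr x.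

Lemma oneDsqrV_le1n (x : R) : (oneDsqr x)^-1 <= 1.
Proof. by rewrite invf_le1 ?oneDsqr_pos// oneDsqr_ge1. Qed.

Lemma lip_decay_decays f : lip_decay f -> decays f.
Proof.
move=> [C fC fL]; split; last by exists C.
have C0 := decays_const_ge0 fC.
have C1 : 0 < C + 1 by rewrite ltr_wpDl.
move=> x; apply/cvgrPdist_le => e e0; near=> y.
have xy : `|x - y| <= Num.min 1 (e / (C + 1)).
  near: y; apply: cvgr_dist_le; first exact: cvg_id.
  by rewrite lt_min ltr01 divr_gt0.
move: xy; rewrite le_min => /andP[xy1 xy2].
have := fL x (y - x); rewrite addrCA subrr addr0 [`|y - x|]distrC => /(_ xy1).
move=> H; rewrite distrC; apply: (le_trans H).
apply: (@le_trans _ _ (C * `|x - y|)).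
  by rewrite ler_piMr ?oneDsqrV_le1n// mulr_ge0.
rewrite ler_pdivlMr// in xy2; apply: le_trans xy2.
by rewrite mulrC ler_wpM2l// lerDl.
Unshelve. all: by end_near.
Qed.

Lemma lip_decay_mul f b K : (forall x, `|b x| <= 1) ->
  (forall x y, `|b x - b y| <= K * `|x - y|) -> lip_decay f -> lip_decay (fun x => b x * f x).
Proof.
move=> b1 bK [C fC fL]; have C0 := decays_const_ge0 fC.
have K0 : 0 <= K.
  by have := bK 1 0; rewrite subr0 normr1 mulr1; exact: le_trans.
have hC x : 0 <= C / oneDsqr x by rewrite divr_ge0// ltW// oneDsqr_pos.
exists (C + K * C) => [x|x h h1].
  rewrite normrM (le_trans (ler_piMl _ (b1 x)))// (le_trans (fC x))//.
  apply: ler_wpM2r; first by rewrite invr_ge0 ltW// oneDsqr_pos.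
  by rewrite lerDl mulr_ge0.
have -> : b (x + h) * f (x + h) - b x * f x =
   b (x + h) * (f (x + h) - f x) + (b (x + h) - b x) * f x by ring.
rewrite (le_trans (ler_normD _ _))// !normrM.
have -> : (C + K * C) * `|h| / oneDsqr x =
  C * `|h| / oneDsqr x + (K * `|h|) * (C / oneDsqr x) by ring.
apply: lerD; first by rewrite (le_trans (ler_piMl _ (b1 _)))// fL.
apply: ler_pM => //; apply: le_trans (bK _ _) _.
by rewrite addrC addKr.
Qed.

Lemma oneDsqr_half (x : R) : (oneDsqr (x / 2))^-1 <= 4 / oneDsqr x.
Proof.
rewrite ler_pdivlMr ?oneDsqr_pos// mulrC ler_pdivrMr ?oneDsqr_pos//.
rewrite /oneDsqr; have := sqr_ge0 x; have -> : (x / 2) ^+ 2 = x ^+ 2 / 4 by field.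
by move=> *; lra.
Qed.

Lemma lip_decay_half f : lip_decay f -> lip_decay (fun x => f (x / 2)).
Proof.
move=> [C fC fL]; have C0 := decays_const_ge0 fC.
exists (C * 4) => [x|x h h1].
  rewrite (le_trans (fC _))// -mulrA ler_wpM2l//; exact: oneDsqr_half.
rewrite mulrDl (le_trans (fL _ _ _))//.
  by rewrite normrM [`|2^-1|]ger0_norm//; move: h1; lra.
rewrite normrM [`|2^-1|]ger0_norm//.
have -> : C * 4 * `|h| / oneDsqr x = C * `|h| * (4 / oneDsqr x) by ring.
apply: ler_pM; [|by rewrite invr_ge0 ltW// oneDsqr_pos| |exact: oneDsqr_half].
  by rewrite mulr_ge0// mulr_ge0.
by rewrite ler_wpM2l//; have := normr_ge0 h; lra.
Qed.

Lemma cos_int (x : R) (k m : int) :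
  cos (2 * pi * m%:~R * (x + k%:~R)) = cos (2 * pi * m%:~R * x).
Proof.
have P (y : R) (n : nat) : cos (y + (pi *+ 2) *+ n) = cos y.
  exact: (periodicn (@cosD2pi R)).
have Q (y : R) (n : int) : cos (y + 2 * pi * n%:~R) = cos y.
  case: n => n.
    by rewrite -[RHS](P y n); congr cos; rewrite -pmulrn -mulr_natr; ring.
  rewrite -[LHS](P _ n.+1); congr cos.
  by rewrite NegzE intrN -pmulrn -mulr_natr; ring.
by rewrite -[RHS](Q _ (m * k)); congr cos; rewrite intrM; ring.
Qed.

Lemma sin_pi_int (k : int) : sin (pi * k%:~R) = 0 :> R.
Proof.
have P (n : nat) : sin (pi * n%:R) = 0 :> R.
  elim: n => [|n IH]; first by rewrite mulr0 sin0.
  by rewrite -natr1 mulrDr mulr1 sinDpi IH oppr0.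
case: k => n; first exact: P.
by rewrite NegzE intrN mulrN sinN -pmulrn P oppr0.
Qed.

Lemma sin_sqr_int (x : R) (k : int) : sin (pi * (x + k%:~R)) ^+ 2 = sin (pi * x) ^+ 2.
Proof.
rewrite mulrDr sinD sin_pi_int mulr0 addr0 exprMn.
have := cos2Dsin2 (pi * k%:~R : R); rewrite sin_pi_int expr0n addr0 => ->.
by rewrite mulr1.
Qed.

(** With t = pi y / 2 one has sin(pi y) = 2 sin t cos t, and sin t >= t cos t
while cos^2 t >= 1/2 on the range considered. *)
Lemma sin_pi_ge (y : R) : 0 <= y <= 2^-1 -> y <= sin (pi * y).
Proof.
move=> /andP[y0 y1]; pose t := pi * y / 2.
have pi0 := pi_gt0 R; have pi2 := pi_ge2 R.
have t0 : 0 <= t by rewrite /t divr_ge0// mulr_ge0// ltW.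
have t1 : t <= pi / 4.
  by have := ler_wpM2l (ltW pi0) y1; rewrite /t; lra.
have ct0 : 0 <= cos t by apply: cos_ge0_pihalf; apply/andP; split; lra.
have st : t * cos t <= sin t.
  have [c /andP[c0 c1] E] := @MVT_segment R sin cos 0 t t0
    (fun z _ => is_derive_sin z) (continuous_subspaceT (@continuous_sin R)).
  rewrite sin0 !subr0 in E; rewrite E mulrC ler_wpM2r//.
  move: c0 c1; rewrite !bnd_simp => c0 c1.
  have [->//|ct] := eqVneq c t.
  by rewrite ltW// ltr_cos ?in_itv/= ?lt_neqAle ?ct//; apply/andP; split; lra.
have -> : pi * y = t *+ 2 by rewrite (mulr2n t) /t; lra.
rewrite sin_mulr2n.
have c2 : 2^-1 <= cos t ^+ 2.
  have := cos_mulr2n t; have : 0 <= cos (t *+ 2).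
    by apply: cos_ge0_pihalf; rewrite (mulr2n t); apply/andP; split; lra.
  by move=> h1 h2; move: h1; rewrite h2 (mulr2n (cos t ^+ 2)); lra.
have h : t * cos t ^+ 2 <= cos t * sin t.
  by rewrite expr2 mulrA mulrC ler_wpM2l.
have h2 : t / 2 <= t * cos t ^+ 2 by rewrite ler_wpM2l.
have h3 : y <= t by rewrite /t; nra.
by rewrite (mulr2n (cos t * sin t)); lra.
Qed.

Lemma sin_pi_sqr_ge (x : R) (k : int) : `|x - k%:~R| <= 2^-1 ->
  (x - k%:~R) ^+ 2 <= sin (pi * x) ^+ 2.
Proof.
move=> xk; rewrite -[in X in _ <= X](subrK k%:~R x) sin_sqr_int.
move: xk; move: (x - k%:~R) => y y1.
rewrite -(real_normK (num_real y)).
have -> : sin (pi * y) ^+ 2 = sin (pi * `|y|) ^+ 2.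
  by have [y0|y0] := ger0P y => //; rewrite mulrN sinN sqrrN.
rewrite ler_sqr ?nnegrE//; first by apply: sin_pi_ge; rewrite normr_ge0.
by rewrite (le_trans (normr_ge0 y))// sin_pi_ge// normr_ge0.
Qed.

(** The squared modulus of the sum of e^(2 pi i j x) over j < N, that is, N
times the Fejer kernel. *)
Definition fejer (N : nat) (x : R) : R :=
  (\sum_(j < N) cos (2 * pi * j%:R * x)) ^+ 2 +
  (\sum_(j < N) sin (2 * pi * j%:R * x)) ^+ 2.

Lemma fejer_ge0 N x : 0 <= fejer N x.
Proof. by rewrite addr_ge0// sqr_ge0. Qed.

Lemma fejerE N x : fejer N x =
  \sum_(i < N) \sum_(j < N) cos (2 * pi * (i%:Z - j%:Z)%:~R * x).
Proof.
rewrite /fejer !expr2 !mulr_suml -big_split/=; apply: eq_bigr => i _.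
rewrite !mulr_sumr -big_split/=; apply: eq_bigr => j _.
by rewrite -cosB; congr cos; rewrite intrB -!pmulrn; ring.
Qed.

(** Multiplying by sin(pi x) telescopes the geometric sum. *)
Lemma fejer_sin N x : sin (pi * x) ^+ 2 * fejer N x <= 1.
Proof.
set t := pi * x.
have tE j : 2 * pi * j%:R * x = t * (2 * j%:R) by rewrite /t; ring.
have C : 2 * sin t * \sum_(j < N) cos (2 * pi * j%:R * x) =
    sin (t * (2 * N%:R - 1)) + sin t.
  elim: N => [|N IH].
    by rewrite big_ord0 mulr0 mulr0 sub0r mulrN mulr1 sinN addrC subrr.
  rewrite big_ord_recr/= mulrDr IH tE -(natr1 N).
  have -> : t * (2 * (N%:R + 1) - 1) = t * (2 * N%:R) + t by ring.
  have -> : t * (2 * N%:R - 1) = t * (2 * N%:R) - t by ring.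
  by rewrite sinB sinD; ring.
have S : 2 * sin t * \sum_(j < N) sin (2 * pi * j%:R * x) =
    cos t - cos (t * (2 * N%:R - 1)).
  elim: N {C} => [|N IH].
    by rewrite big_ord0 mulr0 mulr0 sub0r mulrN mulr1 cosN subrr.
  rewrite big_ord_recr/= mulrDr IH tE -(natr1 N).
  have -> : t * (2 * (N%:R + 1) - 1) = t * (2 * N%:R) + t by ring.
  have -> : t * (2 * N%:R - 1) = t * (2 * N%:R) - t by ring.
  by rewrite cosB cosD; ring.
have : 4 * (sin t ^+ 2 * fejer N x) =
   (2 * sin t * \sum_(j < N) cos (2 * pi * j%:R * x)) ^+ 2 +
   (2 * sin t * \sum_(j < N) sin (2 * pi * j%:R * x)) ^+ 2.
  by rewrite /fejer; ring.
rewrite C S; set a := t * _.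
have h1 := cos2Dsin2 a; have h2 := cos2Dsin2 t.
have h3 : cos (a + t) = cos a * cos t - sin a * sin t by exact: cosD.
have h4 := cos_geN1 (a + t).
have -> : (sin a + sin t) ^+ 2 + (cos t - cos a) ^+ 2 =
  (cos a ^+ 2 + sin a ^+ 2) + (cos t ^+ 2 + sin t ^+ 2) - 2 * (cos a * cos t - sin a * sin t).
  by ring.
by rewrite h1 h2 -h3 => h5; lra.
Qed.

Lemma continuous_cosM (k : R) : continuous (fun x : R => cos (k * x)).
Proof. by apply: continuous_lin; exact: continuous_cos. Qed.

Lemma continuous_sum (I : Type) (r : seq I) (F : I -> R -> R) :
  (forall i, continuous (F i)) -> continuous (fun x => \sum_(i <- r) F i x).
Proof.
move=> cF x; apply: cvg_big => [|i _]; first exact: add_continuous.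
exact: cF.
Qed.

Lemma continuous_fejer N : continuous (fejer N).
Proof.
have -> : fejer N = (fun x => \sum_(i < N) \sum_(j < N)
    cos (2 * pi * (i%:Z - j%:Z)%:~R * x)) by apply/funext => x; exact: fejerE.
by apply: continuous_sum => i; apply: continuous_sum => j; exact: continuous_cosM.
Qed.

(** Half-open intervals, so that integrals over consecutive intervals add
up. *)
Definition lint (a c : R) h : R := \int[mu]_(x in `]a, c]) h x.

Lemma lint_integrable a c h : continuous h -> mu.-integrable `]a, c] (EFin \o h).
Proof.
move=> ch; apply: (@integrableS _ _ _ mu `[a, c]) => //.
  by move=> x /=; rewrite !in_itv/= => /andP[/ltW -> ->].
apply: continuous_compact_integrable; first exact: segment_compact.
exact: continuous_subspaceT.
Qed.

Lemma lintD a c h h' : continuous h -> continuous h' ->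
  lint a c (fun x => h x + h' x) = lint a c h + lint a c h'.
Proof. by move=> ch ch'; apply: RintegralD => //; exact: lint_integrable. Qed.

Lemma lintZ a c (k : R) h : continuous h ->
  lint a c (fun x => k * h x) = k * lint a c h.
Proof. by move=> ch; apply: RintegralZl => //; exact: lint_integrable. Qed.

Lemma ler_lint a c h h' : continuous h -> continuous h' ->
  (forall x, a < x <= c -> h x <= h' x) -> lint a c h <= lint a c h'.
Proof.
move=> ch ch' hh'; apply: le_Rintegral => //; try exact: lint_integrable.
Qed.

Lemma ler_norm_lint a c h : continuous h ->
  `|lint a c h| <= lint a c (fun x => `|h x|).
Proof. by move=> ch; apply: le_normr_Rintegral => //; exact: lint_integrable. Qed.

Lemma lint_cst a c (k : R) : a <= c -> lint a c (fun=> k) = k * (c - a).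
Proof.
move=> ac; rewrite /lint Rintegral_cst//.
have l : @lebesgue_measure R `]a, c]%classic = (c - a)%:E; last first.
  by congr (k * _); transitivity (fine (c - a)%:E); [congr fine; exact: l|].
rewrite lebesgue_measure_itv/= lte_fin.
by move: ac; rewrite le_eqVlt => /predU1P[->|ac]; [rewrite ltxx subrr|rewrite ac].
Qed.

Lemma lint_sum a c (I : Type) (r : seq I) (F : I -> R -> R) :
  (forall i, continuous (F i)) ->
  lint a c (fun x => \sum_(i <- r) F i x) = \sum_(i <- r) lint a c (F i).
Proof.
move=> cF; elim: r => [|i r IH].
  rewrite big_nil /lint; under eq_Rintegral do rewrite big_nil.
  by rewrite /Rintegral integral0.
rewrite big_cons -IH -lintD//; last exact: continuous_sum.
by congr lint; apply/funext => x; rewrite big_cons.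
Qed.

Lemma lint_cat a c d h : continuous h -> a <= c -> c <= d ->
  lint a d h = lint a c h + lint c d h.
Proof.
move=> ch ac cd; rewrite /lint -(@Rintegral_itvB _ h (BRight a) (BRight d) c)//.
- by rewrite addrC subrK.
- exact: lint_integrable.
Qed.

Lemma lint_cos (k m : int) :
  lint (k%:~R - 2^-1) (k%:~R + 2^-1) (fun x => cos (2 * pi * m%:~R * x)) = (m == 0)%:R.
Proof.
have ab : k%:~R - 2^-1 < k%:~R + 2^-1 :> R by lra.
have [->|m0] := eqVneq m 0.
  under [X in lint _ _ X]eq_fun do rewrite mulr0 mul0r cos0.
  rewrite lint_cst ?ltW//=; lra.
set w : R := 2 * pi * m%:~R.
have w0 : w != 0.
  by rewrite mulf_neq0// ?intr_eq0// mulf_neq0// gt_eqF// pi_gt0.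
pose G (x : R) := sin (w * x) / w.
have dG (x : R) : is_derive x (1 : R) G (cos (w * x)).
  have h : is_derive x (1:R) (fun x : R => w * x) w.
    by apply: is_derive_eq; rewrite ?scaler0 ?addr0 -[_ *: _]/(_ * _) mulr1.
  have h2 := @is_derive1_comp _ sin (fun x : R => w * x) x _ _ (is_derive_sin _) h.
  rewrite /G; apply: is_derive_eq.
  by rewrite /= scaler0 add0r -[_ *: _]/(_ * _); field.
have cG : continuous G.
  move=> x; apply: differentiable_continuous; apply/derivable1_diffP.
  by have [] := dG x.
rewrite /lint Rintegral_itv_obnd_cbnd; last exact/lint_integrable/continuous_cosM.
rewrite /Rintegral (@continuous_FTC2 _ _ G)//.
- rewrite /G /w -EFinB/= -mulrBl.
  have s (e : int) : sin (2 * pi * m%:~R * (k%:~R + e%:~R / 2)) = 0 :> R.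
    rewrite -(sin_pi_int (m * (2 * k + e))); congr sin.
    by rewrite intrM intrD intrM; field.
  have := s 1; rewrite mul1r => ->.
  by have := s (-1); rewrite intrN mulN1r => ->; rewrite subrr mul0r.
- exact/continuous_subspaceT/continuous_cosM.
- split; first by move=> x _; have [] := dG x.
  + by apply: cvg_at_right_filter; exact: cG.
  + by apply: cvg_at_left_filter; exact: cG.
- by move=> x _; rewrite derive1E; exact: derive_val.
Qed.

Lemma lint_fejer (k : int) N :
  lint (k%:~R - 2^-1) (k%:~R + 2^-1) (fejer N) = N%:R.
Proof.
have -> : fejer N = (fun x => \sum_(i < N) \sum_(j < N)
    cos (2 * pi * (i%:Z - j%:Z)%:~R * x)) by apply/funext => x; exact: fejerE.
rewrite lint_sum => [|i]; last by apply: continuous_sum => j; exact: continuous_cosM.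
rewrite (eq_bigr (fun=> 1)); first by rewrite sumr_const card_ord.
move=> i _; rewrite lint_sum => [|j]; last exact: continuous_cosM.
under eq_bigr do rewrite lint_cos.
rewrite (bigD1 i)//= subrr eqxx big1 ?addr0// => j ji.
rewrite (_ : (_ == 0) = false)//; apply/eqP => h.
by move/eqP: ji; apply; apply/val_inj => /=; lia.
Qed.

Lemma bisum_lint h N : continuous h ->
  bisum (fun k => lint (k%:~R - 2^-1) (k%:~R + 2^-1) h) N =
  lint (- N%:R - 2^-1) (N%:R - 2^-1) h.
Proof.
move=> ch; rewrite /bisum; elim: N => [|N IH].
  rewrite !big_ord0 addr0 oppr0 /lint set_itvoc0//.
  by rewrite ?Rintegral_set0//.
rewrite !big_ord_recr/= addrACA IH.
have -> : lint (- N.+1%:R - 2^-1) (N.+1%:R - 2^-1) h =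
  lint (- N.+1%:R - 2^-1) (- N%:R - 2^-1) h +
  (lint (- N%:R - 2^-1) (N%:R - 2^-1) h + lint (N%:R - 2^-1) (N.+1%:R - 2^-1) h).
  have n0 := ler0n R N; have NE : N.+1%:R = N%:R + 1 :> R by rewrite -natr1.
  have h1 : - N.+1%:R - 2^-1 <= - N%:R - 2^-1 :> R by rewrite NE; lra.
  have h2 : - N%:R - 2^-1 <= N%:R - 2^-1 :> R by lra.
  have h3 : N%:R - 2^-1 <= N.+1%:R - 2^-1 :> R by rewrite NE; lra.
  by rewrite (lint_cat ch h1 (le_trans h2 h3)) (lint_cat ch h2 h3).
have -> : lint ((- N.+1%:Z)%:~R - 2^-1) ((- N.+1%:Z)%:~R + 2^-1) h =
    lint (- N.+1%:R - 2^-1) (- N%:R - 2^-1) h.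
  by congr lint; rewrite intrN -pmulrn -(natr1 N); lra.
have -> : lint (N%:~R - 2^-1) (N%:~R + 2^-1) h = lint (N%:R - 2^-1) (N.+1%:R - 2^-1) h.
  by congr lint; rewrite -pmulrn -(natr1 N); lra.
by rewrite addrA addrC.
Qed.

Lemma lint_cvg h : decays h ->
  lint (- N%:R - 2^-1) (N%:R - 2^-1) h @[N --> \oo] --> rint h.
Proof.
move=> dh; pose D (N : nat) : set R := `](- N%:R - 2^-1), (N%:R - 2^-1)]%classic.
have ih := decays_integrable dh.
have mh : measurable_fun setT (EFin \o h) by apply: measurable_int ih.
have mh' : measurable_fun setT h by apply/measurable_EFinP.
have mf N : measurable_fun setT (fun x => ((h \_ (D N)) x)%:E).
  apply/measurable_EFinP/(measurable_restrictT _ _).1 => //.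
    exact: measurable_itv.
  exact: measurable_funS mh'.
have cv : {ae mu, forall x : R, setT x ->
    ((h \_ (D N)) x)%:E @[N --> \oo] --> (EFin \o h) x}.
  apply: aeW => x _; apply: cvg_near_cst; near=> N.
  congr EFin; rewrite patchE mem_set// /D /= in_itv/=.
  have xN : `|x| + 1 <= N%:R.
    near: N; exact: nbhs_infty_ger.
  have := ler_norm x; have := ler_norm (- x); rewrite normrN => h1 h2.
  by apply/andP; split; lra.
have bd : {ae mu, forall (x : R) N, setT x ->
    (`|((h \_ (D N)) x)%:E| <= `|(EFin \o h) x|)%E}.
  apply: aeW => x N _; rewrite /= lee_fin patchE.
  by case: ifP => // _; rewrite normr0.
have [_ _ H] := @dominated_convergence _ _ _ mu setT measurableT
  _ _ _ mf mh cv (integrable_abse ih) bd.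
have : fine (\int[mu]_x ((h \_ (D N)) x)%:E) @[N --> \oo] --> rint h.
  apply: fine_cvg; rewrite fineK//.
  exact: integrable_fin_num.
apply: cvg_trans; apply: near_eq_cvg; near=> N.
rewrite /lint [RHS]/Rintegral integral_mkcond /=; congr fine.
by apply: eq_integral => x _; rewrite /= restrict_EFin.
Unshelve. all: by end_near.
Qed.

End Poisson.

(** * Poisson summation *)

Section PoissonSummation.
Context {R : realType}.
Implicit Types (f g b : R -> R) (C K : R).
Local Notation mu := (@lebesgue_measure R).

(** Comparison with the telescoping series of 3 / ((i+1)(i+2)); the inequality
between the terms is (2i - 1)(i - 1) >= 0. *)
Lemma sum_oneDsqrV N : \sum_(i < N) (oneDsqr (i%:R : R))^-1 <= 3.
Proof.
have bnd (i : nat) : (oneDsqr (i%:R : R))^-1 <= 3 * (i.+1%:R^-1 - i.+2%:R^-1).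
  have h1 : 0 < i.+1%:R :> R by rewrite ltr0n.
  have h2 : 0 < i.+2%:R :> R by rewrite ltr0n.
  have -> : 3 * (i.+1%:R^-1 - i.+2%:R^-1) = 3 / (i.+1%:R * i.+2%:R) :> R.
    have -> : i.+2%:R = i.+1%:R + 1 :> R by rewrite -(natr1 i.+1).
    by field; rewrite gt_eqF//= (natr1 i.+1) gt_eqF.
  rewrite ler_pdivlMr ?mulr_gt0// mulrC ler_pdivrMr ?oneDsqr_pos//.
  have hn : (i.+1 * i.+2 <= 3 * (1 + i ^ 2))%N.
    by case: (i) => // j; rewrite -mulnn; nia.
  by rewrite /oneDsqr -natrX -natrM (_ : 1 + (i ^ 2)%:R = (1 + i ^ 2)%:R) -?natrM ?ler_nat// natrD.
have tel : \sum_(i < N) (oneDsqr (i%:R : R))^-1 <= 3 * (1 - N.+1%:R^-1).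
  elim: N => [|N IH]; first by rewrite big_ord0 invr1 subrr mulr0.
  rewrite big_ord_recr/=; apply: le_trans (lerD IH (bnd N)) _.
  by rewrite le_eqVlt; apply/orP; left; apply/eqP; ring.
have := tel; have : 0 <= N.+1%:R^-1 :> R by rewrite invr_ge0.
by move: (N.+1%:R^-1) => z; lra.
Qed.

Lemma bisummable_oneDsqrV : bisummable_by 6 (fun k : int => (oneDsqr (k%:~R : R))^-1).
Proof.
move=> N; have -> : (6 : R) = 3 + 3 by lra.
have o0 (x : R) : `|(oneDsqr x)^-1| = (oneDsqr x)^-1.
  by rewrite ger0_norm// invr_ge0 ltW// oneDsqr_pos.
apply: lerD.
  by under eq_bigr do rewrite o0; exact: sum_oneDsqrV.
apply: le_trans (sum_oneDsqrV N.+1); rewrite big_ord_recl/=.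
apply: ler_wpDl; first by rewrite invr_ge0 ltW// oneDsqr_pos.
apply: ler_sum => i _; rewrite o0 intrN -pmulrn /oneDsqr sqrrN.
by [].
Qed.

Lemma bisummable_decay f C : (forall x, `|f x| <= C / oneDsqr x) ->
  bisummable (fun j : int => f j%:~R).
Proof.
move=> fC; have h : bisummable (fun k : int => (oneDsqr (k%:~R : R))^-1).
  by exists 6; exact: bisummable_oneDsqrV.
apply: bisummable_le (bisummableZ C h) => k.
by apply: le_trans (fC _) _; exact: ler_norm.
Qed.

Lemma rint_sum (I : Type) (r : seq I) (F : I -> R -> R) :
  (forall i, decays (F i)) ->
  decays (fun x => \sum_(i <- r) F i x) /\
  rint (fun x => \sum_(i <- r) F i x) = \sum_(i <- r) rint (F i).
Proof.
move=> dF; elim: r => [|i r [IH1 IH2]].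
  have -> : (fun x : R => \sum_(i <- [::]) F i x) = (fun=> 0).
    by apply/funext => x; rewrite big_nil.
  split; last by rewrite big_nil /rint /Rintegral integral0.
  by split; [exact: cst_continuous|exists 0 => x; rewrite normr0 mul0r].
have -> : (fun x : R => \sum_(j <- i :: r) F j x) =
    (fun x => F i x + \sum_(j <- r) F j x).
  by apply/funext => x; rewrite big_cons.
by rewrite big_cons -IH2 -rintD//; split => //; exact: decaysD.
Qed.

Lemma rint_fejer g N : decays g ->
  decays (fun x => fejer N x * g x) /\
  rint (fun x => fejer N x * g x) =
  \sum_(i < N) \sum_(j < N) cos_coef g (i%:Z - j%:Z)%:~R.
Proof.
move=> dg.
have -> : (fun x => fejer N x * g x) = (fun x => \sum_(i < N) \sum_(j < N)
    (cos (2 * pi * (i%:Z - j%:Z)%:~R * x) * g x)).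
  apply/funext => x; rewrite fejerE mulr_suml; apply: eq_bigr => i _.
  by rewrite mulr_suml.
pose F (i j : 'I_N) x := cos (2 * pi * (i%:Z - j%:Z)%:~R * x) * g x.
have d i j : decays (F i j) by exact: decays_cos.
have H i := rint_sum (index_enum 'I_N) (d i).
have [h1 h2] := rint_sum (index_enum 'I_N) (fun i => (H i).1).
split; first exact: h1.
by rewrite [LHS]h2; apply: eq_bigr => i _; exact: (H i).2.
Qed.

(** The square [0, n]^2 without [0, n-1]^2 has on its border every difference
from -n to n once. *)
Lemma double_sum (c : int -> R) N :
  \sum_(i < N) \sum_(j < N) c (i%:Z - j%:Z) = \sum_(k < N) (bisum c k + c k%:Z).
Proof.
elim: N => [|N IH]; first by rewrite !big_ord0.
rewrite [RHS]big_ord_recr/= -IH big_ord_recr/=.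
under eq_bigr do rewrite big_ord_recr/=.
rewrite big_split/= -addrA; congr (_ + _).
rewrite /bisum [RHS]addrAC addrC; congr (_ + _); last first.
  rewrite (reindex_inj rev_ord_inj)/=; apply: eq_bigr => i _.
  by congr c; have := ltn_ord i; lia.
transitivity (\sum_(i < N.+1) c i%:Z); last by rewrite big_ord_recr.
rewrite (reindex_inj rev_ord_inj)/=; apply: eq_bigr => i _.
  by congr c; have := ltn_ord i; lia.
Qed.

(** Cesaro means of a convergent series. *)
Lemma fejer_mean_cvg (c : int -> R) : bisummable c ->
  n.+1%:R^-1 * \sum_(i < n.+1) \sum_(j < n.+1) c (i%:Z - j%:Z) @[n --> \oo]
  --> bilim c.
Proof.
move=> sc; have h : (fun k => bisum c k + c k%:Z) @ \oo --> bilim c.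
  by rewrite -[X in _ --> X]addr0; apply: cvgD; [exact: bisum_cvg|exact: bisummable_pos].
apply: eq_cvgn (cesaro h) => n; rewrite /arithmetic_mean/= double_sum.
by rewrite /series/= big_mkord.
Qed.

(** On the unit interval around k the kernel has mass N and is at most
1/(x - k)^2, so with N = K^2 the arithmetic-geometric mean inequality bounds
|x - k| times the kernel by a multiple of 1/K in the mean; the Lipschitz bound
of [g] does the rest. The error decays like 1/k^2 and can be summed over k. *)
Lemma fejer_local g C (n : nat) (k : int) : continuous g ->
  (forall x h, `|h| <= 1 -> `|g (x + h) - g x| <= C * `|h| / oneDsqr x) -> 0 <= C ->
  `|lint (k%:~R - 2^-1) (k%:~R + 2^-1) (fun x => fejer (n.+1 ^ 2)%N x * g x) -
    (n.+1 ^ 2)%N%:R * g k%:~R| <= (n.+1 ^ 2)%N%:R * (C / n.+1%:R) / oneDsqr k%:~R.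
Proof.
move=> cg gL C0; set N := (n.+1 ^ 2)%N; set K : R := n.+1%:R; have K0 : 0 < K by rewrite ltr0n.
have NE : N%:R = K ^+ 2 :> R by rewrite natrX.
set a := k%:~R - 2^-1; set b := k%:~R + 2^-1; set o := oneDsqr _.
have o0 : 0 < o by exact: oneDsqr_pos.
have cF := @continuous_fejer R N.
have cM (h : R -> R) : continuous h -> continuous (fun x => fejer N x * h x).
  by move=> ch x; apply: cvgM; [exact: cF|exact: ch].
have cD : continuous (fun x => g x + - g k%:~R).
  by move=> x; apply: cvgD; [exact: cg|exact: cvg_cst].
have -> : N%:R * g k%:~R = lint a b (fun x => fejer N x * g k%:~R).
  rewrite -[in LHS](lint_fejer k N) mulrC -lintZ//; congr lint; apply/funext => x.
  by rewrite mulrC.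
have -> : lint a b (fun x => fejer N x * g x) - lint a b (fun x => fejer N x * g k%:~R)
  = lint a b (fun x => fejer N x * (g x + - g k%:~R)).
  rewrite -mulN1r -lintZ; last by apply: cM; exact: cst_continuous.
  rewrite -lintD; [|exact: cM|].
    by congr lint; apply/funext => x; ring.
  move=> x; apply: cvgM; first exact: cvg_cst.
  by apply: cM; exact: cst_continuous.
apply: le_trans (ler_norm_lint _ _ (cM _ cD)) _.
have cB : continuous (fun x => C / o / 2 / K * (fejer N x + K ^+ 2)).
  move=> x; apply: cvgM; first exact: cvg_cst.
  by apply: cvgD; [exact: cF|exact: cvg_cst].
have ab : a <= b by rewrite /a /b; lra.
have cFK : continuous (fun x => fejer N x + K ^+ 2).
  by move=> x; apply: cvgD; [exact: cF|exact: cvg_cst].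
apply: (@le_trans _ _ (lint a b (fun x => C / o / 2 / K * (fejer N x + K ^+ 2)))).
  apply: ler_lint => [||x /andP[ax xb]] //.
    by move=> x; apply: cvg_norm; exact: (cM _ cD).
  have xk : `|x - k%:~R| <= 2^-1.
    by move: ax xb; rewrite /a /b ler_norml => *; apply/andP; split; lra.
  rewrite normrM ger0_norm ?fejer_ge0//.
  have := gL k%:~R (x - k%:~R); rewrite (addrC k%:~R) subrK -/o => H.
  have {}H : `|g x - g k%:~R| <= C * `|x - k%:~R| / o by apply: H; lra.
  apply: le_trans (ler_wpM2l (fejer_ge0 N x) H) _.
  have -> : fejer N x * (C * `|x - k%:~R| / o) = C / o / 2 / K *
     (2 * K * `|x - k%:~R| * fejer N x) by field; rewrite !gt_eqF.
  apply: ler_wpM2l; first by rewrite !divr_ge0// ltW.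
  have s := sin_pi_sqr_ge xk; have s2 := fejer_sin N x.
  have f0 := fejer_ge0 N x.
  have s3 : (x - k%:~R) ^+ 2 * fejer N x <= 1.
    by apply: le_trans s2; rewrite ler_wpM2r.
  rewrite -(real_normK (num_real (x - k%:~R))) in s3.
  move: s3; set y := `|x - _| => s3.
  have h1 : 0 <= (1 - K * (y * K)) ^+ 2 by exact: sqr_ge0.
  have : 2 * K * y * fejer N x <= fejer N x + K ^+ 2 * (y ^+ 2 * fejer N x).
    rewrite -subr_ge0 (_ : _ - _ = (1 - K * y) ^+ 2 * fejer N x); last by ring.
    by rewrite mulr_ge0// sqr_ge0.
  move/le_trans; apply; rewrite lerD2l -[leRHS]mulr1 ler_wpM2l// sqr_ge0//.
rewrite lintZ// lintD//; last exact: cst_continuous.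
rewrite lint_fejer lint_cst//.
rewrite (_ : b - a = 1); last by rewrite /a /b; lra.
by rewrite NE le_eqVlt; apply/orP; left; apply/eqP; field; rewrite !gt_eqF.
Qed.

(** Integrate [g] against the Fejer kernel. Expanding the kernel gives Cesaro
means of the Fourier coefficients, while [fejer_local] gives the sum of the
values at the integers. *)
Theorem poisson_summation g : lip_decay g ->
  bisummable (fun m : int => cos_coef g m%:~R) ->
  bilim (fun m : int => cos_coef g m%:~R) = bilim (fun j : int => g j%:~R).
Proof.
move=> ng sc; have dg := lip_decay_decays ng; have [C gC gL] := ng.
have C0 := decays_const_ge0 gC.
have sg : bisummable (fun j : int => g j%:~R) by exact: bisummable_decay gC.
pose S (N : nat) := \sum_(i < N) \sum_(j < N) cos_coef g (i%:Z - j%:Z)%:~R.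
have est (n : nat) : `|((n.+1 ^ 2)%N)%:R^-1 * S (n.+1 ^ 2)%N -
    bilim (fun j : int => g j%:~R)| <= 6 * C / n.+1%:R.
  set N := (n.+1 ^ 2)%N; have N0 : 0 < N%:R :> R by rewrite ltr0n expn_gt0.
  have [dF IF] := rint_fejer N dg.
  have fin M : `|lint (- M%:R - 2^-1) (M%:R - 2^-1) (fun x => fejer N x * g x) -
      N%:R * bisum (fun j : int => g j%:~R) M| <= N%:R * (C / n.+1%:R) * 6.
    rewrite -bisum_lint; last exact: dF.1.
    have -> : bisum (fun k : int => lint (k%:~R - 2^-1) (k%:~R + 2^-1)
          (fun x => fejer N x * g x)) M - N%:R * bisum (fun j : int => g j%:~R) M =
        bisum (fun k : int => lint (k%:~R - 2^-1) (k%:~R + 2^-1)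
          (fun x => fejer N x * g x) + -1 * (N%:R * g k%:~R)) M.
      by rewrite bisumD !bisumZ mulN1r.
    apply: le_trans (ler_norm_bisum _ _) _.
    apply: (@le_trans _ _ (bisum (fun k : int => N%:R * (C / n.+1%:R) *
       `|(oneDsqr (k%:~R : R))^-1|) M)).
      apply: ler_bisum => k; rewrite mulN1r.
      apply: le_trans (fejer_local n k dg.1 gL C0) _.
      by rewrite ler_wpM2l ?ler_norm// mulr_ge0 ?divr_ge0.
    rewrite bisumZ ler_wpM2l//; first by rewrite mulr_ge0 ?divr_ge0.
    exact: bisummable_oneDsqrV.
  have lim : `|S N - N%:R * bilim (fun j : int => g j%:~R)| <= N%:R * (C / n.+1%:R) * 6.
    rewrite /S -IF.
    have h : (fun M => `|lint (- M%:R - 2^-1) (M%:R - 2^-1) (fun x => fejer N x * g x) -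
      N%:R * bisum (fun j : int => g j%:~R) M|) @ \oo -->
      `|rint (fun x => fejer N x * g x) - N%:R * bilim (fun j : int => g j%:~R)|.
      apply: cvg_norm; apply: cvgB; first exact: lint_cvg.
      by apply: cvgMr; exact: bisum_cvg.
    rewrite -(cvg_lim _ h)//; apply: limr_le; first by apply/cvg_ex; eexists; exact: h.
    exact: nearW.
  rewrite -(ler_pM2l N0) -[X in X * `|_|](gtr0_norm N0) -normrM mulrBr mulVKf ?gt_eqF//.
  by apply: le_trans lim _; rewrite le_eqVlt; apply/orP; left; apply/eqP; ring.
have c1 : (fun n => ((n.+1 ^ 2)%N)%:R^-1 * S (n.+1 ^ 2)%N) @ \oo -->
    bilim (fun m : int => cos_coef g m%:~R).
  have h := fejer_mean_cvg sc.
  have sub : (fun n => (n.+1 ^ 2).-1)%N @ \oo --> \oo.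
    move=> P [M _ MP]; exists M => //= n /= Mn; apply: MP.
    change (M <= (n.+1 ^ 2).-1)%N; apply: (leq_trans Mn).
    by rewrite -ltnS prednK ?expn_gt0// -mulnn leq_pmulr.
  apply: eq_cvgn (cvg_comp _ _ sub h) => n.
  have E : (n.+1 ^ 2 = (n.+1 ^ 2).-1.+1)%N by rewrite prednK// expn_gt0.
  by rewrite [in RHS]E.
have c2 : (fun n => ((n.+1 ^ 2)%N)%:R^-1 * S (n.+1 ^ 2)%N) @ \oo -->
    bilim (fun j : int => g j%:~R).
  apply/cvgrPdist_le => e e0; near=> n.
  rewrite distrC; apply: le_trans (est n) _.
  rewrite ler_pdivrMr// [e * _]mulrC -ler_pdivrMr//.
  have : 6 * C / e <= n%:R by near: n; exact: nbhs_infty_ger.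
  by move/le_trans; apply; rewrite ler_nat.
exact: (cvg_unique _ c1 c2).
Unshelve. all: by end_near.
Qed.

End PoissonSummation.

(** * The transfer operator and the continuous density *)

Section Transfer.
Context {R : realType}.
Variable p : R.
Hypothesis hp : 0 <= p <= 1.
Implicit Types (f g b : R -> R) (C K : R).

Lemma phase_factorE (k : R) (l : nat) : phase_factor p k l =
  p ^+ 2 + (1 - p) ^+ 2 + 2 * p * (1 - p) * cos (2 ^+ l * pi * k).
Proof.
rewrite /phase_factor /Normc.normc /expi /= !mul0r subr0 addr0 cosN sinN add0r.
rewrite sqr_sqrtr; last by rewrite addr_ge0// sqr_ge0.
set c := cos _; set s := sin _.
have h : c ^+ 2 + s ^+ 2 = 1 by exact: cos2Dsin2.
have {}h : s ^+ 2 = 1 - c ^+ 2 by lra.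
have -> : (1 - p + p * c) ^+ 2 + (p * - s) ^+ 2 =
  (1 - p + p * c) ^+ 2 + p ^+ 2 * s ^+ 2 by ring.
by rewrite h; ring.
Qed.

Lemma phase_factor_ge0 k l : 0 <= phase_factor p k l.
Proof. by rewrite sqr_ge0. Qed.

Lemma phase_factor_le1 k l : phase_factor p k l <= 1.
Proof.
have /andP[p0 p1] := hp; rewrite phase_factorE.
have := cos_le1 (2 ^+ l * pi * k); set c := cos _ => c1.
have h : 0 <= 2 * p * (1 - p) by rewrite mulr_ge0 ?subr_ge0// mulr_ge0.
have hc := ler_wpM2l h c1; rewrite mulr1 in hc.
apply: (le_trans (lerD (lexx _) hc)).
by rewrite le_eqVlt; apply/orP; left; apply/eqP; ring.
Qed.

Definition phase_prod (k : R) (i : nat) := \prod_(1 <= l < i.+1) phase_factor p k l.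

Lemma phase_prod_ge0 k i : 0 <= phase_prod k i.
Proof. by apply: prodr_ge0 => l _; exact: phase_factor_ge0. Qed.

Lemma phase_prod_le1 k i : phase_prod k i <= 1.
Proof.
rewrite /phase_prod; apply: prodr_ile1 => l _.
by rewrite phase_factor_ge0 phase_factor_le1.
Qed.

Lemma phase_prod0 k : phase_prod k 0 = 1.
Proof. by rewrite /phase_prod big_geq. Qed.

Lemma phase_prodS k i : phase_prod k i.+1 = phase_prod k i * phase_factor p k i.+1.
Proof. by rewrite /phase_prod big_nat_recr. Qed.

(** The renormalisation operator on test functions that corresponds to the
recursion of the pair correlations. *)
Definition transfer f (y : R) := phase_factor p (y / 2) 1 * f (y / 2).

Lemma iter_transferE f i y :
  iter i transfer f y = phase_prod (y / 2 ^+ i) i * f (y / 2 ^+ i).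
Proof.
elim: i y => [|i IH] y; first by rewrite /= expr0 divr1 phase_prod0 mul1r.
rewrite iterS /transfer IH phase_prodS.
have -> : y / 2 / 2 ^+ i = y / 2 ^+ i.+1.
  by rewrite exprS invfM mulrA.
rewrite mulrA; congr (_ * _); rewrite mulrC; congr (_ * _).
rewrite !phase_factorE; congr (_ + _ * cos _); field.
by rewrite expf_neq0.
Qed.

Lemma continuous_phase_factor l : continuous (fun k => phase_factor p k l).
Proof.
have -> : (fun k => phase_factor p k l) = (fun k =>
  p ^+ 2 + (1 - p) ^+ 2 + 2 * p * (1 - p) * cos (2 ^+ l * pi * k)).
  by apply/funext => k; exact: phase_factorE.
move=> k; apply: cvgD; first exact: cvg_cst.
apply: cvgM; first exact: cvg_cst.
exact: continuous_cosM.
Qed.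

Lemma continuous_phase_prod i : continuous (fun k => phase_prod k i).
Proof.
elim: i => [|i IH].
  under eq_fun do rewrite phase_prod0; exact: cst_continuous.
under eq_fun do rewrite phase_prodS.
by move=> k; apply: cvgM; [exact: IH|exact: continuous_phase_factor].
Qed.

Lemma lip_decay_transfer f : lip_decay f -> lip_decay (transfer f).
Proof.
have /andP[p0 p1] := hp; have q0 : 0 <= 1 - p by rewrite subr_ge0.
move=> nf; apply: (@lip_decay_half _ (fun x => phase_factor p x 1 * f x)).
apply: (@lip_decay_mul _ _ _ (2 * p * (1 - p) * (2 * pi))) nf => [x|x y].
  by rewrite ger0_norm ?phase_factor_ge0// phase_factor_le1.
rewrite !phase_factorE !expr1 opprD addrACA subrr add0r -mulrBr normrM.
rewrite ger0_norm; last by rewrite mulr_ge0// mulr_ge0.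
rewrite -[leRHS]mulrA ler_wpM2l//; first by rewrite mulr_ge0// mulr_ge0.
apply: le_trans (cos_lip _ _) _; rewrite -mulrBr normrM ger0_norm//.
by rewrite mulr_ge0// pi_ge0.
Qed.

Lemma lip_decay_iter_transfer f i : lip_decay f -> lip_decay (iter i transfer f).
Proof. by move=> nf; elim: i => //= i IH; exact: lip_decay_transfer. Qed.

(** Substitute x = y / 2 in the integral; multiplying by the phase factor, a
trigonometric polynomial of degree 1, mixes neighbouring coefficients. *)
Lemma cos_coef_transfer f : lip_decay f ->
  (fun j : int => cos_coef (transfer f) j%:~R) =
  coef_subst p (fun j : int => cos_coef f j%:~R).
Proof.
move=> nf; have df := lip_decay_decays nf; apply/funext => j.
pose h x := cos (2 * pi * (2 * j%:~R) * x) * (phase_factor p x 1 * f x).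
have dh : decays h.
  apply: decays_cos; apply: (@decaysM _ _ _ 1) df => [x|].
    by rewrite ger0_norm ?phase_factor_ge0// phase_factor_le1.
  exact: continuous_phase_factor.
have h2 : rint h = 2^-1 * cos_coef (transfer f) j%:~R.
  rewrite (rint_affine 0 (_ : 0 < 2^-1) dh)//; congr (_ * rint _).
  apply/funext => x; rewrite /h /transfer addr0 [2^-1 * x]mulrC; congr (_ * _).
  by congr cos; field.
have -> : cos_coef (transfer f) j%:~R = 2 * rint h by rewrite h2; field.
rewrite /coef_subst; congr (2 * _).
have d k : decays (fun x => cos (2 * pi * k * x) * f x) by exact: decays_cos.
have hE : h = (fun x => (p ^+ 2 + (1 - p) ^+ 2) * (cos (2 * pi * (2 * j)%:~R * x) * f x) +
   p * (1 - p) * (cos (2 * pi * (2 * j + 1)%:~R * x) * f x +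
                  cos (2 * pi * (2 * j - 1)%:~R * x) * f x)).
  apply/funext => x; rewrite /h phase_factorE expr1 intrB intrD intrM.
  have -> : 2 * pi * (2%:~R * j%:~R + 1%:~R) * x =
    2 * pi * (2 * j%:~R) * x + 2 * pi * x by ring.
  have -> : 2 * pi * (2%:~R * j%:~R - 1%:~R) * x =
    2 * pi * (2 * j%:~R) * x - 2 * pi * x by ring.
  by rewrite cosD cosB; ring.
rewrite hE rintD; [|exact: decaysZ|apply: decaysZ; exact: decaysD].
by rewrite !rintZ//; [rewrite rintD|exact: decaysD].
Qed.

Lemma iter_cos_coef f i : lip_decay f ->
  iter i (coef_subst p) (fun j : int => cos_coef f j%:~R) =
  (fun j : int => cos_coef (iter i transfer f) j%:~R).
Proof.
move=> nf; elim: i => //= i ->.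
by rewrite -cos_coef_transfer//; exact: lip_decay_iter_transfer.
Qed.

Definition phi_term (i : nat) (k : R) : R :=
  4 * p * (1 - p) / 3 * ((1 - cos (2 ^+ i.+1 * pi * k)) / 2 ^+ i.+1 * phase_prod k i).

Lemma phi_term_ge0 i k : 0 <= phi_term i k.
Proof.
have /andP[p0 p1] := hp; have q0 : 0 <= 1 - p by rewrite subr_ge0.
rewrite /phi_term mulr_ge0//; first by rewrite divr_ge0// !mulr_ge0.
by rewrite mulr_ge0 ?phase_prod_ge0// divr_ge0 ?exprn_ge0// subr_ge0 cos_le1.
Qed.

Lemma phi_term_le i k : phi_term i k <= 2 ^- i.
Proof.
have /andP[p0 p1] := hp; have q0 : 0 <= 1 - p by rewrite subr_ge0.
rewrite /phi_term -[leRHS]mul1r; apply: ler_pM.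
- by rewrite divr_ge0// !mulr_ge0.
- by rewrite mulr_ge0 ?phase_prod_ge0// divr_ge0 ?exprn_ge0// subr_ge0 cos_le1.
- by have := sqr_ge0 (2 * p - 1); nra.
rewrite -[leRHS]mulr1; apply: ler_pM; rewrite ?phase_prod_ge0 ?phase_prod_le1//.
rewrite exprS invfM mulrA -[leRHS]mul1r ler_wpM2r ?invr_ge0 ?exprn_ge0//.
by rewrite ler_pdivrMr//; have := cos_geN1 (2 * 2 ^+ i * pi * k); lra.
Qed.

Lemma continuous_phi_term i : continuous (phi_term i).
Proof.
move=> k; apply: cvgM; first exact: cvg_cst.
apply: cvgM; last exact: continuous_phase_prod.
apply: cvgM; last exact: cvg_cst.
by apply: cvgB; [exact: cvg_cst|exact: continuous_cosM].
Qed.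

Definition phi_sum (n : nat) (k : R) : R := \sum_(i < n) phi_term i k.

(** The terms are at most 2^-i, since 4 p q <= 1 and 1 - cos <= 2. *)
Lemma phi_sum_tail n m k : phi_sum (n + m) k <= phi_sum n k + 2 * 2 ^- n.
Proof.
have H : forall m, phi_sum (n + m) k <= phi_sum n k + 2 * 2 ^- n - 2 * 2 ^- (n + m).
  elim=> [|j IH]; first by rewrite addn0 addrK.
  rewrite addnS {1}/phi_sum big_ord_recr/=; have := phi_term_le (n + j) k.
  move: IH; rewrite /phi_sum exprS invfM.
  move: (2 ^- (n + j)) => z; move: (\sum_(_ < n + j) _) => s.
  by move: (phi_term _ _) (\sum_(_ < n) _) (2 ^- n) => *; lra.
apply: le_trans (H m) _; rewrite gerBl.
by rewrite mulr_ge0// invr_ge0 exprn_ge0.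
Qed.

Lemma phi_sum_nd k : nondecreasing_seq (phi_sum ^~ k).
Proof.
apply/nondecreasing_seqP => n; rewrite /phi_sum big_ord_recr/= lerDl.
exact: phi_term_ge0.
Qed.

Lemma phi_sum_cvg k : phi_sum ^~ k @ \oo --> phi_ac p k.
Proof.
have c : cvgn (phi_sum ^~ k).
  apply: nondecreasing_is_cvgn; first exact: phi_sum_nd.
  exists 2 => _ [n _ <-]; have := phi_sum_tail 0 n k.
  by rewrite /phi_sum big_ord0 add0r add0n expr0 invr1 mulr1.
suff -> : phi_ac p k = limn (phi_sum ^~ k) by [].
rewrite /phi_ac; set u := fun N => _.
have E n : phi_sum n k = 4 * p * (1 - p) / 3 * u n.+1.
  rewrite /phi_sum /u mulr_sumr big_add1 /= big_mkord; apply: eq_bigr => i _.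
  by [].
have [pq|pq] := eqVneq (4 * p * (1 - p) / 3) 0.
  rewrite pq mul0r; apply/esym/cvg_lim => //.
  by apply: eq_cvgn (cvg_cst 0) => n; rewrite E pq mul0r.
have cu : u @ \oo --> (4 * p * (1 - p) / 3)^-1 * limn (phi_sum ^~ k).
  rewrite -(cvg_shiftS u); apply: eq_cvgn (cvgMr c) => n.
  by rewrite E mulKf.
by rewrite (cvg_lim _ cu)// mulVKf.
Qed.

Lemma phi_sum_le n k : phi_sum n k <= phi_ac p k.
Proof.
rewrite -(cvg_lim _ (@phi_sum_cvg k))//; apply: nondecreasing_cvgn_le.
  exact: phi_sum_nd.
by apply/cvg_ex; eexists; exact: phi_sum_cvg.
Qed.

Lemma phi_ac_le n k : phi_ac p k <= phi_sum n k + 2 * 2 ^- n.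
Proof.
rewrite -(cvg_lim _ (@phi_sum_cvg k))//; apply: limr_le.
  by apply/cvg_ex; eexists; exact: phi_sum_cvg.
by near=> m; rewrite -(@subnKC n m) ?phi_sum_tail//; near: m; exact: nbhs_infty_ge.
Unshelve. all: by end_near.
Qed.

Lemma phi_ac_ge0 k : 0 <= phi_ac p k.
Proof. by have := phi_sum_le 0 k; rewrite /phi_sum big_ord0. Qed.

Lemma phi_ac_le2 k : phi_ac p k <= 2.
Proof. by have := phi_ac_le 0 k; rewrite /phi_sum big_ord0 add0r expr0 invr1 mulr1. Qed.

Lemma continuous_phi_sum n : continuous (phi_sum n).
Proof. by apply: continuous_sum => i; exact: continuous_phi_term. Qed.

Lemma geo2_cvg0 (K : R) : K * 2 ^- n @[n --> \oo] --> (0 : R).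
Proof. by rewrite -(mulr0 K); apply: cvgMr; exact: expr2V_cvg0.
Qed.

(** A uniform limit of continuous functions. *)
Lemma continuous_phi_ac : continuous (phi_ac p).
Proof.
move=> x; apply/cvgrPdist_le => e e0.
have [n _ /(_ n (leqnn n)) Hn] : \forall n \near \oo, 2 * 2 ^- n <= e / 2 :> R.
  have /cvgrPdist_le/(_ (e / 2)) := geo2_cvg0 2.
  move=> /(_ (divr_gt0 e0 (ltr0n _ 2))) [n _ H]; exists n => // m nm.
  by have := H m nm; rewrite sub0r normrN; apply: le_trans; exact: ler_norm.
near=> y.
have : `|phi_sum n x - phi_sum n y| <= e / 2.
  near: y; apply: cvgr_dist_le; first exact: continuous_phi_sum.
  by rewrite divr_gt0.
have := phi_sum_le n x; have := phi_sum_le n y.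
have := phi_ac_le n x; have := phi_ac_le n y.
rewrite !ler_norml => h1 h2 h3 h4 /andP[h5 h6]; apply/andP; split; lra.
Unshelve. all: by end_near.
Qed.

Lemma decays_phi_term i f : decays f -> decays (fun x => phi_term i x * f x).
Proof.
apply: (@decaysM _ _ _ (2 ^- i)); last exact: continuous_phi_term.
by move=> x; rewrite ger0_norm ?phi_term_ge0// phi_term_le.
Qed.

Lemma decays_phi_ac f : decays f -> decays (fun x => phi_ac p x * f x).
Proof.
apply: (@decaysM _ _ _ 2); last exact: continuous_phi_ac.
by move=> x; rewrite ger0_norm ?phi_ac_ge0// phi_ac_le2.
Qed.

Lemma rint_phi_cvg f : decays f ->
  \sum_(i < n) rint (fun x => phi_term i x * f x) @[n --> \oo]
  --> rint (fun x => phi_ac p x * f x).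
Proof.
move=> df; have dn := decays_norm df.
have est n : `|rint (fun x => phi_ac p x * f x) -
     \sum_(i < n) rint (fun x => phi_term i x * f x)| <=
     (2 * rint (fun x => `|f x|)) * 2 ^- n.
  have [d1 <-] := rint_sum (index_enum 'I_n) (fun i : 'I_n => decays_phi_term i df).
  rewrite -[- rint _]mulN1r -(rintZ (-1) d1).
  rewrite -(rintD (decays_phi_ac df) (decaysZ (-1) d1)).
  have dd : decays (fun x => phi_ac p x * f x + -1 * \sum_(i < n) phi_term i x * f x).
    by apply: decaysD; [exact: decays_phi_ac|exact: decaysZ].
  apply: le_trans (ler_norm_rint dd) _.
  have -> : (2 * rint (fun x => `|f x|)) * 2 ^- n = 2 * 2 ^- n * rint (fun x => `|f x|).
    by ring.
  rewrite -rintZ//; apply: ler_rint => [||x]; [exact: decays_norm|exact: decaysZ|].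
  rewrite -mulr_suml mulN1r -mulrBl normrM ler_wpM2r//.
  have := phi_sum_le n x; have := phi_ac_le n x; rewrite /phi_sum.
  by move=> h1 h2; rewrite ger0_norm ?subr_ge0// lerBlDl.
apply/cvgrPdist_le => e e0; near=> n; apply: le_trans (est n) _.
apply: le_trans (ler_norm _) _; rewrite -normrN -sub0r.
near: n; apply: cvgr_dist_le => //; exact: geo2_cvg0.
Unshelve. all: by end_near.
Qed.

(** The defect term of the i-th step, pulled back to the original variable by
x = 2^i y. *)
Lemma phi_coef f i : lip_decay f ->
  4 ^- i * (2 * p * (1 - p) / 3 * (cos_coef (iter i transfer f) 0%:~R -
    (cos_coef (iter i transfer f) 1%:~R + cos_coef (iter i transfer f) (-1)%:~R) / 2)) =
  rint (fun x => phi_term i x * f x).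
Proof.
move=> nf; have df := lip_decay_decays nf.
have dT := lip_decay_decays (lip_decay_iter_transfer i nf).
set F := iter i transfer f in dT *; pose c (j : int) := cos_coef F j%:~R.
rewrite -[cos_coef F 0%:~R]/(c 0) -[cos_coef F 1%:~R]/(c 1) -[cos_coef F _]/(c (-1)).
have d k : decays (fun x => cos (2 * pi * k * x) * F x) by exact: decays_cos.
have -> : c 0 - (c 1 + c (-1)) / 2 = rint (fun x => (1 - cos (2 * pi * x)) * F x).
  have -> : (fun x => (1 - cos (2 * pi * x)) * F x) =
    (fun x => cos (2 * pi * 0%:~R * x) * F x + - 2^-1 * (cos (2 * pi * 1%:~R * x) * F x
       + cos (2 * pi * (-1)%:~R * x) * F x)).
    apply/funext => x; rewrite mulr0 mul0r cos0 mulr1.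
    have -> : 2 * pi * (-1)%:~R * x = - (2 * pi * x) by rewrite intrN; ring.
    by rewrite cosN; field.
  rewrite rintD//; last by apply: decaysZ; exact: decaysD.
  by rewrite rintZ ?rintD//; [rewrite /c /cos_coef; field|exact: decaysD].
have d1 : decays (fun x => (1 - cos (2 * pi * x)) * F x).
  apply: (@decaysM _ _ _ 2) dT => [x|x].
    have h1 := cos_geN1 (2 * pi * x); have h2 := cos_le1 (2 * pi * x).
    by rewrite ler_norml; apply/andP; split; lra.
  by apply: cvgB; [exact: cvg_cst|exact: continuous_cosM].
have i0 : 0 < 2 ^+ i :> R by rewrite exprn_gt0.
rewrite (rint_affine 0 i0 d1).
have -> : (fun x => phi_term i x * f x) = (fun x => 4 ^- i * (2 * p * (1 - p) / 3 * 2 ^+ i) *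
  ((1 - cos (2 * pi * (2 ^+ i * x + 0))) * F (2 ^+ i * x + 0))).
  apply/funext => x; rewrite addr0 /F iter_transferE /phi_term.
  have -> : 2 ^+ i * x / 2 ^+ i = x by field; rewrite gt_eqF.
  have -> : 2 * pi * (2 ^+ i * x) = 2 ^+ i.+1 * pi * x by rewrite exprS; ring.
  have -> : 4 ^+ i = 2 ^+ i * 2 ^+ i :> R by rewrite -exprMn; congr (_ ^+ _); ring.
  by rewrite exprS; field; rewrite gt_eqF.
rewrite rintZ; last exact: (decays_affine 0 i0 d1).
by rewrite !mulrA.
Qed.

Variable eta : nat -> R.
Hypothesis eta_bound : forall m, `|eta m| <= 1.
Hypothesis eta_0 : eta 0%N = 2 / 3.
Hypothesis eta_1 : eta 1%N = 1 / 3 + p * (1 - p) / 2 * eta 1%N.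
Hypothesis eta_e : forall j, (0 < j)%N ->
  eta (2 * j)%N = 1 / 3 + (p ^+ 2 + (1 - p) ^+ 2) / 2 * eta j.
Hypothesis eta_o : forall j, (0 < j)%N ->
  eta (2 * j).+1 = 1 / 3 + p * (1 - p) / 2 * (eta j + eta j.+1).

(** The steps of [pair_series_cvg] read on the side of the test function: Poisson
summation for the iterates of [transfer] gives the point masses of the i-th
layer, and the defects add up to the density. *)
Lemma pair_series_decomposition f : lip_decay f ->
  bisummable (fun m : int => cos_coef f m%:~R) ->
  \sum_(i < n) bilim (fun j : int => (3 * 4 ^+ i)^-1 *
     phase_prod (j%:~R / 2 ^+ i) i * f (j%:~R / 2 ^+ i)) @[n --> \oo] -->
  pair_series eta (fun m : int => cos_coef f m%:~R) - rint (fun x => phi_ac p x * f x).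
Proof.
move=> nf sc; have [K cK] := sc.
have h := cvgB (@pair_series_cvg _ _ _ hp eta_bound eta_0 eta_1 eta_e eta_o _ sc)
  (@rint_phi_cvg _ (lip_decay_decays nf)).
apply: (eq_cvgn _ (h _)) => n; rewrite -[LHS]/(_ - _) -sumrB; apply: eq_bigr => i _.
have sT : bisummable (fun m : int => cos_coef (iter i transfer f) m%:~R).
  by rewrite -iter_cos_coef//; eexists; exact: iter_coef_subst_summable cK.
rewrite iter_cos_coef// -phi_coef// mulrDr addrK mulrA.
rewrite (poisson_summation (lip_decay_iter_transfer i nf) sT).
have [C fC _] := lip_decay_iter_transfer i nf.
rewrite -bilimZ.
  congr bilim; apply/funext => j; rewrite iter_transferE mulrA; congr (_ * _ * _).
  by rewrite invfM div1r mulrC.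
exact: bisummable_decay fC.
Qed.

End Transfer.

(** * Weighted combs and measures with a density *)

Section WeightedComb.
Context {R : realType} (T : countType) (w : T -> {nonneg R}) (a : T -> R).
Local Open Scope ereal_scope.

(** The countable index type is enumerated by its pickling; codes that are not
in use get the zero measure. *)
Definition comb_atom (n : nat) : {measure set (measurableTypeR R) -> \bar R} :=
  if pickle_inv n is Some t then mscale (w t) (@dirac _ (measurableTypeR R) (a t) R)
  else @mzero _ (measurableTypeR R) R.

Definition weighted_comb : {measure set (measurableTypeR R) -> \bar R} :=
  mseries comb_atom 0.

Lemma esum_pickle (h : T -> \bar R) : (forall t, 0 <= h t) ->
  \sum_(n <oo) (if pickle_inv n is Some t then h t else 0) = \esum_(t in [set: T]) h t.
Proof.
move=> h0; pose H n := if pickle_inv n is Some t then h t else 0.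
rewrite nneseries_esumT; last by move=> n; case: pickle_inv.
transitivity (\esum_(n in range (@pickle T)) H n).
  rewrite [RHS]esum_mkcond; apply: eq_esum => n _; rewrite /H.
  have := @pickle_invK T n; case: pickle_inv => [t /= <-|_].
    by rewrite mem_set//; exists t.
  by case: ifP.
rewrite (@reindex_esum _ _ _ [set: T] _ pickle).
  by apply: eq_esum => t _; rewrite /H pickleK_inv.
by split => // x y _ _; exact: (pcan_inj pickleK).
Qed.

Lemma ge0_integral_weighted_comb (f : measurableTypeR R -> \bar R) :
  measurable_fun setT f -> (forall x, 0 <= f x) ->
  \int[weighted_comb]_x f x = \esum_(t in [set: T]) ((w t)%:num%:E * f (a t)).
Proof.
move=> mf f0; rewrite ge0_integral_measure_series//.
rewrite -esum_pickle => [|t]; last by rewrite mule_ge0.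
apply: eq_eseriesr => n _; rewrite /comb_atom; case: pickle_inv => [t|].
  rewrite ge0_integral_mscale//; congr (_ * _).
  by rewrite integral_dirac// diracT mul1e.
exact: integral_measure_zero.
Qed.

Lemma weighted_combE (A : set (measurableTypeR R)) : measurable A ->
  weighted_comb A = \esum_(t in [set: T]) ((w t)%:num%:E * \d_(a t) A).
Proof.
move=> mA; rewrite -(setIT A) -(integral_indic _ measurableT mA).
rewrite ge0_integral_weighted_comb//.
  by apply: eq_esum => t _; rewrite setIT.
by apply/measurable_EFinP; exact: measurable_indic.
Qed.

End WeightedComb.

Section IntegerSums.
Context {R : realType}.

Lemma esum_bilim (b : int -> R) : (forall m, 0 <= b m) -> bisummable b ->
  (\esum_(m in [set: int]) (b m)%:E = (bilim b)%:E)%E.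
Proof.
move=> b0 [K bK].
have b0' m : (0 <= (b m)%:E)%E by rewrite lee_fin.
have nb m : `|b m| = b m by rewrite ger0_norm.
have half (u : nat -> R) : (forall n, 0 <= u n) ->
    (forall N, \sum_(i < N) `|u i| <= K) ->
    exists2 l : R, (\sum_(i < n) u i @[n --> \oo] --> l) &
      (\esum_(n in [set: nat]) (u n)%:E = l%:E)%E.
  move=> u0 uK; have c := series_abs_cvg uK; exists (limn (fun N => \sum_(i < N) u i)) => //.
  rewrite -nneseries_esumT => [|n]; last by rewrite lee_fin.
  apply: cvg_lim => //; have h : (fun N => (\sum_(i < N) u i)%:E) @ \oo -->
      (limn (fun N => \sum_(i < N) u i))%:E by apply: cvg_EFin; [exact: nearW|].
  apply: cvg_trans h; apply: near_eq_cvg; apply: nearW => N.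
  by rewrite big_mkord sumEFin.
have [|N|l1 c1 e1] := half (fun n => b n%:Z) => //.
  by apply: le_trans (bK N); rewrite lerDl sumr_ge0.
have [|N|l2 c2 e2] := half (fun n => b (- n.+1%:Z)) => //.
  by apply: le_trans (bK N); rewrite lerDr sumr_ge0.
have -> : bilim b = l1 + l2 by apply: bilim_eq; exact: cvgD.
rewrite EFinD -e1 -e2 (esumID (range Posz)) => [|m _]//.
rewrite !setTI; congr (_ + _)%E.
  rewrite (@reindex_esum _ _ _ [set: nat] _ Posz)//.
  by split => // x y _ _ [].
rewrite (@reindex_esum _ _ _ [set: nat] _ (fun n => - n.+1%:Z))//.
split => //.
- by move=> n _ [m _].
- by move=> x y _ _ /oppr_inj [].
- by move=> [n|n] /= h; [exfalso; apply: h; exists n|exists n => //; rewrite NegzE].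
Qed.

End IntegerSums.

Section Density.
Context {R : realType} (g : R -> R).
Hypothesis mg : measurable_fun setT g.
Hypothesis g0 : forall x, 0 <= g x.
Local Notation mu := (@lebesgue_measure R).
Local Open Scope ereal_scope.

Definition density_fun (A : set (measurableTypeR R)) : \bar R :=
  \int[mu]_(x in A) (g x)%:E.

Let density0 : density_fun set0 = 0.
Proof. by rewrite /density_fun integral_set0. Qed.

Let density_ge0 A : 0 <= density_fun A.
Proof. by apply: integral_ge0 => x _; rewrite lee_fin. Qed.

Let density_sigma_additive : semi_sigma_additive density_fun.
Proof.
move=> /= F mF tF mUF; rewrite /density_fun ge0_integral_bigcup//; last 2 first.
- by apply/measurable_EFinP; exact: measurable_funS mg.
- by move=> x _; rewrite lee_fin.
apply: is_cvg_ereal_nneg_natsum_cond => n _ _.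
by apply: integral_ge0 => x _; rewrite lee_fin.
Qed.

HB.instance Definition _ := isMeasure.Build _ _ _
  density_fun density0 density_ge0 density_sigma_additive.

Definition density_measure : {measure set (measurableTypeR R) -> \bar R} := density_fun.

End Density.

Section DensityIntegral.
Context {R : realType} (g : R -> R).
Hypothesis mg : measurable_fun setT g.
Hypothesis g0 : forall x, 0 <= g x.
Local Notation mu := (@lebesgue_measure R).
Local Notation nu := (density_measure mg g0).
Local Open Scope ereal_scope.
Import HBNNSimple.

Let indic_int (A : set (measurableTypeR R)) : measurable A ->
  \int[mu]_x ((\1_A x)%:E * (g x)%:E) = nu A.
Proof.
move=> mA; rewrite [RHS]integral_mkcond; apply: eq_integral => x _.
by rewrite patchE indicE; case: ifP => xA; rewrite ?mul1e ?mul0e.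
Qed.

Let nnsfun_int (f : {nnsfun (measurableTypeR R) >-> R}) :
  \int[nu]_x (f x)%:E = \int[mu]_x ((f x)%:E * (g x)%:E).
Proof.
under [RHS]eq_integral.
  move=> x xD; rewrite fimfunE -fsumEFin// muleC ge0_mule_fsumr; last first.
    by move=> r; rewrite EFinM nnfun_muleindic_ge0.
  over.
rewrite [RHS]ge0_integral_fsum//; last 2 first.
  - move=> r; apply/measurable_EFinP; apply: measurable_funM => //.
    exact: measurableT_comp.
  - move=> n x _; apply: mule_ge0; first by rewrite lee_fin.
    by rewrite EFinM nnfun_muleindic_ge0.
under [LHS]eq_integral do rewrite fimfunE -fsumEFin//.
rewrite [LHS]ge0_integral_fsum//; last 2 first.
  - by move=> r; exact/measurable_EFinP/measurableT_comp.
  - by move=> n x _; rewrite EFinM nnfun_muleindic_ge0.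
apply: eq_fsbigr => r _.
rewrite integralZl_indic_nnsfun// integral_indic// setIT -indic_int//.
have [r0|r0] := leP 0%R r.
  rewrite -ge0_integralZl//.
  - by apply: eq_integral => x _; rewrite EFinM [RHS]muleC muleA.
  - apply/measurable_EFinP; apply: measurable_funM => //.
  - by move=> x _; rewrite mule_ge0// lee_fin.
rewrite preimage_nnfun0//; rewrite !integral0_eq ?mule0//.
  by move=> x _; rewrite indicE in_set0 mul0e.
by move=> x _; rewrite indicE in_set0 mulr0 mule0.
Qed.

(** By definition for indicators, then for simple functions by linearity, then
by monotone convergence. *)
Lemma ge0_integral_density (f : measurableTypeR R -> \bar R) :
  measurable_fun setT f -> (forall x, 0 <= f x) ->
  \int[nu]_x f x = \int[mu]_x (f x * (g x)%:E).
Proof.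
move=> mf f0; pose h := nnsfun_approx measurableT mf.
have mh n : measurable_fun setT (fun x => (h n x)%:E).
  by apply/measurable_EFinP; exact/measurable_funP.
have approx (m : {measure set (measurableTypeR R) -> \bar R}) :
    \int[m]_x f x = lim (\int[m]_x (h n x)%:E @[n --> \oo]).
  rewrite -monotone_convergence//=.
  - apply: eq_integral => x _; apply/esym/cvg_lim => //=.
    exact: cvg_nnsfun_approx.
  - by move=> n x _; rewrite lee_fin.
  - by move=> x _ n n' nn'; rewrite lee_fin; exact/lefP/nd_nnsfun_approx.
rewrite approx.
transitivity (lim (\int[mu]_x ((h n x)%:E * (g x)%:E) @[n --> \oo])).
  by apply: congr_lim; apply/funext => n; exact: nnsfun_int.
rewrite -monotone_convergence//=.
- apply: eq_integral => x _; apply/cvg_lim => //=.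
  apply: cvgeZr => //; exact: cvg_nnsfun_approx.
- move=> n; apply: emeasurable_funM; first exact: mh.
  exact/measurable_EFinP.
- by move=> n x _; rewrite mule_ge0// lee_fin.
- move=> x _ m n mn; rewrite lee_wpmul2r ?lee_fin//.
  exact/lefP/nd_nnsfun_approx.
Qed.

End DensityIntegral.

Section SignedIntegrals.
Context {R : realType} (m : {measure set (measurableTypeR R) -> \bar R}).

(** Reduces the integral of a real function to those of |f| and f + |f|, which
can be computed by formulas for nonnegative functions. *)
Lemma integral_of_ge0 (f : R -> R) (c1 c2 : R) : measurable_fun setT f ->
  (\int[m]_x (`|f x|)%:E = c1%:E)%E ->
  (\int[m]_x (f x + `|f x|)%:E = c2%:E)%E ->
  m.-integrable setT (EFin \o f) /\ \int[m]_x f x = c2 - c1.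
Proof.
move=> mf h1 h2.
have mef : measurable_fun setT (EFin \o f) by apply/measurable_EFinP.
have mnf : measurable_fun setT (fun x => `|f x|) by exact: measurableT_comp.
have i1 : m.-integrable setT (EFin \o f).
  by apply/integrableP; split => //; rewrite [X in (X < _)%E]h1 ltry.
have i2 : m.-integrable setT (fun x => (`|f x|)%:E) by exact: integrable_norm.
split => //; have h3 : \int[m]_x (f x + `|f x|) = c2 by rewrite /Rintegral h2.
have h4 : \int[m]_x (`|f x|) = c1 by rewrite /Rintegral h1.
by rewrite -h3 RintegralD// h4 addrK.
Qed.

End SignedIntegrals.

(** * The pure point part and the diffraction measure *)

Section DyadicLayers.

Definition dyadic_layer (i : nat) : set rat :=
  [set k | dyadic k /\ (dyadic_exponent k <= i)%N].

(** If k = j / 2^i then the reduced denominator divides 2^i, hence it is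
a power of 2 with exponent at most i. *)
Lemma dyadic_layerP (i : nat) (k : rat) :
  dyadic_layer i k <-> exists j : int, k = j%:~R / 2 ^+ i.
Proof.
have p2 n : (2 ^+ n : rat) != 0 by rewrite expf_neq0.
split=> [[[r dr] ri]|[j kE]].
  have rE : dyadic_exponent k = r.
    by rewrite /dyadic_exponent dr abszX pfactorK.
  rewrite rE in ri; exists (numq k * 2 ^+ (i - r)).
  rewrite -{1}(divq_num_den k) dr intrM !rmorphXn/= -{2}(subnK ri) exprD.
  by field; rewrite !p2.
have d0 : (denq k)%:~R != 0 :> rat by rewrite intr_eq0 denq_neq0.
have E : numq k * 2 ^+ i = j * denq k.
  apply/eqP; rewrite -(eqr_int rat) !intrM rmorphXn/=; apply/eqP.
  have := divq_num_den k; rewrite kE => h; rewrite -kE in h *.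
  have -> : (numq k)%:~R = k * (denq k)%:~R by rewrite numqE.
  by rewrite {1}kE; field.
have : (`|denq k| %| 2 ^ i)%N.
  rewrite -(@Gauss_dvdr _ `|numq k|); last by rewrite coprime_sym coprime_num_den.
  apply/dvdnP; exists `|j|%N.
  by rewrite -abszM -E abszM abszX.
move/(dvdn_pfactor _ _ (isT : prime 2)) => [r ri dE].
split; first by exists r; rewrite -absz_denq dE -natz natrX.
by rewrite /dyadic_exponent dE pfactorK.
Qed.

End DyadicLayers.

Section PurePointPart.
Context {R : realType}.
Variable p : R.
Hypothesis hp : 0 <= p <= 1.

Lemma cos2pi_int (m : int) : cos (2 * pi * m%:~R) = 1 :> R.
Proof.
by have := cos_int (0 : R) 1 m; rewrite mulr0 cos0 add0r mulr1.
Qed.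

(** Beyond the exponent the phase is a multiple of 2 pi. *)
Lemma phase_factor_dyadic (k : rat) l : dyadic k -> (dyadic_exponent k < l)%N ->
  phase_factor p (ratr k) l = 1.
Proof.
move=> dk; case: l => // l; rewrite ltnS => lk.
have [j kE] : exists j : int, k = j%:~R / 2 ^+ l by apply/dyadic_layerP; split.
rewrite phase_factorE kE fmorph_div rmorphXn/= ratr_int ratr_nat.
have -> : 2 ^+ l.+1 * pi * (j%:~R / 2 ^+ l) = 2 * pi * j%:~R :> R.
  by rewrite exprS; field; rewrite expf_neq0.
by rewrite cos2pi_int; ring.
Qed.

Lemma phase_prod_dyadic (k : rat) n : dyadic k ->
  phase_prod p (ratr k) (dyadic_exponent k + n) = phase_prod p (ratr k) (dyadic_exponent k).
Proof.
move=> dk; elim: n => [|n IH]; first by rewrite addn0.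
by rewrite addnS phase_prodS IH phase_factor_dyadic ?mulr1// ltnS leq_addr.
Qed.

Lemma I_pp_ge0 k : 0 <= I_pp p k.
Proof.
by rewrite /I_pp mulr_ge0//; exact: phase_prod_ge0.
Qed.

Definition layer_weight (i : nat) (x : R) : R := (3 * 4 ^+ i)^-1 * phase_prod p x i.

Lemma layer_weight_ge0 i x : 0 <= layer_weight i x.
Proof. by rewrite mulr_ge0 ?phase_prod_ge0// invr_ge0 mulr_ge0// exprn_ge0. Qed.

(** The product is constant from the exponent r on, and the sum of (3 4^i)^-1
over i >= r is 4 / (9 4^r). *)
Lemma I_pp_series (k : rat) : dyadic k ->
  \sum_(i < n) (if (dyadic_exponent k <= i)%N then layer_weight i (ratr k) else 0)
    @[n --> \oo] --> I_pp p k.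
Proof.
move=> dk; set r := dyadic_exponent k; set P := phase_prod p (ratr k) r.
pose S n := \sum_(i < n) (if (r <= i)%N then layer_weight i (ratr k) else 0).
have E n : S (n + r)%N = 4 / 9 * 4 ^- r * P - (4 / 9 * 4 ^- r * P) * 4 ^- n.
  elim: n => [|n IH].
    rewrite add0n expr0 invr1 mulr1 subrr /S big1// => i _.
    by rewrite leqNgt ltn_ord.
  rewrite addSn /S big_ord_recr/= -/(S _) IH leq_addl.
  rewrite /layer_weight addnC phase_prod_dyadic// -/r -/P exprS exprD.
  by field; rewrite !expf_neq0.
have -> : I_pp p k = 4 / 9 * 4 ^- r * P.
  rewrite /I_pp -/r -/P; congr (_ * _).
  have -> : (4 : R) ^ (r%:Z - 1) = 4 ^+ r / 4 by rewrite expfzDr// exprnP.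
  by field; rewrite expf_neq0.
rewrite -(cvg_shiftn r); apply: (eq_cvgn (fun n => esym (E n))).
rewrite -[X in _ --> X]subr0; apply: cvgB; first exact: cvg_cst.
rewrite -[X in _ --> X](mulr0 (4 / 9 * 4 ^- r * P)); apply: cvgMr.
under eq_fun do rewrite -exprVn; apply: cvg_expr.
by rewrite ger0_norm// invf_lt1// ltr1n.
Qed.

(** Zero outside of the dyadic numbers, so that all rational numbers can serve
as the index type. *)
Definition pp_weight (k : rat) : {nonneg R} :=
  if k \in dyadic then NngNum (I_pp_ge0 k) else 0%:nng.

Definition gamma_pp : {measure set (measurableTypeR R) -> \bar R} :=
  weighted_comb pp_weight (fun k => ratr k : R).

Lemma gamma_ppE (A : set (measurableTypeR R)) : measurable A ->
  gamma_pp A = (\esum_(k in dyadic) ((I_pp p k)%:E * \d_(ratr k : R) A))%E.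
Proof.
move=> mA; rewrite weighted_combE// [RHS]esum_mkcond; apply: eq_esum => k _.
by rewrite /pp_weight; case: ifP => // _; rewrite mul0e.
Qed.

Lemma esum_swap (T U : choiceType) (a : T -> U -> \bar R) :
  (forall t u, 0 <= a t u)%E ->
  (\esum_(t in [set: T]) \esum_(u in [set: U]) a t u =
   \esum_(u in [set: U]) \esum_(t in [set: T]) a t u)%E.
Proof.
move=> a0; rewrite esum_esum// [RHS]esum_esum//.
rewrite (@reindex_esum _ _ _ ([set: U] `*`` (fun=> [set: T])) _ (fun z => (z.2, z.1)))//.
split=> [z _|z w _ _|[t u] _]//.
  by case: z w => [u t] [u' t'] /= [-> ->].
by exists (u, t).
Qed.

Lemma esum_layer (i : nat) (b : R -> \bar R) :
  (\esum_(k in dyadic_layer i) b (ratr k) =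
   \esum_(j in [set: int]) b (j%:~R / 2 ^+ i)%R)%E.
Proof.
rewrite (@reindex_esum _ _ _ [set: int] _ (fun j => j%:~R / 2 ^+ i))//.
  by apply: eq_esum => j _; rewrite fmorph_div rmorphXn/= ratr_int ratr_nat.
split=> [j _|j j' _ _|k /dyadic_layerP[j ->]]; last by exists j.
  by apply/dyadic_layerP; exists j.
have p2 : (2 ^+ i : rat)^-1 != 0 by rewrite invr_neq0// expf_neq0.
by move/(mulIf p2)/intr_inj.
Qed.

(** Exchange the sum over the points with the sum over the layers that make up
the intensity of each point. *)
Lemma ge0_integral_gamma_pp (h : R -> R) (l : R) :
  measurable_fun setT h -> (forall x, 0 <= h x) ->
  (forall i, bisummable (fun j : int =>
     layer_weight i (j%:~R / 2 ^+ i) * h (j%:~R / 2 ^+ i))) ->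
  \sum_(i < n) bilim (fun j : int => layer_weight i (j%:~R / 2 ^+ i) * h (j%:~R / 2 ^+ i))
    @[n --> \oo] --> l ->
  (\int[gamma_pp]_x (h x)%:E = l%:E)%E.
Proof.
move=> mh h0 sh hl; pose b i x := (layer_weight i x * h x)%:E.
have b0 i x : (0 <= b i x)%E by rewrite lee_fin mulr_ge0// layer_weight_ge0.
rewrite ge0_integral_weighted_comb; [|exact/measurable_EFinP|by []].
pose u k i := (if k \in dyadic_layer i then b i (ratr k) else 0)%E.
have u0 k i : (0 <= u k i)%E by rewrite /u; case: ifP.
transitivity (\esum_(k in [set: rat]) \esum_(i in [set: nat]) u k i)%E.
  apply: eq_esum => k _; rewrite -nneseries_esumT//.
  have [dk|dk] := pselect (dyadic k); last first.
    rewrite /pp_weight memNset// mul0e eseries0// => i _ _.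
    by rewrite /u memNset// => -[].
  rewrite /pp_weight mem_set//= -EFinM; apply/esym/cvg_lim => //.
  have H : (fun n => ((\sum_(i < n) (if (dyadic_exponent k <= i)%N then
      layer_weight i (ratr k) else 0)) * h (ratr k))%:E) @ \oo -->
      (I_pp p k * h (ratr k))%:E.
    apply: cvg_EFin; first exact: nearW.
    apply: cvgM; [exact: I_pp_series|exact: cvg_cst].
  apply: cvg_trans H; apply: near_eq_cvg; apply: nearW => n.
  rewrite big_mkord mulr_suml -sumEFin; apply: eq_bigr => i _.
  rewrite /u; case: ifPn => ki; first by rewrite mem_set.
  by rewrite mul0r memNset// => -[_]; apply/negP.
rewrite esum_swap// -nneseries_esumT => [|i]; last exact: esum_ge0.
apply: cvg_lim => //.
have H : (fun n => (\sum_(i < n) bilim (fun j : int =>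
     layer_weight i (j%:~R / 2 ^+ i) * h (j%:~R / 2 ^+ i)))%:E) @ \oo --> l%:E.
  by apply: cvg_EFin; first exact: nearW.
apply: cvg_trans H; apply: near_eq_cvg; apply: nearW => n.
rewrite big_mkord -sumEFin; apply: eq_bigr => i _.
rewrite -esum_bilim//; last first.
  by move=> m; rewrite mulr_ge0// layer_weight_ge0.
by rewrite -(esum_layer i (b i)) esum_mkcond.
Qed.

(** Compare each of the 2^i points in [a, a+1[ with a. A factor 2^i, and not
4^i, is essential for the layers to be summable. *)
Lemma sum_oneDsqrV_scaled i N :
  \sum_(j < N) (oneDsqr (j%:R / 2 ^+ i : R))^-1 <= 3 * 2 ^+ i.
Proof.
have i0 : 0 < 2 ^+ i :> R by rewrite exprn_gt0.
pose F (j : nat) := (oneDsqr (j%:R / 2 ^+ i : R))^-1.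
apply: (@le_trans _ _ (\sum_(j < 2 ^ i * N) F j)).
  have [M ->] : exists M, (2 ^ i * N = N + M)%N.
    exists (2 ^ i * N - N)%N; rewrite subnKC// leq_pmull// expn_gt0//.
  rewrite big_split_ord/= lerDl sumr_ge0// => j _.
  by rewrite invr_ge0 ltW// oneDsqr_pos.
rewrite (big_ord_block (2 ^ i) N F).
apply: (@le_trans _ _ (\sum_(a < N) 2 ^+ i * (oneDsqr (a%:R : R))^-1)).
  apply: ler_sum => a _.
  apply: (@le_trans _ _ (\sum_(s < 2 ^ i) (oneDsqr (a%:R : R))^-1)).
    apply: ler_sum => s _; rewrite lef_pV2 ?posrE ?oneDsqr_pos//.
    rewrite /oneDsqr lerD2l ler_sqr ?nnegrE//.
    by rewrite ler_pdivlMr// natrD natrM natrX mulrC lerDl.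
  by rewrite sumr_const card_ord -[X in X <= _]mulr_natl natrX.
by rewrite -mulr_sumr mulrC ler_wpM2r ?sum_oneDsqrV// ltW.
Qed.

(** The weights of the i-th layer are of order 4^-i and its points have density
2^i. *)
Lemma layer_bisummable (f : R -> R) C i : (forall x, `|f x| <= C / oneDsqr x) ->
  bisummable_by (2 * C * 2 ^- i)
    (fun j : int => layer_weight i (j%:~R / 2 ^+ i) * f (j%:~R / 2 ^+ i)).
Proof.
move=> fC N; have C0 := decays_const_ge0 fC.
have i0 : 0 < 2 ^+ i :> R by rewrite exprn_gt0.
apply: (@le_trans _ _ (bisum (fun j : int => (3 * 4 ^+ i)^-1 * C *
    (oneDsqr (j%:~R / 2 ^+ i))^-1) N)).
  apply: ler_bisum => j; rewrite normrM -mulrA ger0_norm ?layer_weight_ge0//.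
  apply: ler_pM => //; first exact: layer_weight_ge0.
  by rewrite ler_piMr ?phase_prod_le1// invr_ge0 mulr_ge0// exprn_ge0.
rewrite bisumZ.
have -> : 2 * C * 2 ^- i = (3 * 4 ^+ i)^-1 * C * (3 * 2 ^+ i + 3 * 2 ^+ i).
  have -> : 4 ^+ i = 2 ^+ i * 2 ^+ i :> R by rewrite -exprMn; congr (_ ^+ _); ring.
  by field; rewrite gt_eqF.
rewrite ler_wpM2l//; first by rewrite mulr_ge0// invr_ge0 mulr_ge0// exprn_ge0.
apply: lerD; first exact: sum_oneDsqrV_scaled.
apply: le_trans (sum_oneDsqrV_scaled i N.+1); rewrite big_ord_recl/=.
apply: ler_wpDl; first by rewrite invr_ge0 ltW// oneDsqr_pos.
apply: ler_sum => j _; rewrite intrN mulNr /oneDsqr sqrrN.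
by [].
Qed.

Definition pp_functional (f : R -> R) : R := limn (fun n => \sum_(i < n)
  bilim (fun j : int => layer_weight i (j%:~R / 2 ^+ i) * f (j%:~R / 2 ^+ i))).

Lemma pp_functional_cvg f : decays f ->
  \sum_(i < n) bilim (fun j : int => layer_weight i (j%:~R / 2 ^+ i) * f (j%:~R / 2 ^+ i))
   @[n --> \oo] --> pp_functional f.
Proof.
move=> [_ [C fC]]; have C0 := decays_const_ge0 fC.
pose u i := bilim (fun j : int =>
  layer_weight i (j%:~R / 2 ^+ i) * f (j%:~R / 2 ^+ i)).
suff h n : \sum_(i < n) `|u i| <= 4 * C by exact: (@series_abs_cvg _ u _ h).
apply: (@le_trans _ _ (\sum_(i < n) 2 * C * 2 ^- i)).
  by apply: ler_sum => i _; apply: bilim_norm; exact: layer_bisummable.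
have : \sum_(i < n) 2 * C * 2 ^- i = 4 * C * (1 - 2 ^- n).
  elim: n => [|n IH]; first by rewrite big_ord0 expr0 invr1 subrr mulr0.
  by rewrite big_ord_recr/= IH exprS; field; rewrite expf_neq0.
move=> ->; rewrite ler_piMr// ?mulr_ge0// gerBl invr_ge0 exprn_ge0//.
Qed.

Lemma pp_functionalD f g : decays f -> decays g ->
  pp_functional (fun x => f x + g x) = pp_functional f + pp_functional g.
Proof.
move=> df dg; apply: cvg_lim => //.
apply: (eq_cvgn _ (cvgD (@pp_functional_cvg _ df) (@pp_functional_cvg _ dg))) => n.
rewrite -[LHS]/(_ + _) -big_split/=; apply: eq_bigr => i _.
have [_ [C fC]] := df; have [_ [D gD]] := dg.
rewrite -bilimD; [|by eexists; exact: layer_bisummable fC|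
  by eexists; exact: layer_bisummable gD].
by congr bilim; apply/funext => j; rewrite mulrDr.
Qed.

Lemma decays_ge0_gamma_pp h : decays h -> (forall x, 0 <= h x) ->
  (\int[gamma_pp]_x (h x)%:E = (pp_functional h)%:E)%E.
Proof.
move=> dh h0; have [ch [C hC]] := dh.
apply: ge0_integral_gamma_pp => //; last exact: pp_functional_cvg.
  exact: continuous_measurable_fun.
by move=> i; eexists; exact: layer_bisummable hC.
Qed.

Lemma measurable_phi_ac : measurable_fun setT (phi_ac p).
Proof. by apply: continuous_measurable_fun; exact: continuous_phi_ac. Qed.

Definition gamma_ac := density_measure measurable_phi_ac (phi_ac_ge0 hp).

Lemma decays_ge0_gamma_ac h : decays h -> (forall x, 0 <= h x) ->
  (\int[gamma_ac]_x (h x)%:E = (rint (fun x => phi_ac p x * h x)%R)%:E)%E.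
Proof.
move=> dh h0; rewrite ge0_integral_density.
- rewrite /rint /Rintegral fineK; last first.
    apply: integrable_fin_num => //.
    exact: decays_integrable (decays_phi_ac hp dh).
  by apply: eq_integral => x _; rewrite -EFinM mulrC.
- by apply/measurable_EFinP; apply: continuous_measurable_fun; exact: dh.1.
- by move=> x; rewrite lee_fin.
Qed.

Definition gamma_hat : {measure set (measurableTypeR R) -> \bar R} :=
  measure_add gamma_pp gamma_ac.

(** Stated for decaying functions, which are not of one sign: the formula is
additive, so it follows from the one for nonnegative functions. *)
Lemma integral_gamma_hat f : decays f ->
  gamma_hat.-integrable setT (EFin \o f) /\
  \int[gamma_hat]_x f x = pp_functional f + rint (fun x => phi_ac p x * f x).
Proof.
have pos h : decays h -> (forall x, 0 <= h x) ->
    (\int[gamma_hat]_x (h x)%:E =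
      (pp_functional h + rint (fun x => phi_ac p x * h x))%:E)%E.
  move=> dh h0; rewrite ge0_integral_measure_add//.
  - by rewrite decays_ge0_gamma_pp// decays_ge0_gamma_ac.
  - by move=> x _; rewrite lee_fin.
  - by apply/measurable_EFinP; apply: continuous_measurable_fun; exact: dh.1.
move=> df; have dn := decays_norm df.
have dp : decays (fun x => f x + `|f x|) by exact: decaysD.
have p0 x : 0 <= f x + `|f x| by have := ler_norm (- f x); rewrite normrN => ?; lra.
have mf : measurable_fun setT f by apply: continuous_measurable_fun; exact: df.1.
have [i1 ->] := integral_of_ge0 mf (pos _ dn (fun x => normr_ge0 _)) (pos _ dp p0).
split => //; rewrite pp_functionalD//.
have -> : (fun x => phi_ac p x * (f x + `|f x|)) =
    (fun x => phi_ac p x * f x + phi_ac p x * `|f x|).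
  by apply/funext => x; rewrite mulrDr.
rewrite (rintD (decays_phi_ac hp df) (decays_phi_ac hp dn)).
by ring.
Qed.

End PurePointPart.

(** * The Fourier transform of the autocorrelation *)

Section PairCorrelationComb.
Context {R : realType} (eta : nat -> R).
Hypothesis eta_ge0 : forall d, 0 <= eta d.
Hypothesis eta_le1 : forall d, eta d <= 1.

Definition eta_weight (m : int) : {nonneg R} := NngNum (eta_ge0 (absz m)).

Definition gamma : {measure set (measurableTypeR R) -> \bar R} :=
  weighted_comb eta_weight (fun m => m%:~R : R).

Lemma ge0_integral_gamma (h : R -> R) : measurable_fun setT h ->
  (forall x, 0 <= h x) -> bisummable (fun m : int => h m%:~R) ->
  (\int[gamma]_x (h x)%:E = (pair_series eta (fun m : int => h m%:~R))%:E)%E.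
Proof.
move=> mh h0 sh; rewrite ge0_integral_weighted_comb.
- rewrite -esum_bilim//; first by move=> m; rewrite mulr_ge0.
  by apply: bisummableM sh => m; rewrite ger0_norm.
- exact/measurable_EFinP.
- by move=> x; rewrite lee_fin.
Qed.

Lemma integral_gamma (f : R -> R) : measurable_fun setT f ->
  bisummable (fun m : int => f m%:~R) ->
  gamma.-integrable setT (EFin \o f) /\
  \int[gamma]_x f x = pair_series eta (fun m : int => f m%:~R).
Proof.
move=> mf sf.
have sn : bisummable (fun m : int => `|f m%:~R|).
  by apply: bisummable_le sf => m; rewrite normr_id.
have mn : measurable_fun setT (fun x => `|f x|) by exact: measurableT_comp.
have p0 x : 0 <= f x + `|f x| by have := ler_norm (- f x); rewrite normrN => ?; lra.
have [i1 ->] := integral_of_ge0 mf (ge0_integral_gamma mn (fun x => normr_ge0 _) sn)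
   (ge0_integral_gamma (measurable_funD mf mn) p0 (bisummableD sf sn)).
split => //; rewrite /pair_series.
under [X in bilim X - _]eq_fun do rewrite mulrDr.
have b1 m : `|eta (absz m)| <= 1 by rewrite ger0_norm.
by rewrite (bilimD (bisummableM b1 sf) (bisummableM b1 sn)) addrK.
Qed.

(** A compact set is bounded, so its indicator is dominated by a multiple of
1 / (1 + x^2). *)
Lemma locally_finite_gamma : locally_finite gamma.
Proof.
move=> K cK; have mK : measurable (K : set (measurableTypeR R)).
  by apply: closed_measurable; exact: compact_closed.
have [M [_ KM]] := compact_bounded cK.
have {}KM x : K x -> `|x| <= `|M| + 1.
  by apply: KM; rewrite (le_lt_trans (ler_norm _))// ltrDl.
have mI : measurable_fun setT (\1_K : R -> R) by exact: measurable_indic.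
have sI : bisummable (fun m : int => (\1_K (m%:~R : R) : R)).
  apply: (@bisummable_decay _ (\1_K) (1 + (`|M| + 1) ^+ 2)) => x.
  rewrite indicE; have [xK|xK] := boolP (x \in K); last first.
    by rewrite normr0 divr_ge0 ?addr_ge0 ?sqr_ge0// ltW// oneDsqr_pos.
  rewrite normr1 ler_pdivlMr ?oneDsqr_pos// mul1r /oneDsqr lerD2l.
  rewrite -(real_normK (num_real x)) ler_sqr ?nnegrE ?addr_ge0//.
  by apply: KM; rewrite inE in xK.
have := ge0_integral_gamma mI (fun x => ler0n _ _) sI.
by rewrite integral_indic// setIT => ->; exact: ltry.
Qed.

Lemma bisum_finite (a : int -> R) (M n : nat) : (forall m, (M < absz m)%N -> a m = 0) ->
  bisum a (M.+1 + n) = \sum_(d < 2 * M + 1) a (d%:Z - M%:Z).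
Proof.
move=> aM.
have bS N : bisum a N.+1 = bisum a N + (a N%:Z + a (- N.+1%:Z)).
  by rewrite /bisum !big_ord_recr/= addrACA.
elim: n => [|n IH]; last first.
  by rewrite addnS bS IH (aM (M.+1 + n)%N%:Z) ?(aM (- (M.+1 + n).+1%:Z)) ?addr0//; lia.
have z : a (- M.+1%:Z) = 0 by apply: aM; lia.
rewrite addn0 /bisum [X in _ + X]big_ord_recr/= z addr0.
have -> : (2 * M + 1 = M + M.+1)%N by lia.
rewrite big_split_ord/= addrC; congr (_ + _).
  by apply: eq_bigr => i _; congr a; lia.
rewrite (reindex_inj rev_ord_inj)/=; apply: eq_bigr => i _; congr a.
by have := ltn_ord i; lia.
Qed.

Lemma bilim_finite (a : int -> R) (M : nat) : (forall m, (M < absz m)%N -> a m = 0) ->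
  bisummable a /\ bilim a = \sum_(d < 2 * M + 1) a (d%:Z - M%:Z).
Proof.
move=> aM; split.
  exists (\sum_(d < 2 * M + 1) `|a (d%:Z - M%:Z)|) => N.
  rewrite -(@bisum_finite (fun m => `|a m|) M N) => [|m Mm]; last first.
    by rewrite aM// normr0.
  rewrite addnC /bisum !big_split_ord/=; apply: lerD; rewrite lerDl;
  by apply: sumr_ge0 => i _.
apply: bilim_eq; apply: cvg_near_cst; exists M.+1 => // N /= MN.
by rewrite -(subnKC MN); exact: bisum_finite.
Qed.

Lemma integral_gamma_compact (f : R -> R) (M : nat) : continuous f ->
  (forall z, M%:R < `|z| -> f z = 0) ->
  \int[gamma]_x f x =
  \sum_(d < 2 * M + 1) f (d%:Z - M%:Z)%:~R * eta (absz (d%:Z - M%:Z)).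
Proof.
move=> cf fM.
have f0 (m : int) : (M < absz m)%N -> f m%:~R = 0.
  by move=> Mm; apply: fM; rewrite -intr_norm -abszE -pmulrn ltr_nat.
have [sf _] := bilim_finite f0.
have [_ ->] := integral_gamma (continuous_measurable_fun cf) sf.
have ef0 (m : int) : (M < absz m)%N -> eta (absz m) * f m%:~R = 0.
  by move=> Mm; rewrite f0// mulr0.
rewrite /pair_series (bilim_finite ef0).2.
by apply: eq_bigr => d _; rewrite mulrC.
Qed.

End PairCorrelationComb.

Section SchwartzFunctions.
Context {R : realType}.
Implicit Types f : R -> R.
Local Notation mu := (@lebesgue_measure R).

Lemma rintN f : decays f -> rint (fun x => - f x) = - rint f.
Proof.
move=> df; rewrite -[RHS]mulN1r -(rintZ (-1) df); congr rint.
by apply/funext => x; rewrite mulN1r.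
Qed.

Lemma rintB f h : decays f -> decays h ->
  rint (fun x => f x - h x) = rint f - rint h.
Proof.
move=> df dh; rewrite -(rintN dh) -rintD//.
have -> : (fun x => - h x) = (fun x => -1 * h x) by apply/funext => x; rewrite mulN1r.
exact: decaysZ.
Qed.

(** Moving by at most 1 costs a factor 3: 1 + x^2 <= 3 + 2 c^2. *)
Lemma oneDsqr_near (x c : R) : `|x - c| <= 1 -> (oneDsqr c)^-1 <= 3 / oneDsqr x.
Proof.
move=> xc; rewrite ler_pdivlMr ?oneDsqr_pos// mulrC ler_pdivrMr ?oneDsqr_pos//.
move: xc; rewrite /oneDsqr ler_norml => /andP[h1 h2].
have : 0 <= (x - 2 * c) ^+ 2 by exact: sqr_ge0.
have : 0 <= (1 - (x - c)) * (1 + (x - c)) by apply: mulr_ge0; lra.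
by move=> h3 h4; nra.
Qed.

Lemma schwartz_derive1 f : schwartz_real f -> schwartz_real (derive1 f).
Proof.
have E n : derive1n n (derive1 f) = derive1n n.+1 f by rewrite /derive1n -iterSr.
by move=> [df bf]; split=> [n x|m n]; rewrite E; [exact: df|exact: bf].
Qed.

Lemma schwartz_decay f : schwartz_real f -> exists C, forall x, `|f x| <= C / oneDsqr x.
Proof.
move=> [_ bf]; have [C0 h0] := bf 0%N 0%N; have [C2 h2] := bf 2%N 0%N.
exists (C0 + C2) => x; rewrite ler_pdivlMr ?oneDsqr_pos//.
have := h0 x; have := h2 x; rewrite /= expr0 mul1r normrM => h h'.
rewrite /oneDsqr mulrDr mulr1; apply: lerD => //.
by rewrite mulrC -[x ^+ 2]ger0_norm ?sqr_ge0.
Qed.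

Lemma schwartz_lip_decay f : schwartz_real f -> lip_decay f.
Proof.
move=> sf; have [C fC] := schwartz_decay sf; have C0 := decays_const_ge0 fC.
have [D fD] := schwartz_decay (schwartz_derive1 sf); have D0 := decays_const_ge0 fD.
have df (x : R) : is_derive x (1 : R) f (derive1 f x).
  by rewrite derive1E; apply: derivableP; exact: sf.1 0%N x.
have cf : continuous f.
  by move=> x; apply: differentiable_continuous; apply/derivable1_diffP; exact: sf.1 0%N x.
have step x y : x <= y -> exists2 c, x <= c <= y & f y - f x = derive1 f c * (y - x).
  move=> xy; have [c] := @MVT_segment R f (derive1 f) x y xy (fun z _ => df z)
    (continuous_subspaceT cf).
  by rewrite in_itv/=; exists c.
exists (C + 3 * D) => [x|x h h1].
  apply: le_trans (fC x) _; apply: ler_wpM2r; first by rewrite invr_ge0 ltW// oneDsqr_pos.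
  by rewrite lerDl mulr_ge0.
have [c cx ->] : exists2 c, `|x - c| <= 1 & `|f (x + h) - f x| = `|derive1 f c| * `|h|.
  move: h1; rewrite ler_norml => /andP[h1 h2].
  have [h0|h0] := leP 0 h.
    have [c /andP[c1 c2] E] := step x (x + h) ltac:(by rewrite lerDl).
    exists c; first by rewrite ler_norml; apply/andP; split; lra.
    by rewrite E addrC addKr normrM.
  have [c /andP[c1 c2] E] := step (x + h) x ltac:(by rewrite gerDl ltW).
  exists c; first by rewrite ler_norml; apply/andP; split; lra.
  by rewrite distrC E opprD addNKr normrM normrN.
have h3 : `|derive1 f c| <= 3 * D / oneDsqr x.
  apply: le_trans (fD c) _; rewrite [3 * D]mulrC -mulrA ler_wpM2l//.
  exact: oneDsqr_near.
apply: le_trans (ler_wpM2r (normr_ge0 h) h3) _.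
rewrite mulrAC; apply: ler_wpM2r; first by rewrite invr_ge0 ltW// oneDsqr_pos.
by rewrite ler_wpM2r// lerDr.
Qed.

(** The mean value theorem for f(y + h) - f(y), whose derivative is of order h
by the Lipschitz bound for the derivative of [f]. *)
Lemma schwartz_second_difference f : schwartz_real f -> exists C, forall x h, 0 <= h <= 1 ->
  `|2 * f x - f (x + h) - f (x - h)| <= C * h ^+ 2 / oneDsqr x.
Proof.
move=> sf; have [C _ fL] := schwartz_lip_decay (schwartz_derive1 sf).
have C0 : 0 <= C.
  have := fL 0 1; rewrite normr1 mulr1 /oneDsqr expr0n addr0 divr1 => /(_ (lexx _)).
  exact: le_trans.
exists (3 * C) => x h /andP[h0 h1].
have dsf y : derivable f y 1 by exact: sf.1 0%N y.
pose G y := f (y + h) - f y.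
have dG (y : R) : is_derive y (1 : R) G (derive1 f (y + h) - derive1 f y).
  have d1 : is_derive y (1 : R) (fun y : R => y + h) 1.
    by apply: is_derive_eq; rewrite ?addr0.
  have d2 : is_derive (y + h) (1 : R) f (derive1 f (y + h)).
    by rewrite derive1E; exact: derivableP.
  have d3 := @is_derive1_comp _ f (fun y : R => y + h) y _ _ d2 d1.
  have d4 : is_derive y (1 : R) f (derive1 f y) by rewrite derive1E; exact: derivableP.
  rewrite -[derive1 f (y + h)]mulr1; exact: is_deriveB.
have cG : continuous G.
  move=> y; apply: differentiable_continuous; apply/derivable1_diffP.
  by have [] := dG y.
have xh : x - h <= x by rewrite gerBl.
have [c] := @MVT_segment R G _ (x - h) x xh (fun z _ => dG z) (continuous_subspaceT cG).
rewrite in_itv/= => /andP[c1 c2]; rewrite /G subrK => E.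
have -> : 2 * f x - f (x + h) - f (x - h) = - (f (x + h) - f x - (f x - f (x - h))).
  by ring.
have xxh : x - (x - h) = h by ring.
rewrite normrN E xxh normrM (ger0_norm h0).
have hh : `|h| <= 1 by rewrite ger0_norm.
have := fL c h hh; rewrite (ger0_norm h0) => H.
apply: le_trans (ler_wpM2r h0 H) _.
have -> : C * h / oneDsqr c * h = C * h ^+ 2 * (oneDsqr c)^-1 by ring.
have -> : 3 * C * h ^+ 2 / oneDsqr x = C * h ^+ 2 * (3 / oneDsqr x) by ring.
apply: ler_wpM2l; first by rewrite mulr_ge0// sqr_ge0.
by apply: oneDsqr_near; rewrite ler_norml; apply/andP; split; lra.
Qed.

Lemma quadratic_decay_bisummable (c : int -> R) K :
  (forall m : int, `|c (- m)| = `|c m|) ->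
  (forall n : nat, (0 < n)%N -> `|c n%:Z| <= K / n%:R ^+ 2) -> bisummable c.
Proof.
move=> cN cK.
have K0 : 0 <= K by have := cK 1%N isT; rewrite expr1n divr1; exact: le_trans.
have h : bisummable (fun k : int => (oneDsqr (k%:~R : R))^-1).
  by exists 6; exact: bisummable_oneDsqrV.
apply: bisummable_le (bisummableZ (`|c 0| + 2 * K) h) => m.
apply: le_trans _ (ler_norm _).
have pos (n : nat) : `|c n%:Z| <= (`|c 0| + 2 * K) / oneDsqr (n%:R : R).
  case: n => [|n].
    by rewrite /oneDsqr expr0n addr0 divr1 lerDl mulr_ge0.
  apply: le_trans (cK n.+1 isT) _.
  have n1 : 1 <= n.+1%:R :> R by rewrite ler1n.
  have n0 : 0 < n.+1%:R ^+ 2 :> R by rewrite exprn_gt0// ltr0n.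
  rewrite ler_pdivrMr// mulrAC ler_pdivlMr ?oneDsqr_pos// /oneDsqr.
  have n2 : 1 <= n.+1%:R ^+ 2 :> R by rewrite exprn_ege1.
  have := normr_ge0 (c 0); move: n2; move: (n.+1%:R ^+ 2) `|c 0| => z y z1 y0.
  have : 0 <= K * (z - 1) by rewrite mulr_ge0// subr_ge0.
  have : 0 <= y * z by rewrite mulr_ge0//; lra.
  by move=> *; nra.
case: m => n; first exact: pos.
rewrite NegzE cN; apply: le_trans (pos n.+1) _.
by rewrite intrN /oneDsqr sqrrN.
Qed.

Lemma schwartz_osc (u : R -> R) f : schwartz_real f ->
  continuous u -> (forall x, `|u x| <= 1) -> (forall x, u (x + pi) = - u x) ->
  exists K, forall n : nat, (0 < n)%N ->
    `|rint (fun x => u (2 * pi * n%:R * x) * f x)| <= K / n%:R ^+ 2.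
Proof.
move=> sf cu u1 upi; have [C fC] := schwartz_second_difference sf.
exists (C / 16 * rint (fun x => (oneDsqr x)^-1)) => n n0.
exact: osc_bound n0 cu u1 upi (lip_decay_decays (schwartz_lip_decay sf)) fC.
Qed.

Lemma cos_coefN f k : cos_coef f (- k) = cos_coef f k.
Proof.
rewrite /cos_coef; congr rint; apply/funext => x.
by rewrite mulrN mulNr cosN.
Qed.

Lemma sin_coefN f k : decays f -> sin_coef f (- k) = - sin_coef f k.
Proof.
move=> df; rewrite /sin_coef -rintN; last exact: decays_sin.
by congr rint; apply/funext => x; rewrite mulrN mulNr sinN mulNr.
Qed.

Lemma cos_coef_bisummable f : schwartz_real f ->
  bisummable (fun m : int => cos_coef f m%:~R).
Proof.
move=> sf; have [K cK] := schwartz_osc sf (@continuous_cos R) (@norm_cos_le1 R) (@cosDpi R).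
apply: (@quadratic_decay_bisummable _ K) => [m|n n0]; last exact: cK.
by rewrite intrN cos_coefN.
Qed.

Lemma sin_coef_bisummable f : schwartz_real f ->
  bisummable (fun m : int => sin_coef f m%:~R).
Proof.
move=> sf; have df := lip_decay_decays (schwartz_lip_decay sf).
have [K cK] := schwartz_osc sf (@continuous_sin R) (@norm_sin_le1 R) (@sinDpi R).
apply: (@quadratic_decay_bisummable _ K) => [m|n n0]; last exact: cK.
by rewrite intrN sin_coefN// normrN.
Qed.

Lemma schwartz_decays_id f : schwartz_real f -> decays (fun x => x * f x).
Proof.
move=> sf; have df := lip_decay_decays (schwartz_lip_decay sf); split.
  by move=> x; apply: cvgM; [exact: cvg_id|exact: df.1].
have [C1 h1] := sf.2 1%N 0%N; have [C3 h3] := sf.2 3%N 0%N.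
exists (C1 + C3) => x; rewrite ler_pdivlMr ?oneDsqr_pos//.
have := h1 x; have := h3 x; rewrite /= expr1 => h h'.
rewrite /oneDsqr mulrDr mulr1; apply: lerD => //.
rewrite -[x ^+ 2]ger0_norm ?sqr_ge0// -normrM.
by rewrite (_ : x * f x * x ^+ 2 = x ^+ 3 * f x)//; ring.
Qed.

(** The Lipschitz constant is the first absolute moment of [f], up to the factor
2 pi. This gives the measurability of the Fourier transform. *)
Lemma lipschitz_coef (u : R -> R) f : continuous u -> (forall x, `|u x| <= 1) ->
  (forall x y, `|u x - u y| <= `|x - y|) -> schwartz_real f ->
  continuous (fun k => rint (fun x => u (2 * pi * k * x) * f x)).
Proof.
move=> cu u1 uL sf; have df := lip_decay_decays (schwartz_lip_decay sf).
have dx := decays_norm (schwartz_decays_id sf).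
apply: (@lipschitz_continuous _ _ (2 * pi * rint (fun x => `|x * f x|))) => k k'.
have d l : decays (fun x => u (2 * pi * l * x) * f x).
  by apply: (@decaysM _ _ _ 1) df => [x|]; [exact: u1|exact: continuous_lin].
have dd : decays (fun x => u (2 * pi * k * x) * f x - u (2 * pi * k' * x) * f x).
  under eq_fun do rewrite -mulN1r.
  by apply: decaysD => //; exact: decaysZ.
rewrite -rintB//; apply: le_trans (ler_norm_rint dd) _.
rewrite [leRHS]mulrAC -(rintZ (2 * pi * `|k - k'|) dx).
apply: ler_rint => [||x]; [exact: decays_norm|exact: decaysZ|].
rewrite -mulrBl normrM.
apply: le_trans (ler_wpM2r (normr_ge0 _) (uL _ _)) _.
have -> : `|2 * pi * k * x - 2 * pi * k' * x| = 2 * pi * `|k - k'| * `|x|.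
  rewrite -mulrBl -mulrBr 2!normrM; congr (_ * _ * _).
  by rewrite ger0_norm// mulr_ge0// pi_ge0.
by rewrite normrM -!mulrA.
Qed.

Lemma measurable_cos_coef f : schwartz_real f -> measurable_fun setT (cos_coef f).
Proof.
move=> sf; apply: continuous_measurable_fun.
exact: lipschitz_coef (@continuous_cos R) (@norm_cos_le1 R) (@cos_lip R) sf.
Qed.

Lemma measurable_sin_coef f : schwartz_real f -> measurable_fun setT (sin_coef f).
Proof.
move=> sf; apply: continuous_measurable_fun.
exact: lipschitz_coef (@continuous_sin R) (@norm_sin_le1 R) (@sin_lip R) sf.
Qed.

Lemma Re_fourier (g : R -> complex R) k : schwartz g ->
  complex.Re (fourier g k) =
    cos_coef (fun x => complex.Re (g x)) k + sin_coef (fun x => complex.Im (g x)) k.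
Proof.
move=> [/schwartz_lip_decay/lip_decay_decays dr /schwartz_lip_decay/lip_decay_decays di].
rewrite /cos_coef /sin_coef -rintD; [|exact: decays_cos|exact: decays_sin].
rewrite /fourier /cintegral /=; congr Rintegral; apply/funext => x.
by rewrite /expi cosN sinN; case: (g x) => a b /=; ring.
Qed.

Lemma Im_fourier (g : R -> complex R) k : schwartz g ->
  complex.Im (fourier g k) =
    cos_coef (fun x => complex.Im (g x)) k - sin_coef (fun x => complex.Re (g x)) k.
Proof.
move=> [/schwartz_lip_decay/lip_decay_decays dr /schwartz_lip_decay/lip_decay_decays di].
rewrite /cos_coef /sin_coef -[- rint _]mulN1r -rintZ; last exact: decays_sin.
rewrite -rintD; [|exact: decays_cos|by apply: decaysZ; exact: decays_sin].
rewrite /fourier /cintegral /=; congr Rintegral; apply/funext => x.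
by rewrite /expi cosN sinN; case: (g x) => a b /=; ring.
Qed.

End SchwartzFunctions.

Section FourierTransform.
Context {R : realType} (p : R).
Hypothesis hp : 0 <= p <= 1.
Variable eta : nat -> R.
Hypothesis eta_ge0 : forall d, 0 <= eta d.
Hypothesis eta_le1 : forall d, eta d <= 1.
Hypothesis eta_0 : eta 0%N = 2 / 3.
Hypothesis eta_1 : eta 1%N = 1 / 3 + p * (1 - p) / 2 * eta 1%N.
Hypothesis eta_e : forall j, (0 < j)%N ->
  eta (2 * j)%N = 1 / 3 + (p ^+ 2 + (1 - p) ^+ 2) / 2 * eta j.
Hypothesis eta_o : forall j, (0 < j)%N ->
  eta (2 * j).+1 = 1 / 3 + p * (1 - p) / 2 * (eta j + eta j.+1).

Let eta_bound m : `|eta m| <= 1.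
Proof. by rewrite ger0_norm. Qed.

Let sin_series f : schwartz_real f ->
  pair_series eta (fun m : int => sin_coef f m%:~R) = 0.
Proof.
move=> sf; have df := lip_decay_decays (schwartz_lip_decay sf).
rewrite /pair_series; apply: bilim_odd_eq0.
  by apply: bisummableM => [m|]; [exact: eta_bound|exact: sin_coef_bisummable].
by move=> j; rewrite abszN intrN sin_coefN// mulrN.
Qed.

(** Real and imaginary parts of the Fourier transform both have the form of the
integrand, with s = 1 and s = -1. The autocorrelation is symmetric, so the
sine part contributes nothing. *)
Lemma gamma_fourier_pairing f h (s : R) : schwartz_real f -> schwartz_real h ->
  (gamma eta_ge0).-integrable setT
    (EFin \o (fun k => cos_coef f k + s * sin_coef h k)) /\
  \int[gamma eta_ge0]_k (cos_coef f k + s * sin_coef h k) =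
    \int[gamma_hat hp]_x f x.
Proof.
move=> sf sh; have nf := schwartz_lip_decay sf.
have bf := cos_coef_bisummable sf; have bh := bisummableZ s (sin_coef_bisummable sh).
have mf : measurable_fun setT (fun k => cos_coef f k + s * sin_coef h k).
  apply: measurable_funD; first exact: measurable_cos_coef.
  by apply: measurable_funM => //; exact: measurable_sin_coef.
have [i1 ->] := integral_gamma eta_ge0 eta_le1 mf (bisummableD bf bh).
split => //; have [_ ->] := integral_gamma_hat hp (lip_decay_decays nf).
have -> : pair_series eta (fun m : int => cos_coef f m%:~R + s * sin_coef h m%:~R) =
    pair_series eta (fun m : int => cos_coef f m%:~R) +
    s * pair_series eta (fun m : int => sin_coef h m%:~R).
  rewrite /pair_series -bilimZ; last first.
    by apply: bisummableM => [m|]; [exact: eta_bound|exact: sin_coef_bisummable].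
  rewrite -bilimD.
  - by congr bilim; apply/funext => m; ring.
  - by apply: bisummableM bf => m; exact: eta_bound.
  - apply: bisummableZ; apply: bisummableM => [m|]; first exact: eta_bound.
    exact: sin_coef_bisummable.
rewrite sin_series// mulr0 addr0.
have h1 := @pair_series_decomposition _ _ hp _ eta_bound eta_0 eta_1 eta_e eta_o _ nf bf.
have h2 := pp_functional_cvg hp (lip_decay_decays nf).
have : pp_functional p f = pair_series eta (fun m : int => cos_coef f m%:~R) -
  rint (fun x => phi_ac p x * f x) by exact: (cvg_unique _ h2 h1).
by move=> ->; rewrite subrK.
Qed.

Lemma gamma_hat_fourier : is_fourier_transform (gamma eta_ge0) (gamma_hat hp).
Proof.
move=> g sg; have [sr si] := sg.
have dr := lip_decay_decays (schwartz_lip_decay sr); have di := lip_decay_decays (schwartz_lip_decay si).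
have [ir er] := gamma_fourier_pairing 1 sr si.
have [ii ei] := gamma_fourier_pairing (-1) si sr.
have Er : (fun k => complex.Re (fourier g k)) = (fun k =>
    cos_coef (fun x => complex.Re (g x)) k + 1 * sin_coef (fun x => complex.Im (g x)) k).
  by apply/funext => k; rewrite Re_fourier// mul1r.
have Ei : (fun k => complex.Im (fourier g k)) = (fun k =>
    cos_coef (fun x => complex.Im (g x)) k + -1 * sin_coef (fun x => complex.Re (g x)) k).
  by apply/funext => k; rewrite Im_fourier// mulN1r.
split.
- split.
  + by rewrite -[X in _.-integrable _ X]/(EFin \o (fun k => complex.Re (fourier g k))) Er.
  + by rewrite -[X in _.-integrable _ X]/(EFin \o (fun k => complex.Im (fourier g k))) Ei.
- by split; [exact: (integral_gamma_hat hp dr).1|exact: (integral_gamma_hat hp di).1].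
- rewrite /cintegral Er Ei er ei.
  by [].
Qed.

End FourierTransform.

(** * The diffraction of almost every tiling *)

Lemma countable_ratr {R : realType} : countable (range (fun k : rat => ratr k : R)).
Proof. exact: (card_le_trans (card_image_le _ _) (countableP _)). Qed.

Section Decomposition.
Context {R : realType} (p : R).
Hypothesis hp : 0 <= p <= 1.

Lemma pure_point_gamma_pp : pure_point (gamma_pp (R := R) p).
Proof.
exists (range (fun k : rat => ratr k : R)); first exact: countable_ratr.
have mS : measurable (~` range (fun k : rat => ratr k : R) : set (measurableTypeR R)).
  by apply: measurableC; apply: countable_measurable => [x|]; [exact: measurable_set1|exact: countable_ratr].
rewrite gamma_ppE// esum1// => k _; rewrite diracE memNset ?mule0// => h.
by apply: h; exists k.
Qed.

Lemma gamma_ac_dominated : gamma_ac hp `<< @lebesgue_measure R.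
Proof.
apply/null_content_dominatesP => A mA A0.
apply: null_set_integral => //; apply/measurable_EFinP.
  exact: measurable_funS (measurable_phi_ac hp).
Qed.

End Decomposition.

(** Joins the two halves of the proof: the counting limit identifies the
autocorrelation, the recursion its Fourier transform. *)
Lemma is_diffraction_hull (R : realType) (p : R) (hp : 0 <= p <= 1)
    (mu : probability full_shift R) (hmu : is_word_frequency_measure p mu)
    (B : nat -> set R) (hB : averaging_sequence B) x t :
  generic mu x -> 0 < t < 1 ->
  is_diffraction B (left_endpoints (translate t (tiling_of x)) true) (gamma_hat hp).
Proof.
move=> gx t01.
have etaP m : mean_cvg p (pair_obs m) (pair_corr mu m) by exact: (@pair_corr_cvg _ _ hp _ hmu m).
have e0 d : 0 <= pair_corr mu d by have /andP[] := pair_corr_bounds hp hmu d.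
have e1 d : pair_corr mu d <= 1 by have /andP[] := pair_corr_bounds hp hmu d.
exists (gamma e0); last first.
  apply: gamma_hat_fourier => //.
  - exact: (@pair_mean_0 _ _ hp _ etaP).
  - exact: (@pair_mean_1 _ _ hp _ etaP).
  - by move=> j; exact: (@pair_mean_even _ _ hp _ etaP).
  - by move=> j; exact: (@pair_mean_odd _ _ hp _ etaP).
split; first exact: locally_finite_gamma.
move=> f cf [r fr].
pose M := (Num.trunc `|r|).+1.
have fM z : M%:R < `|z| -> f z = 0.
  move=> Mz; apply: fr; apply: le_lt_trans (ler_norm r) _; apply: le_lt_trans Mz.
  by apply: ltW; exact: truncnS_gt.
rewrite (integral_gamma_compact e0 e1 cf fM).
apply: autocorrelation_cvg => // d.
by rewrite ger0_norm.
Qed.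

Theorem theorem6p10 (R : realType) (p : R) (hp : 0 < p < 1)
    (B : nat -> set R) (hB : averaging_sequence B)
    (nu : probability (hull_space p) R)
    (hnu : is_patch_frequency_measure nu) :
  {ae nu, forall T : hull_space p, geometric_hull p T ->
    exists gammahat gamma_pp gamma_ac :
        {measure set (measurableTypeR R) -> \bar R},
    [/\ is_diffraction B (left_endpoints T true) gammahat,
        forall A, measurable A -> gammahat A = (gamma_pp A + gamma_ac A)%E,
        pure_point gamma_pp /\ gamma_ac `<< @lebesgue_measure R,
        forall A, measurable A ->
          gamma_pp A =
            (\esum_(k in dyadic) ((I_pp p k)%:E * \d_(ratr k : R) A))%E
      & forall A, measurable A ->
          gamma_ac A = (\int[lebesgue_measure]_(k in A) (phi_ac p k)%:E)%E]}.
Proof.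
have hp' : 0 <= p <= 1 by have /andP[p0 p1] := hp; rewrite !ltW.
have [mu hmu nuE] := hnu.
have [E [mE E0 gE]] := ae_generic hp' hmu.
have [mu1 _ _] := hmu.
apply: filterS (ae_lifted mu1 nuE mE E0) => T [x [t [Ex t01 ->]]] _.
exists (gamma_hat hp'), (gamma_pp p), (gamma_ac hp'); split.
- exact: is_diffraction_hull hmu _ hB _ _ (gE _ Ex) t01.
- by move=> A _; exact: measure_addE.
- by split; [exact: pure_point_gamma_pp|exact: gamma_ac_dominated].
- exact: gamma_ppE.
- by [].
Qed.
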